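(* Let $n,p,N$ be positive integers with $2\le p\le N+1$ and let $\tau=\{t_0,\dots,t_N\}$ with real numbers $t_0<t_1<\dots<t_N$. Given a set of data functions $\{f_0,f_1,\dots,f_N\}\subset W^{2p-2}(\mathbb{T}^n)$, let $S\in\mathcal{S}_p(\tau,n)$ be the (unique) Beppo Levi polyspline that satisfies $S(t_j,y)=f_j(y)$ for all $j\in\{0,1,\dots,N\}$, $y\in\mathbb{T}^n$. If $F\in\mathcal{B}_p$ is any other function ($F\neq S$) satisfying $F(t_j,y)=f_j(y)$ for all $j\in\{0,\dots,N\}$ and all $y\in\mathbb{T}^n$, then $$\|S\|_{\mathcal{B}_p}<\|F\|_{\mathcal{B}_p}.$$
   Context: $\mathbb{T}:=[-\pi,\pi]$. Points of $\mathbb{R}^{n+1}$ are written $(t,y)$ with $t\in\mathbb{R}$, $y\in\mathbb{R}^n$. $|\xi|$ is the Euclidean norm of $\xi\in\mathbb{R}^n$ and $\langle\cdot,\cdot\rangle$ the dot product. For a non-negative integer $r$, $W^r(\mathbb{T}^n)$ is the space of all continuous functions $f:\mathbb{R}^n\to\mathbb{C}$ that are $2\pi$-periodic in each variable and satisfy $\sum_{\xi\in\mathbb{Z}^n}|\widehat f_\xi|(1+|\xi|)^r<\infty$, where $\widehat f_\xi:=\int_{\mathbb{T}^n}e^{-i\langle\xi,y\rangle}f(y)\,dy$. Set $t_{-1}:=-\infty$, $t_{N+1}:=\infty$ and $\Omega_j:=\{(t,y)\in\mathbb{R}\times\mathbb{R}^n: t\in(t_{j-1},t_j)\}$ for $j\in\{0,1,\dots,N+1\}$.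 A function is polyharmonic of order $p$ on an open set if $\Delta^p S=0$ there (classically), $\Delta$ being the Laplace operator in $\mathbb{R}^{n+1}$. A function $S:\mathbb{R}^{n+1}\to\mathbb{C}$ is a Beppo Levi polyspline of order $p$ on strips determined by $\tau$ in $\mathbb{R}^{n+1}$ if: (i) $S\in C^{2p-2}(\mathbb{R}^{n+1})$; (ii) $S$ is polyharmonic of order $p$ on each open strip $\Omega_j$, $j\in\{0,1,\dots,N+1\}$; (iii) $S$ is $2\pi$-periodic in each of its last $n$ variables; (iv) $\partial^\alpha S\in L^2(\mathbb{R}\times\mathbb{T}^n)$ for all multi-indices $\alpha\in\mathbb{Z}_+^{n+1}$ with $|\alpha|=p$. The space of all such functions is denoted $\mathcal{S}_p(\tau,n)$. For data in $W^{2p-2}(\mathbb{T}^n)$ there is exactly one $S\in\mathcal{S}_p(\tau,n)$ satisfying the interpolation conditions. $\mathcal{B}_p$ is the space of all functions $F\in C^p(\mathbb{R}^{n+1})$ (complex-valued) that are $2\pi$-periodic in each of the last $n$ variables and satisfy $\partial^\alpha F\in L^2(\mathbb{R}\times\mathbb{T}^n)$ for all $|\alpha|=p$, with the seminorm $$\|F\|_{\mathcal{B}_p}:=\Big(\int_{\mathbb{R}\times\mathbb{T}^n}\sum_{|\alpha|=p}\frac{p!}{\alpha!}|\partial^\alpha F(t,y)|^2\,dt\,dy\Big)^{1/2}.$$ One has $\mathcal{S}_p(\tau,n)\subset\mathcal{B}_p$ for $p\ge2$. *)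

(* Defs.v *)
From HB Require Import structures.
From mathcomp Require Import all_boot all_order all_algebra.
From mathcomp Require Import all_classical all_reals all_analysis.
From mathcomp Require Import complex.

Set Implicit Arguments.
Unset Strict Implicit.
Unset Printing Implicit Defensive.

Import Order.TTheory GRing.Theory Num.Theory numFieldNormedType.Exports.

Local Open Scope classical_set_scope.
Local Open Scope complex_scope.
Local Open Scope ring_scope.

(* Row vectors carry the sigma-algebra generated by the coordinates, that is,
   the Borel sigma-algebra of R^n. *)
Definition rV_display : measure_display.
Proof. exact: default_measure_display. Qed.

Section measurable_rV.
Context {R : realType} (n : nat).

Let coord (i : 'I_n) (x : 'rV[R]_n) : measurableTypeR R := x ord0 i.

Let rV_set0 : g_sigma_preimage coord set0.
Proof. exact: sigma_algebra0. Qed.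

Let rV_setC A : g_sigma_preimage coord A -> g_sigma_preimage coord (~` A).
Proof. exact: sigma_algebraC. Qed.

Let rV_bigcup (F : _^nat) : (forall i, g_sigma_preimage coord (F i)) ->
  g_sigma_preimage coord (\bigcup_i (F i)).
Proof. exact: sigma_algebra_bigcup. Qed.

HB.instance Definition _ := @isMeasurable.Build rV_display
  'rV[R]_n (g_sigma_preimage coord) rV_set0 rV_setC rV_bigcup.

Lemma measurable_coord (i : 'I_n) :
  measurable_fun [set: 'rV[R]_n] (coord i).
Proof.
move=> _ Y mY; rewrite setTI; apply: sub_sigma_algebra => /=.
rewrite -bigcup_seq/=; exists i => /=; first by rewrite mem_index_enum.
by exists Y => //; rewrite setTI.
Qed.

Lemma measurable_fun_rV d (T : measurableType d) (f : T -> 'rV[R]_n) :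
  (forall i, measurable_fun [set: T] (coord i \o f)) ->
  measurable_fun [set: T] f.
Proof.
move=> mf _ A mA; rewrite setTI.
have : g_sigma_preimage (fun i => coord i \o f) (f @^-1` A).
  by rewrite g_sigma_preimage_comp; exists A => //; rewrite setTI.
apply: smallest_sub; first exact: sigma_algebra_measurable.
rewrite -bigcup_seq/=; apply: bigcup_sub => i _ B [C mC <-].
exact: mf.
Qed.

End measurable_rV.

Definition point {R : realType} {n : nat} (t : R) (y : 'rV[R]_n) :
    'rV[R]_n.+1 :=
  row_mx (t%:M : 'rV[R]_1) y.

Section lebesgue_rV.
Context {R : realType}.

Definition cons_rV n (p : measurableTypeR R * 'rV[R]_n) : 'rV[R]_n.+1 :=
  point (p.1 : R) p.2.

Lemma cons_rV0 n (p : measurableTypeR R * 'rV[R]_n) :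
  cons_rV p ord0 ord0 = p.1.
Proof.
by rewrite mxE; case: splitP => // j _; rewrite ord1 mxE (ord1 j).
Qed.

Lemma cons_rVS n (p : measurableTypeR R * 'rV[R]_n) j :
  cons_rV p ord0 (lift ord0 j) = p.2 ord0 j.
Proof.
rewrite mxE; case: splitP => k /= jk; first by case: k jk => -[].
by congr (p.2 _ _); apply/val_inj/eqP; rewrite -eqSS -[k.+1]jk.
Qed.

Lemma measurable_cons_rV n : measurable_fun setT (@cons_rV n).
Proof.
apply: measurable_fun_rV => i; case: (unliftP ord0 i) => [j|] ->.
  rewrite (_ : _ \o _ = (fun x : 'rV[R]_n => x ord0 j : measurableTypeR R) \o snd).
    by apply: measurableT_comp => //; exact: measurable_coord.
  by apply/funext => p /=; rewrite cons_rVS.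
rewrite (_ : _ \o _ = fst) //; apply/funext => p /=; exact: cons_rV0.
Qed.

Definition uncons_rV n (x : 'rV[R]_n.+1) : measurableTypeR R * 'rV[R]_n :=
  (x ord0 ord0, \row_j x ord0 (lift ord0 j)).

Lemma measurable_uncons_rV n : measurable_fun setT (@uncons_rV n).
Proof.
apply: measurable_fun_pair; first exact: measurable_coord.
apply: measurable_fun_rV => j.
rewrite (_ : _ \o _ =
  (fun x : 'rV[R]_n.+1 => x ord0 (lift ord0 j) : measurableTypeR R)).
  exact: measurable_coord.
by apply/funext => x /=; rewrite mxE.
Qed.

Lemma cons_rVK n : cancel (@cons_rV n) (@uncons_rV n).
Proof.
move=> p; rewrite /uncons_rV cons_rV0; case: p => a y /=; congr pair.
by apply/rowP => j; rewrite mxE cons_rVS.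
Qed.

Section step.
Context (n : nat) (mu : {sigma_finite_measure set 'rV[R]_n -> \bar R}).

Definition lebesgue_rV_step : set 'rV[R]_n.+1 -> \bar R :=
  pushforward (@lebesgue_measure R \x mu)%E (@cons_rV n).

Let step0 : lebesgue_rV_step set0 = 0%E.
Proof. by rewrite /lebesgue_rV_step /pushforward preimage_set0 measure0. Qed.

Let step_ge0 A : (0 <= lebesgue_rV_step A)%E.
Proof. by rewrite /lebesgue_rV_step /pushforward; exact: measure_ge0. Qed.

Let step_sigma_additive : semi_sigma_additive lebesgue_rV_step.
Proof.
move=> F mF tF mUF; rewrite /lebesgue_rV_step /pushforward preimage_bigcup.
apply: measure_semi_sigma_additive.
- by move=> k; rewrite -[X in measurable X]setTI; exact: measurable_cons_rV.
- apply/trivIsetP => /= i j _ _ ij; rewrite -preimage_setI.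
  by move/trivIsetP : tF => /(_ _ _ _ _ ij) ->//; rewrite preimage_set0.
- rewrite -preimage_bigcup -[X in measurable X]setTI.
  exact: measurable_cons_rV.
Qed.

HB.instance Definition _ := isMeasure.Build _ _ _ lebesgue_rV_step
  step0 step_ge0 step_sigma_additive.

Let step_sigma_finite : sigma_finite setT lebesgue_rV_step.
Proof.
have /sigma_finiteP[G [GT ndG Gfin]] := sigma_finiteT mu.
have /sigma_finiteP[H [HT ndH Hfin]] := sigma_finiteT (@lebesgue_measure R).
exists (fun k => @uncons_rV n @^-1` (H k `*` G k)).
  rewrite -preimage_bigcup (_ : \bigcup_k _ = setT) ?preimage_setT//.
  apply/seteqP; split => // -[a y] _.
  have [k _ Hka] : (\bigcup_k H k) a by rewrite -HT.
  have [l _ Gly] : (\bigcup_k G k) y by rewrite -GT.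
  exists (maxn k l) => //; split.
    by move: a Hka; exact/subsetPset/ndH/leq_maxl.
  by move: y Gly; exact/subsetPset/ndG/leq_maxr.
move=> k; have [mHk Hk] := Hfin k; have [mGk Gk] := Gfin k; split.
  rewrite -[X in measurable X]setTI; apply: measurable_uncons_rV => //.
  exact: measurableX.
rewrite /lebesgue_rV_step /pushforward -comp_preimage.
rewrite (_ : _ \o _ = id); last by apply/funext => p; exact: cons_rVK.
by rewrite product_measure1E// lte_mul_pinfty// ge0_fin_numE.
Qed.

HB.instance Definition _ := Measure_isSigmaFinite.Build _ _ _ lebesgue_rV_step
  step_sigma_finite.

End step.

(* Lebesgue measure on R^n: the product of n copies of [lebesgue_measure]. *)
Fixpoint lebesgue_rV (n : nat) : {sigma_finite_measure set 'rV[R]_n -> \bar R} :=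
  match n with
  | 0 => (dirac (0 : 'rV[R]_0) : {sigma_finite_measure set 'rV[R]_0 -> \bar R})
  | n'.+1 => (lebesgue_rV_step (lebesgue_rV n') :
               {sigma_finite_measure set 'rV[R]_n'.+1 -> \bar R})
  end.

End lebesgue_rV.

Section smoothness.
Context {R : realType} (d : nat).
Implicit Types (U : set 'rV[R]_d) (i : 'I_d).

Definition partial i (f : 'rV[R]_d -> R) : 'rV[R]_d -> R :=
  fun x => 'D_(delta_mx ord0 i) f x.

(* Intended for open U only: derivatives are not one-sided at the boundary. *)
Fixpoint Ck_on U (k : nat) (f : 'rV[R]_d -> R) : Prop :=
  (forall x, U x -> {for x, continuous f}) /\
  (if k is k'.+1 then
     forall i, (forall x, U x -> derivable f x (delta_mx ord0 i)) /\
               Ck_on U k' (partial i f)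
   else True).

Definition cCk_on U (k : nat) (F : 'rV[R]_d -> R[i]) : Prop :=
  Ck_on U k (fun x => complex.Re (F x)) /\ Ck_on U k (fun x => complex.Im (F x)).

Definition cpartial i (F : 'rV[R]_d -> R[i]) : 'rV[R]_d -> R[i] :=
  fun x => partial i (fun z => complex.Re (F z)) x
             +i* partial i (fun z => complex.Im (F z)) x.

Definition mderive (alpha : 'I_d -> nat) (F : 'rV[R]_d -> R[i]) :
    'rV[R]_d -> R[i] :=
  foldr (fun i G => iter (alpha i) (cpartial i) G) F (enum 'I_d).

Definition laplacian (F : 'rV[R]_d -> R[i]) : 'rV[R]_d -> R[i] :=
  fun x => \sum_(i < d) cpartial i (cpartial i F) x.

Definition polyharmonic_on U (p : nat) (F : 'rV[R]_d -> R[i]) : Prop :=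
  cCk_on U (2 * p) F /\ forall x, U x -> iter p laplacian F x = 0.

Definition periodic_in i (F : 'rV[R]_d -> R[i]) : Prop :=
  forall x, F (x + (2 * pi) *: delta_mx ord0 i) = F x.

(* [normc] is the R-valued modulus; the ring_scope norm of R[i] is
   R[i]-valued. *)
Definition in_L2 (D : set 'rV[R]_d) (F : 'rV[R]_d -> R[i]) : Prop :=
  [/\ measurable_fun D (fun x => complex.Re (F x) : measurableTypeR R),
      measurable_fun D (fun x => complex.Im (F x) : measurableTypeR R) &
      (\int[lebesgue_rV d]_(x in D)
         (ComplexField.Normc.normc (F x) ^+ 2)%:E < +oo)%E].

End smoothness.

Section fourier.
Context {R : realType} (n : nat).

Definition torus : set 'rV[R]_n :=
  [set y : 'rV[R]_n | forall i, - pi <= y ord0 i <= pi].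

Definition cintegral (D : set 'rV[R]_n) (F : 'rV[R]_n -> R[i]) : R[i] :=
  Rintegral (lebesgue_rV n) D (fun y => complex.Re (F y))
    +i* Rintegral (lebesgue_rV n) D (fun y => complex.Im (F y)).

Definition freq_dot (xi : 'rV[int]_n) (y : 'rV[R]_n) : R :=
  \sum_(i < n) (xi ord0 i)%:~R * y ord0 i.

(* Euclidean norm; the library norm on row vectors is the sup norm. *)
Definition freq_norm (xi : 'rV[int]_n) : R :=
  Num.sqrt (\sum_(i < n) (xi ord0 i)%:~R ^+ 2).

(* The exponential of i * theta. *)
Definition cis (theta : R) : R[i] := cos theta +i* sin theta.

Definition fourier_coef (f : 'rV[R]_n -> R[i]) (xi : 'rV[int]_n) : R[i] :=
  cintegral torus (fun y => cis (- freq_dot xi y) * f y).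

Definition in_W (r : nat) (f : 'rV[R]_n -> R[i]) : Prop :=
  [/\ cCk_on setT 0 f,
      forall i, periodic_in i f &
      (\esum_(xi in [set: 'rV[int]_n])
         (ComplexField.Normc.normc (fourier_coef f xi)
            * (1 + freq_norm xi) ^+ r)%:E < +oo)%E].

End fourier.

Section beppo_levi.
Context {R : realType} (n : nat).

(* R x T^n: in 'rV_n.+1, coordinate 0 is t and the others are y. *)
Definition slab : set 'rV[R]_n.+1 :=
  [set x : 'rV[R]_n.+1 | forall i, i != ord0 -> - pi <= x ord0 i <= pi].

Definition L2_derivatives (p : nat) (F : 'rV[R]_n.+1 -> R[i]) : Prop :=
  forall alpha : 'I_n.+1 -> nat,
    (\sum_(i < n.+1) alpha i = p)%N -> in_L2 slab (mderive alpha F).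

Definition in_B (p : nat) (F : 'rV[R]_n.+1 -> R[i]) : Prop :=
  [/\ cCk_on setT p F,
      forall i, i != ord0 -> periodic_in i F &
      L2_derivatives p F].

(* Multi-indices with |alpha| = p have all their entries at most p, hence the
   finite index type. *)
Definition B_seminorm (p : nat) (F : 'rV[R]_n.+1 -> R[i]) : \bar R :=
  ((\int[lebesgue_rV n.+1]_(x in slab)
      (\sum_(alpha : {ffun 'I_n.+1 -> 'I_p.+1}
               | (\sum_(i < n.+1) alpha i == p)%N)
         p`!%:R / (\prod_(i < n.+1) (alpha i)`!)%:R
           * ComplexField.Normc.normc
               (mderive (fun i => alpha i : nat) F x) ^+ 2)%:E) `^ 2^-1)%E.

(* [knot t k] is t_(k-1), with t_(-1) = -oo and t_(N+1) = +oo. *)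
Definition knot (N : nat) (t : 'I_N.+1 -> R) (k : nat) : \bar R :=
  if k is j.+1 then
    if insub j is Some i then (t i)%:E else +oo%E
  else -oo%E.

Definition strip (N : nat) (t : 'I_N.+1 -> R) (j : nat) : set 'rV[R]_n.+1 :=
  [set x : 'rV[R]_n.+1 | (knot t j < (x ord0 ord0)%:E < knot t j.+1)%E].

Definition in_S (p N : nat) (t : 'I_N.+1 -> R) (S : 'rV[R]_n.+1 -> R[i]) : Prop :=
  [/\ cCk_on setT (2 * p - 2) S,
      forall j, (j <= N.+1)%N -> polyharmonic_on (strip t j) p S,
      forall i, i != ord0 -> periodic_in i S &
      L2_derivatives p S].

Definition interpolates (N : nat) (t : 'I_N.+1 -> R)
    (f : 'I_N.+1 -> 'rV[R]_n -> R[i]) (S : 'rV[R]_n.+1 -> R[i]) : Prop :=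
  forall j y, torus y -> S (point (t j) y) = f j y.

End beppo_levi.

(* Main.v *)
(* Put G = F - S; it suffices to treat real and imaginary parts separately.
   G vanishes on the planes t = t_j, and the point is that S and G are
   orthogonal for the Beppo Levi form, so that |F|^2 = |S|^2 + |G|^2.

   Expanding in Fourier series in y, the form becomes a sum over frequencies xi
   of integrals over t of B(u, g) = sum_k C(p, k) |xi|^(2(p-k)) u^(k) g^(k),
   where u, g are Fourier coefficients of S, G.  Off the knots u solves
   (D^2 - |xi|^2)^p u = 0, so B(u, g) has an antiderivative Q(u, g) which is
   bilinear in derivatives of u of order < 2p and of g of order < p.  At the
   knots Q is continuous, because the only discontinuous derivative of u, the
   one of order 2p - 1, is bounded and multiplied by g = 0.  At infinity,
   square integrability leaves for u only exponentially decaying solutions (or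
   polynomials of degree < p when xi = 0, for which Q = 0), while g grows at
   most polynomially; hence Q tends to 0 and the integral of B(u, g) is 0.

   The sum over frequencies is recovered from Fejer-type means (tensor powers
   of the kernel ((1 + cos s)/2)^m) and dominated convergence.

   Finally, if |G| = 0 then the p-th t-derivative of G is zero, so for each y
   the function t |-> G(t, y) is a polynomial of degree < p with N + 1 >= p
   zeros, and G = 0. *)

From mathcomp Require Import all_boot all_order all_algebra.
From mathcomp Require Import all_classical all_reals all_analysis measurable_realfun.
From mathcomp Require Import complex polyrcf ring lra zify.
Require Import Defs.

Set Implicit Arguments.
Unset Strict Implicit.
Unset Printing Implicit Defensive.

Import Order.TTheory GRing.Theory Num.Theory numFieldNormedType.Exports.

Local Open Scope classical_set_scope.
Local Open Scope complex_scope.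
Local Open Scope ring_scope.

(** * The form of a single frequency and its antiderivative *)

(** Integrating by parts directly in (t, y) would call for control of the derivatives of order 2p -
    1 of S up to the planes and for decay of S at infinity; the definition of a polyspline provides
    neither. For a single frequency both follow from the ODE. Near a knot, (D^2 - lam)^(p-1) u' has
    derivative lam (D^2 - lam)^(p-1) u, which involves only derivatives of order at most 2p - 2 and
    is therefore bounded. Towards infinity, D^2 - |xi|^2 splits as (D - |xi|)(D + |xi|): (D +
    |xi|)^p u is e^(|xi| t) times a polynomial, its square is at most 2^p B(u, u), which is
    integrable, so it vanishes.

    The kernel of the means is a nonnegative trigonometric polynomial of unit mass. Each mean is
    thus a finite combination of single-frequency integrals, positivity gives the bound needed for
    domination, and concentration gives the limit, without appeal to completeness of the
    trigonometric system. The powers of (1 + cos s)/2 are convenient because their moment against 1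
    - cos s is exactly 1/(m + 1) of their mass, so no tail estimate is required. *)

Section forms.
Context {R : realType}.
Implicit Types (u g : nat -> R -> R) (lam t : R).

(* A sequence [u : nat -> R -> R] stands for a function and its successive
   derivatives: [u k] is the k-th derivative, [sh] is differentiation and
   [helm lam] is D^2 - lam. *)
Definition sh u : nat -> R -> R := fun k => u k.+1.

Definition helm lam u : nat -> R -> R := fun k t => u k.+2 t - lam * u k t.

(* The sum over k <= m of 'C(m, k) lam^(m - k) u^(k) g^(k). *)
Fixpoint bform lam m u g (t : R) : R :=
  if m is m'.+1 then lam * bform lam m' u g t + bform lam m' (sh u) (sh g) t
  else u 0 t * g 0 t.

(** One integration by parts per level: writing B for the form of order m, the form of order m + 1
    is lam B(u, g) + B(u', g'), which equals the derivative of B(u', g) minus B((D^2 - lam) u, g).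
    The recursion then treats the last term. *)
Fixpoint bprim lam m u g (t : R) : R :=
  if m is m'.+1 then bform lam m' (sh u) g t - bprim lam m' (helm lam u) g t
  else 0.

Lemma bform_helm lam m u g t :
  bform lam m (helm lam u) g t =
  bform lam m (sh (sh u)) g t - lam * bform lam m u g t.
Proof.
elim: m u g => [|m IH] u g /=; first by rewrite /helm /sh; ring.
rewrite IH (_ : sh (helm lam u) = helm lam (sh u)) // IH; ring.
Qed.

Lemma is_derive_bform lam m u g t :
  (forall k, (k <= m)%N -> is_derive t 1 (u k) (u k.+1 t)) ->
  (forall k, (k <= m)%N -> is_derive t 1 (g k) (g k.+1 t)) ->
  is_derive t 1 (bform lam m u g)
    (bform lam m (sh u) g t + bform lam m u (sh g) t).
Proof.
elim: m u g => [|m IH] u g du dg /=.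
  have ? := du 0 (leqnn _); have ? := dg 0 (leqnn _).
  have -> : (fun t => u 0 t * g 0 t) = u 0 * g 0 by [].
  apply: is_derive_eq; rewrite /sh /= /GRing.scale /=; ring.
have h1 : is_derive t 1 (bform lam m u g)
    (bform lam m (sh u) g t + bform lam m u (sh g) t).
  by apply: IH => k km; [apply: du|apply: dg]; exact: leqW.
have h2 : is_derive t 1 (bform lam m (sh u) (sh g))
    (bform lam m (sh (sh u)) (sh g) t + bform lam m (sh u) (sh (sh g)) t).
  by apply: IH => k km; [apply: du|apply: dg].
have -> : (fun t => lam * bform lam m u g t + bform lam m (sh u) (sh g) t) =
  (lam *: bform lam m u g + bform lam m (sh u) (sh g)) by [].
apply: is_derive_eq; rewrite /GRing.scale /=; ring.
Qed.

Lemma is_derive_bprim lam m u g t :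
  (forall k, (k < 2 * m)%N -> is_derive t 1 (u k) (u k.+1 t)) ->
  (forall k, (k < m)%N -> is_derive t 1 (g k) (g k.+1 t)) ->
  is_derive t 1 (bprim lam m u g)
    (bform lam m u g t - (- 1) ^+ m * iter m (helm lam) u 0 t * g 0 t).
Proof.
elim: m u => [|m IH] u du dg.
  rewrite /= expr0 mul1r subrr.
  exact: is_derive_cst.
have h1 : is_derive t 1 (bform lam m (sh u) g)
    (bform lam m (sh (sh u)) g t + bform lam m (sh u) (sh g) t).
  apply: is_derive_bform => k km.
    by apply: du; rewrite mulnS; lia.
have h2 : is_derive t 1 (bprim lam m (helm lam u) g)
    (bform lam m (helm lam u) g t
     - (- 1) ^+ m * iter m (helm lam) (helm lam u) 0 t * g 0 t).
  apply: IH => k km; last exact/dg/leqW.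
  have ? : is_derive t 1 (u k) (u k.+1 t) by apply: du; lia.
  have ? : is_derive t 1 (u k.+2) (u k.+3 t) by apply: du; lia.
  have -> : helm lam u k = u k.+2 - lam *: u k by [].
  exact: is_derive_eq.
rewrite iterSr /=.
have -> : (fun t => bform lam m (sh u) g t - bprim lam m (helm lam u) g t) =
  (bform lam m (sh u) g - bprim lam m (helm lam u) g) by [].
apply: is_derive_eq; rewrite bform_helm exprS; ring.
Qed.

Lemma continuous_bform lam m u g t :
  (forall k, (k <= m)%N -> {for t, continuous (u k)}) ->
  (forall k, (k <= m)%N -> {for t, continuous (g k)}) ->
  {for t, continuous (bform lam m u g)}.
Proof.
elim: m u g => [|m IH] u g cu cg /=.
  by apply: continuousM; [exact: cu|exact: cg].
apply: continuousD; last by apply: IH => k km; [exact: cu|exact: cg].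
apply: continuousM; first exact: cst_continuous.
by apply: IH => k km; [apply: cu|apply: cg]; exact: leqW.
Qed.

(* [g 0] vanishes at the exceptional point, so boundedness of the highest
   derivative occurring in [bprim] is enough there. *)
Lemma continuous_bprim lam m u g t :
  (forall k, (k <= 2 * m)%N -> {for t, continuous (u k)}) ->
  (forall k, (k <= m)%N -> {for t, continuous (g k)}) ->
  g 0 t = 0 ->
  (exists M, \forall s \near t, `|iter m (helm lam) u 1 s| <= M) ->
  {for t, continuous (bprim lam m.+1 u g)}.
Proof.
elim: m u => [|m IH] u cu cg g0 [M bM] /=.
  have -> : (fun s => sh u 0 s * g 0 s - 0) = (fun s => u 1%N s * g 0 s).
    by apply/funext => s; rewrite subr0.
  rewrite /prop_for /continuous_at g0 mulr0; apply/cvgr0Pnorm_lt => e e0.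
  have M0 : 0 <= M by case: (nbhs_singleton bM) => /(le_trans (normr_ge0 _)).
  have sg : \forall s \near t, `|g 0 s| < e / (M + 1).
    have /cvgrPdist_lt := cg 0 (leqnn _); rewrite g0.
    move=> /(_ (e / (M + 1)) (divr_gt0 e0 (ltr_wpDl M0 ltr01))).
    by apply: filterS => s; rewrite sub0r normrN.
  near=> s; rewrite normrM.
  apply: (@le_lt_trans _ _ (M * `|g 0 s|)).
    by apply: ler_wpM2r => //; near: s.
  apply: (@le_lt_trans _ _ ((M + 1) * `|g 0 s|)).
    by apply: ler_wpM2r => //; rewrite lerDl.
  rewrite mulrC -ltr_pdivlMr; first by near: s.
  by rewrite ltr_wpDl.
apply: (@continuousB _ _ _ (bform lam m.+1 (sh u) g)
  (bprim lam m.+1 (helm lam u) g)).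
  by apply: continuous_bform => k km; [apply: cu; lia|apply: cg; lia].
apply: IH => [k km|k km||].
- apply: (@continuousB _ _ _ (u k.+2) (fun s => lam * u k s)); first by apply: cu; lia.
  by apply: continuousM; [exact: cst_continuous|apply: cu; lia].
- by apply: cg; lia.
- by [].
- by exists M; move: bM; rewrite iterSr.
Unshelve. all: by end_near. Qed.

(** With the signs (-1)^k the sequences are those of the derivatives of s |-> u(-s) and s |-> g(-s).
    Limits at -oo are obtained in this way from limits at +oo. *)
Lemma bform_reflect lam m u g t :
  bform lam m (fun k s => (-1) ^+ k * u k (- s))
    (fun k s => (-1) ^+ k * g k (- s)) t = bform lam m u g (- t).
Proof.
(* Shifting a reflected sequence changes its sign, so the induction has to carry arbitrary factors e
   and f. *)
suff H e f : bform lam m (fun k s => e * (-1) ^+ k * u k (- s))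
    (fun k s => f * (-1) ^+ k * g k (- s)) t = e * f * bform lam m u g (- t).
  by rewrite -[RHS]mul1r -{3}[1](mulr1 1) -H; congr bform;
    apply/funext => k; apply/funext => s; rewrite mul1r.
elim: m u g e f => [|m IH] u g e f /=; first by rewrite expr0; ring.
rewrite IH; have := IH (sh u) (sh g) (- e) (- f).
have E c (h : nat -> R -> R) : (fun k s => - c * (-1) ^+ k * sh h k (- s)) =
    sh (fun k s => c * (-1) ^+ k * h k (- s)).
  by apply/funext => k; apply/funext => s; rewrite /sh exprS; ring.
rewrite !E => ->; ring.
Qed.

End forms.

(** * One-variable calculus *)

Section calculus.
Context {R : realType}.
Implicit Types (f df : R -> R) (x y t : R) (Z : seq R).

Lemma mean_value f df x y : x < y ->
  (forall s, x < s < y -> is_derive s 1 f (df s)) ->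
  (forall s, x <= s <= y -> {for s, continuous f}) ->
  exists2 c, x < c < y & f y - f x = df c * (y - x).
Proof.
move=> xy fd fc; have [|c] := @MVT R f df x y xy.
- apply: continuous_in_subspaceT => s; rewrite inE /= in_itv /=; exact: fc.
- by rewrite in_itv => cxy e; exists c.
Qed.

Lemma is_derive_continuous f l t : is_derive t 1 f l -> {for t, continuous f}.
Proof. by move=> fl; apply: differentiable_continuous; apply/derivable1_diffP. Qed.

Lemma derive0_cst_ray f a : (forall t, a < t -> is_derive t 1 f 0) ->
  forall s t, a < s -> a < t -> f s = f t.
Proof.
move=> fd; suff H s t : a < s -> s < t -> f s = f t.
  move=> s t as_ at_; have [st|ts|->//] := ltgtP s t; first exact: H.
  by apply/esym/H.
move=> as_ st; have [r /andP[sr _]|r /andP[sr _]|c _] := @mean_value f (cst 0) s t st.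
- by apply: fd; exact: lt_trans sr.
- by apply: is_derive_continuous; apply: fd; exact: lt_le_trans sr.
- by rewrite mul0r => /eqP; rewrite subr_eq0 => /eqP.
Qed.

Lemma poly_antideriv (q : {poly R}) :
  exists2 Q : {poly R}, Q^`() = q & (size Q <= (size q).+1)%N.
Proof.
exists (\poly_(i < (size q).+1) (q`_i.-1 / i%:R)); last exact: size_poly.
apply/polyP => i; rewrite coef_deriv coef_poly ltnS /=.
case: ltnP => iq; last by rewrite nth_default // mul0rn.
by rewrite -[LHS]mulr_natr divfK // pnatr_eq0.
Qed.

Lemma is_derive_horner (q : {poly R}) t : is_derive t 1 (horner q) q^`().[t].
Proof.
by apply: DeriveDef; [exact: derivable_horner|rewrite derivE derive1E].
Qed.

Lemma chain_poly p (x : nat -> R -> R) a :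
  (forall k t, (k < p)%N -> a < t -> is_derive t 1 (x k) (x k.+1 t)) ->
  (forall t, a < t -> x p t = 0) ->
  exists2 q : {poly R}, (size q <= p)%N & forall t, a < t -> x 0 t = q.[t].
Proof.
elim: p x => [|p IH] x dx x0.
  by exists 0 => [|t /x0->]; rewrite ?size_poly0 ?horner0.
have [k t kp|//|q sq xq] := IH (sh x); first exact: dx.
have [Q dQ sQ] := poly_antideriv q.
have dxQ t : a < t -> is_derive t 1 (x 0 - horner Q) 0.
  move=> at_; have ? := is_derive_horner Q t; have ? := dx 0 t isT at_.
  by apply: is_derive_eq; rewrite dQ -xq // subrr.
exists (Q + (x 0 (a + 1) - Q.[a + 1])%:P).
  rewrite (leq_trans (size_polyD _ _)) // geq_max (leq_trans sQ) //=.
  by rewrite (leq_trans (size_polyC_leq1 _)).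
move=> t at_; rewrite hornerD hornerC.
have := derive0_cst_ray dxQ at_ (_ : a < a + 1); rewrite ltrDl ltr01.
by move=> /(_ isT); rewrite !fctE => <-; ring.
Qed.

Lemma near_notin Z z : \forall s \near z, s != z -> s \notin Z.
Proof.
elim: Z => [|y Z IH]; first by near=> s.
have [->|zy] := eqVneq y z.
  by apply: filterS IH => s H sz; rewrite inE negb_or sz H.
have H : \forall s \near z, s != y.
  have : (fun s => s - y) @ z --> z - y by apply: cvgB; [exact: cvg_id|exact: cvg_cst].
  move=> /cvgr_neq0; rewrite subr_eq0 eq_sym => /(_ zy).
  by apply: filterS => s; rewrite subr_eq0.
by apply: filterS2 H IH => s sy sZ sz; rewrite inE negb_or sy sZ.
Unshelve. all: by end_near. Qed.

(** By the mean value theorem the difference quotient at t is a value of [df] at an intermediate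
    point. For small increments this point lies off the finite set [Z], and [df] is continuous at
    t. *)
Lemma is_derive_removable f df Z t :
  (forall s, {for s, continuous f}) -> {for t, continuous df} ->
  (forall s, s \notin Z -> is_derive s 1 f (df s)) -> is_derive t 1 f (df t).
Proof.
move=> cf cdf fd.
suff L : (fun h => h^-1 *: ((f \o shift t) (h *: 1) - f t)) @ 0^' --> df t.
  apply: DeriveDef; first by apply/cvg_ex; exists (df t).
  exact/cvg_lim.
apply/cvgrPdist_le => e e0.
have [d /= d0 dZ] : nbhs t [set s | `|df t - df s| <= e /\ (s != t -> s \notin Z)].
  apply: filterI (near_notin Z t); by move/cvgrPdist_le : cdf; exact.
exists d => //= h; rewrite /ball_ /= sub0r normrN => hd h0; rewrite /shift /= /GRing.scale /= mulr1.
(* The interval has t as an endpoint, so an interior point c differs from t and is not in [Z]. *)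
have key x y c : x < y -> x < c < y -> `|x - t| < d -> `|y - t| < d ->
    (x = t \/ y = t) -> `|df t - df c| <= e /\ is_derive c 1 f (df c).
  move=> xy /andP[xc cy] xd yd xyt.
  have [|? cZ] := dZ c.
    rewrite /ball /= distrC ltr_norml; move: xd yd; rewrite !ltr_norml.
    by move=> /andP[? _] /andP[_ ?]; apply/andP; split; lra.
  split => //; apply: fd; apply: cZ; apply/eqP => ct.
  by case: xyt => E; move: xc cy; rewrite ct E ltxx.
have cc x y s : x <= s <= y -> {for s, continuous f} by [].
have [hp|hn|hE] := ltgtP 0 h; last by rewrite -hE eqxx in h0.
- have th : t < h + t by lra.
  have th' : `|t - t| < d by rewrite subrr normr0.
  have hd' : `|h + t - t| < d by rewrite addrK.
  have H c (tc : t < c < h + t) := key _ _ c th tc th' hd' (or_introl erefl).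
  have [c tc E] := mean_value th (fun c tc => (H c tc).2) (cc _ _).
  by rewrite E addrK mulrC mulfK //; exact: (H c tc).1.
- have th : h + t < t by lra.
  have th' : `|t - t| < d by rewrite subrr normr0.
  have hd' : `|h + t - t| < d by rewrite addrK.
  have H c (tc : h + t < c < t) := key _ _ c th tc hd' th' (or_intror erefl).
  have [c tc E] := mean_value th (fun c tc => (H c tc).2) (cc _ _).
  have -> : f (h + t) - f t = df c * h by move: E; lra.
  by rewrite mulrC mulfK //; exact: (H c tc).1.
Qed.

(** The mean value theorem is applied on each side of t separately, against the reference points t -
    d/2 and t + d/2. As f may jump at t, the value at t enters the bound as a term of its own. *)
Lemma bounded_near_removable f df Z t K :
  (forall s, s \notin Z -> is_derive s 1 f (df s)) ->
  (\forall s \near t, `|df s| <= K) ->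
  exists M, \forall s \near t, `|f s| <= M.
Proof.
move=> fd bK.
have [d /= d0 dZ] : nbhs t [set s | `|df s| <= K /\ (s != t -> s \notin Z)].
  exact: filterI bK (near_notin Z t).
have K0 : 0 <= K.
  by have [|/(le_trans (normr_ge0 _))//] := dZ t; exact: ballxx.
have key x y : x < y -> t - d < x -> y < t + d -> (y < t) || (t < x) ->
    `|f y - f x| <= K * d * 2.
  move=> xy tx yt yx.
  have H s : x <= s <= y -> `|df s| <= K /\ is_derive s 1 f (df s).
    move=> /andP[xs sy]; have [|? sZ] := dZ s.
      by rewrite /ball /= distrC ltr_norml; apply/andP; split; lra.
    split => //; apply/fd/sZ/eqP => st.
    by move: yx; rewrite -st; move: xs sy; case: (ltgtP y s); case: (ltgtP s x) => //=; lra.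
  have [s /andP[xs sy]|s xsy|c /andP[xc cy] ->] := @mean_value f df x y xy.
  - by apply: (H s _).2; rewrite !ltW.
  - by apply: is_derive_continuous; exact: (H s xsy).2.
  - rewrite normrM (gtr0_norm (_ : 0 < y - x)) ?subr_gt0 // -mulrA.
    apply: ler_pM => //; [lra|by apply: (H c _).1; rewrite !ltW|lra].
exists (`|f t| + (`|f (t + d / 2)| + `|f (t - d / 2)| + K * d * 2)).
exists (d / 2) => /= [|s]; first exact: divr_gt0.
rewrite /ball /= distrC ltr_norml => /andP[sl sr].
have KD : 0 <= K * d * 2 by rewrite !mulr_ge0 // ltW.
have n1 := normr_ge0 (f t).
have n2 := normr_ge0 (f (t + d / 2)); have n3 := normr_ge0 (f (t - d / 2)).
have [st|ts|->] := ltgtP s t; last lra.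
- have H : `|f s - f (t - d / 2)| <= K * d * 2.
    by apply: key; rewrite ?st //; lra.
  have -> : f s = (f s - f (t - d / 2)) + f (t - d / 2) by rewrite subrK.
  apply: (le_trans (ler_normD _ _)); lra.
- have H : `|f (t + d / 2) - f s| <= K * d * 2.
    by apply: key; rewrite ?ts ?orbT //; lra.
  have -> : f s = f (t + d / 2) - (f (t + d / 2) - f s) by rewrite opprB addrC subrK.
  apply: (le_trans (ler_normB _ _)); lra.
Qed.

End calculus.

(** * Factorization of the Helmholtz operator *)

Section shifted.
Context {R : realType}.
Implicit Types (u g w : nat -> R -> R) (lam mu t : R).

Definition dshift mu u : nat -> R -> R := fun k t => u k.+1 t + mu * u k t.

Lemma helm_dshift mu u : helm (mu ^+ 2) u = dshift (- mu) (dshift mu u).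
Proof.
by apply/funext => k; apply/funext => t; rewrite /helm /dshift; ring.
Qed.

Lemma dshiftC mu nu u : dshift mu (dshift nu u) = dshift nu (dshift mu u).
Proof. by apply/funext => k; apply/funext => t; rewrite /dshift; ring. Qed.

Lemma dshift_iter mu nu p u :
  dshift mu (iter p (dshift nu) u) = iter p (dshift nu) (dshift mu u).
Proof. by elim: p => //= p IH; rewrite dshiftC IH. Qed.

Lemma iter_helm mu p u :
  iter p (helm (mu ^+ 2)) u = iter p (dshift (- mu)) (iter p (dshift mu) u).
Proof.
by elim: p => //= p ->; rewrite helm_dshift dshift_iter.
Qed.

Lemma iter_dshiftS mu p u k t :
  iter p (dshift mu) u k.+1 t = iter p (dshift mu) (sh u) k t.
Proof. by elim: p k => //= p IH k; rewrite /dshift !IH. Qed.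

Lemma is_derive_dshift mu p u i t :
  (forall j, (j <= p + i)%N -> is_derive t 1 (u j) (u j.+1 t)) ->
  is_derive t 1 (iter p (dshift mu) u i) (iter p (dshift mu) u i.+1 t).
Proof.
elim: p i => [|p IH] i du /=; first exact: du.
have d0 := IH i (fun j jp => du j (leqW jp)).
have d1 : is_derive t 1 (iter p (dshift mu) u i.+1) (iter p (dshift mu) u i.+2 t).
  by apply: IH => j; rewrite addnS; exact: du.
have -> : dshift mu (iter p (dshift mu) u) i =
  iter p (dshift mu) u i.+1 + mu *: iter p (dshift mu) u i by [].
exact: (is_deriveD d1 (is_deriveZ mu d0)).
Qed.

(** Conjugation by e^(mu t) turns D + mu into D; hence the solutions of (D + mu)^p u = 0 are e^(-mu
    t) times polynomials, by [chain_poly]. *)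
Lemma is_derive_expdshift mu p u t :
  (forall j, (j <= p)%N -> is_derive t 1 (u j) (u j.+1 t)) ->
  is_derive t 1 (fun s => expR (mu * s) * iter p (dshift mu) u 0 s)
    (expR (mu * t) * iter p.+1 (dshift mu) u 0 t).
Proof.
move=> du; have ? : is_derive t 1 (iter p (dshift mu) u 0) (iter p (dshift mu) u 1 t).
  by apply: is_derive_dshift => j; rewrite addn0; exact: du.
have ? : is_derive t 1 (fun s : R => expR (mu * s)) (expR (mu * t) * mu).
  have ? := is_derive_expR (mu * t).
  have ? : is_derive t 1 (fun s : R => mu * s) mu.
    have -> : (fun s : R => mu * s) = mu *: id by [].
    by apply: is_derive_eq; rewrite /GRing.scale /= mulr1.
  have -> : (fun s : R => expR (mu * s)) = expR \o ( *%R mu) by [].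
  exact: is_derive1_comp.
have -> : (fun s => expR (mu * s) * iter p (dshift mu) u 0 s) =
  (fun s => expR (mu * s)) * iter p (dshift mu) u 0 by [].
by apply: is_derive_eq; rewrite /GRing.scale /= /dshift; ring.
Qed.

Lemma bform_ge0 lam m u t : 0 <= lam -> 0 <= bform lam m u u t.
Proof.
move=> l0; elim: m u => [|m IH] u /=; first by rewrite -expr2 sqr_ge0.
by rewrite addr_ge0 // mulr_ge0.
Qed.

Lemma bform_ge_last lam m u t : 0 <= lam -> u m t ^+ 2 <= bform lam m u u t.
Proof.
move=> l0; elim: m u => [|m IH] u /=; first by rewrite -expr2.
by apply: (le_trans (IH (sh u))); rewrite lerDr mulr_ge0 // bform_ge0.
Qed.

Lemma normr_bform lam m u g t : 0 <= lam ->
  `|bform lam m u g t| <= bform lam m u u t + bform lam m g g t.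
Proof.
move=> l0; elim: m u g => [|m IH] u g /=.
  have := sqr_ge0 (u 0 t + g 0 t); have := sqr_ge0 (u 0 t - g 0 t).
  have := sqr_ge0 (u 0 t); have := sqr_ge0 (g 0 t).
  by rewrite ler_norml => ? ? ? ?; apply/andP; split; nra.
apply: (le_trans (ler_normD _ _)); rewrite normrM (ger0_norm l0).
have := IH (sh u) (sh g).
by have := ler_wpM2l l0 (IH u g); rewrite !mulrDr; lra.
Qed.

(** This passes integrability from the form to (D + mu)^m u, which isolates the growing part of a
    solution. Each level costs a factor 2, from (a + mu b)^2 <= 2 a^2 + 2 mu^2 b^2. *)
Lemma sqr_dshift_le mu m u t :
  (iter m (dshift mu) u 0 t) ^+ 2 <= 2 ^+ m * bform (mu ^+ 2) m u u t.
Proof.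
elim: m u => [|m IH] u /=; first by rewrite mul1r -expr2.
rewrite /dshift iter_dshiftS; set a := iter m _ _ _ _; set b := iter m _ _ _ _.
have ha : a ^+ 2 <= _ := IH (sh u).
have hb := ler_wpM2l (sqr_ge0 mu) (IH u : b ^+ 2 <= _).
have := sqr_ge0 (a - mu * b); rewrite [2 ^+ m.+1]exprS.
set x := bform _ _ _ _ _ in ha *; set y := bform _ _ _ _ _ in hb *.
move: ha hb; set z := 2 ^+ m => ha hb.
have -> : 2 * z * (mu ^+ 2 * y + x) = 2 * (mu ^+ 2 * (z * y)) + 2 * (z * x) by ring.
have -> : (a - mu * b) ^+ 2 = 2 * a ^+ 2 + 2 * (mu ^+ 2 * b ^+ 2) - (a + mu * b) ^+ 2.
  by ring.
by lra.
Qed.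

Lemma bform0 m u g t : bform 0 m u g t = u m t * g m t.
Proof. by elim: m u g => //= m IH u g; rewrite mul0r add0r IH. Qed.

(** At frequency zero every term of the antiderivative carries a derivative of u of order between m
    and 2m - 1. *)
Lemma bprim0 m u g t : (forall k, (m <= k < 2 * m)%N -> u k t = 0) ->
  bprim 0 m u g t = 0.
Proof.
elim: m u => //= m IH u u0; rewrite bform0 /sh u0 ?mul0r ?sub0r; last by lia.
by rewrite IH ?oppr0 // => k mk; rewrite /helm mul0r subr0 u0 //; lia.
Qed.

End shifted.

(** * Growth at infinity *)

Section growth.
Context {R : realType}.
Implicit Types (f g : R -> R).

Definition rapid f := forall k : nat,
  exists M, \forall t \near +oo, `|f t| * t ^+ k <= M.

Definition tempered g := exists (k : nat) M,
  \forall t \near +oo, `|g t| <= M * t ^+ k.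

Lemma rapid_near f g : (\forall t \near +oo, f t = g t) -> rapid f -> rapid g.
Proof.
move=> fg rf k; have [M HM] := rf k; exists M.
by apply: filterS2 fg HM => t ->.
Qed.

Lemma rapidD f g : rapid f -> rapid g -> rapid (fun t => f t + g t).
Proof.
move=> rf rg k; have [M HM] := rf k; have [L HL] := rg k; exists (M + L).
have H0 : \forall t \near (+oo : set_system R), 0 <= t by apply: nbhs_pinfty_ge; exact: num_real.
apply: filterS3 H0 HM HL => t t0 h1 h2.
apply: (@le_trans _ _ ((`|f t| + `|g t|) * t ^+ k)); last by rewrite mulrDl lerD.
by rewrite ler_wpM2r ?exprn_ge0 // ler_normD.
Qed.

Lemma rapidM f g : rapid f -> tempered g -> rapid (fun t => f t * g t).
Proof.
move=> rf [l [L HL]] k; have [M HM] := rf (l + k)%N; exists (`|L| * M).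
have H0 : \forall t \near (+oo : set_system R), 0 <= t by apply: nbhs_pinfty_ge; exact: num_real.
apply: filterS3 H0 HM HL => t t0 h1 h2; rewrite normrM.
apply: (@le_trans _ _ (`|L| * (`|f t| * t ^+ (l + k)))); last exact: ler_wpM2l.
rewrite exprD mulrCA mulrA -mulrA -!mulrA ler_wpM2l // !mulrA.
rewrite ler_wpM2r ?exprn_ge0 //; apply: (le_trans h2).
by rewrite ler_wpM2r ?exprn_ge0 // ler_norm.
Qed.

Lemma tempered_cst (c : R) : tempered (cst c).
Proof. by exists 0, `|c|; near=> t; rewrite expr0 mulr1.
Unshelve. all: by end_near. Qed.

Lemma rapidZ c f : rapid f -> rapid (fun t => c * f t).
Proof.
move=> rf; have := rapidM rf (tempered_cst c).
by apply: rapid_near; near=> t; rewrite mulrC.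
Unshelve. all: by end_near. Qed.

Lemma rapid0 : rapid (cst 0).
Proof. by move=> k; exists 0; near=> t; rewrite normr0 mul0r.
Unshelve. all: by end_near. Qed.

Lemma rapid_cvg0 f : rapid f -> f t @[t --> +oo] --> 0.
Proof.
move=> /(_ 1%N) [M HM]; apply/cvgr0Pnorm_le => e e0.
have H0 : \forall t \near (+oo : set_system R), Num.max 1 (M / e) <= t.
  by apply: nbhs_pinfty_ge; exact: num_real.
apply: filterS2 H0 HM => t; rewrite ge_max expr1 => /andP[t1 tM] h.
have t0 : 0 < t by lra.
rewrite -(ler_pM2r t0); apply: (le_trans h).
by rewrite mulrC -ler_pdivrMr.
Qed.

Lemma rapid_expR_pow mu k : 0 < mu -> rapid (fun t => expR (- (mu * t)) * t ^+ k).
Proof.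
(* The constant comes from the term of degree k + l + 1 of the exponential series; the spare power
   of t is discarded because t >= 1. *)
move=> mu0 l; exists ((k + l).+1`!%:R / mu ^+ (k + l).+1).
have H0 : \forall t \near (+oo : set_system R), 1 <= t by apply: nbhs_pinfty_ge; exact: num_real.
apply: filterS H0 => t t1; have t0 : 0 < t by lra.
rewrite normrM (gtr0_norm (expR_gt0 _)) normrX (gtr0_norm t0) -mulrA -exprD.
rewrite expRN mulrC ler_pdivrMr ?expR_gt0 //.
have := @expR_ge1Dxn R (mu * t) (k + l) (ltW (mulr_gt0 mu0 t0)).
move: (expR _) => E; rewrite exprMn => HE.
have F0 : 0 < (k + l).+1`!%:R :> R by rewrite ltr0n fact_gt0.
have M0 : 0 < mu ^+ (k + l).+1 by rewrite exprn_gt0.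
have : mu ^+ (k + l).+1 * t ^+ (k + l).+1 / (k + l).+1`!%:R <= E by lra.
rewrite ler_pdivrMr // => h; rewrite mulrAC ler_pdivlMr // mulrC [leRHS]mulrC.
apply: le_trans h; apply: ler_wpM2l; first exact: ltW.
by rewrite exprS ler_peMl // exprn_ge0 // ltW.
Qed.

Lemma rapid_expR_poly mu (q : {poly R}) : 0 < mu ->
  rapid (fun t => expR (- (mu * t)) * q.[t]).
Proof.
move=> mu0; apply: (@rapid_near (fun t => \sum_(i < size q) q`_i * (expR (- (mu * t)) * t ^+ i))).
  by near=> t; rewrite horner_coef mulr_sumr; apply: eq_bigr => i _; ring.
elim: (size q) => [|m IH].
  by under eq_fun do rewrite big_ord0; exact: rapid0.
under eq_fun do rewrite big_ord_recr /=.
by apply: rapidD => //; exact/rapidZ/rapid_expR_pow.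
Unshelve. all: by end_near. Qed.

Lemma tempered_antiderive f g (a : R) :
  (forall t : R, a < t -> is_derive t 1 f (g t)) -> tempered g -> tempered f.
Proof.
move=> fg [k [M HM]].
have : \forall t \near (+oo : set_system R), Num.max 1 (a + 1) <= t.
  by apply: nbhs_pinfty_ge; exact: num_real.
move=> /(filterI HM) [T [_ HT]]; pose b := Num.max T (Num.max 1 (a + 1)) + 1.
have bT : T < b by rewrite /b ltr_pwDr // le_max lexx.
have b1 : 1 <= b.
  by rewrite /b -[leLHS]add0r lerD // le_max; apply/orP; right; rewrite le_max ler01.
have ab : a < b.
  rewrite (lt_le_trans (_ : a < a + 1)) ?ltrDl //.
  by rewrite /b (le_trans (_ : _ <= Num.max T (Num.max 1 (a + 1)))) ?lerDl // !le_max lexx !orbT.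
exists k.+1, (`|f b| + `|M|).
exists b; split => [|t bt]; first exact: num_real.
have t1 : 1 <= t by lra.
have [s /andP[bs st]|s /andP[bs st]|c /andP[bc ct] E] := @mean_value _ f g b t bt.
- by apply: fg; lra.
- by apply: (@is_derive_continuous _ _ (g s)); apply: fg; lra.
have -> : f t = f b + (f t - f b) by rewrite addrCA subrr addr0.
rewrite E (le_trans (ler_normD _ _)) // mulrDl lerD //.
  by rewrite ler_peMr // exprn_ege1.
rewrite normrM exprSr mulrA; apply: ler_pM => //; last first.
  by rewrite gtr0_norm ?subr_gt0 //; lra.
have [h _] := HT c (lt_trans bT bc).
apply: (le_trans h); apply: (@le_trans _ _ (`|M| * c ^+ k)).
  by rewrite ler_wpM2r ?ler_norm // exprn_ge0 //; lra.
by rewrite ler_wpM2l // lerXn2r ?nnegrE //; lra.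
Qed.

Lemma rapid_bform (lam : R) m (u g : nat -> R -> R) :
  (forall k, (k <= m)%N -> rapid (u k)) ->
  (forall k, (k <= m)%N -> tempered (g k)) -> rapid (bform lam m u g).
Proof.
elim: m u g => [|m IH] u g ru tg /=; first by apply: rapidM; [exact: ru|exact: tg].
apply: rapidD; last by apply: IH => k km; [exact: ru|exact: tg].
by apply/rapidZ/IH => k km; [apply: ru|apply: tg]; exact: leqW.
Qed.

Lemma rapid_bprim (lam : R) m (u g : nat -> R -> R) :
  (forall k, (k < 2 * m)%N -> rapid (u k)) ->
  (forall k, (k < m)%N -> tempered (g k)) -> rapid (bprim lam m u g).
Proof.
elim: m u => [|m IH] u ru tg /=; first exact: rapid0.
apply: (@rapid_near (fun t => bform lam m (sh u) g t + (-1) * bprim lam m (helm lam u) g t)).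
  by near=> t; rewrite mulN1r.
apply: rapidD.
  by apply: rapid_bform => k km; [apply: ru; lia|exact: tg].
apply/rapidZ/IH => k km; last by apply: tg; lia.
apply: (@rapid_near (fun t => u k.+2 t + (- lam) * u k t)).
  by near=> t; rewrite mulNr.
by apply: rapidD; [apply: ru; lia|apply: rapidZ; apply: ru; lia].
Unshelve. all: by end_near. Qed.

End growth.

(** * Behaviour of a single frequency at infinity *)

Section far.
Context {R : realType}.
Notation mu_ := (@lebesgue_measure R).
Implicit Types (u g : nat -> R -> R) (t : R).

Lemma nonintegrable_ray (f : R -> R) (c T : R) : 0 < c ->
  (forall t, 0 <= f t) -> (forall t, T <= t -> c <= f t) ->
  mu_.-integrable setT (EFin \o f) -> False.
Proof.
move=> c0 f0 fT /[dup] fi /integrableP [mf].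
have -> : (\int[mu_]_x `|(EFin \o f) x| = \int[mu_]_x (f x)%:E)%E.
  by apply: eq_integral => x _ /=; rewrite ger0_norm.
apply/negP; rewrite -leNgt leye_eq -leye_eq.
apply: (@le_trans _ _ (\int[mu_]_(x in `[T, +oo[) (f x)%:E)%E); last first.
  by apply: ge0_subset_integral => // x _; rewrite lee_fin.
apply: (@le_trans _ _ (\int[mu_]_(x in `[T, +oo[) c%:E)%E).
  rewrite integral_cst //= lebesgue_measure_itv /= ltry.
  by rewrite addye // mulry gtr0_sg // mul1e.
apply: ge0_le_integral => //.
- by move=> x _; rewrite lee_fin ltW.
- exact: measurable_funS mf.
- by move=> x /=; rewrite in_itv andbT lee_fin; exact: fT.
Qed.

(** Since |h| <= 1 + h^2 <= 1 + w, the increment of f over [0, t] is at most t plus the integral of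
    w, so f grows at most linearly. *)
Lemma tempered_sqr_integrable (f h w : R -> R) :
  (forall t : R, is_derive t 1 f (h t)) -> (forall t, {for t, continuous h}) ->
  (forall t, h t ^+ 2 <= w t) -> mu_.-integrable setT (EFin \o w) ->
  tempered f.
Proof.
move=> fh ch hw iw.
have w0 t : 0 <= w t by exact: le_trans (sqr_ge0 _) (hw t).
have h1 t : `|h t| <= 1 + w t.
  have := sqr_ge0 (`|h t| - 1); have := hw t; rewrite -(real_normK (num_real (h t))).
  by have := normr_ge0 (h t); nra.
have mw := measurable_int _ iw.
have C1 : (0 <= \int[mu_]_x (w x)%:E)%E by apply: integral_ge0 => x _; rewrite lee_fin.
have C2 : (\int[mu_]_x (w x)%:E < +oo)%E.
  case/integrableP: iw => _; under eq_integral do rewrite /= ger0_norm //; exact.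
pose C := fine (\int[mu_]_x (w x)%:E); have CE : (\int[mu_]_x (w x)%:E)%E = C%:E.
  by rewrite fineK // ge0_fin_numE.
have C0 : 0 <= C by rewrite fine_ge0.
exists 1%N, (`|f 0| + 1 + C); exists 1; split => [|t t1]; first exact: num_real.
have t0 : 0 < t by lra.
have mh (A : set (measurableTypeR R)) : measurable A ->
    measurable_fun A (h : measurableTypeR R -> measurableTypeR R).
  move=> mA.
  apply: (@measurable_funS _ _ _ _ setT) => //.
  by apply: continuous_measurable_fun => s; exact: ch.
have cf s : f @ s --> f s by have := is_derive_continuous (fh s).
have : (`|f t - f 0|%:E <= (t + C)%:E)%E.
  rewrite -abse_EFin.
  have <- : (\int[mu_]_(x in `[0%R, t]) (h x)%:E)%E = (f t - f 0)%:E.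
    apply: (@continuous_FTC2 R h f 0 t t0).
    - by apply: continuous_in_subspaceT => s _; exact: ch.
    - by split=> [s _||]; [exact: ex_derive|exact/cvg_at_right_filter/cf|
        exact/cvg_at_left_filter/cf].
    - by move=> s _; rewrite derive1E; exact: derive_val.
  apply: le_trans (le_abse_integral _ _ _) _ => //.
    by apply/measurable_EFinP; exact: mh.
  apply: (@le_trans _ _ (\int[mu_]_(x in `[0%R, t]) (1%:E + (w x)%:E))%E).
    apply: ge0_le_integral => //.
    - by apply/measurableT_comp => //; apply/measurable_EFinP; exact: mh.
    - by apply: emeasurable_funD => //; exact: measurable_funS mw.
    - by move=> x _; rewrite -EFinD lee_fin.
  rewrite ge0_integralD //=; first last.
  - exact: measurable_funS mw.
  - by move=> x _; rewrite lee_fin.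
  rewrite integral_cst //= mul1e lebesgue_measure_itv /= lte_fin t0 -EFinB subr0.
  rewrite EFinD leeD2l // -CE.
  by apply: ge0_subset_integral => // x _; rewrite lee_fin.
rewrite lee_fin expr1 => H.
have -> : f t = (f t - f 0) + f 0 by rewrite subrK.
apply: (le_trans (ler_normD _ _)).
have := ler_peMr (normr_ge0 (f 0)) (ltW t1); have := ler_peMr C0 (ltW t1).
by rewrite !mulrDl; lra.
Qed.

Lemma is_derive_zero_near (f : R -> R) (t a l : R) : a < t ->
  (forall s, a < s -> f s = 0) -> is_derive t 1 f l -> l = 0.
Proof.
move=> at_ f0 fl; have <- : 'D_1 f t = l by exact: derive_val.
rewrite (@near_eq_derive _ _ _ f (cst 0) t 1) ?oner_neq0 ?derive_cst //.
have : \forall s \near t, a < s by exact: lt_nbhsr.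
by apply: filterS => s /f0.
Qed.

(** v = (D + mu)^p u solves (D - mu)^p v = 0, so it is e^(mu t) q(t) with q a polynomial. If q were
    nonzero, |v| would stay away from 0 near +oo, and the form, which dominates v^2 up to a
    constant, would not be integrable. *)
Lemma far_zero p (mu : R) u a : 0 <= mu ->
  (forall k t, (k < 2 * p)%N -> a < t -> is_derive t 1 (u k) (u k.+1 t)) ->
  (forall t, a < t -> iter p (helm (mu ^+ 2)) u 0 t = 0) ->
  mu_.-integrable setT (EFin \o bform (mu ^+ 2) p u u) ->
  exists2 T, a <= T & forall t, T < t -> forall k, (p <= k < 2 * p)%N ->
    iter k (dshift mu) u 0 t = 0.
Proof.
move=> mu0 du ode iu; set v := iter p (dshift mu) u.
have dv k t : (k < p)%N -> a < t -> forall j, (j <= k)%N -> is_derive t 1 (v j) (v j.+1 t).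
  move=> kp at_ j jk; apply: is_derive_dshift => i ip; apply: du => //; lia.
have [|t at_|q _ qv] := @chain_poly R p
    (fun k t => expR (- mu * t) * iter k (dshift (- mu)) v 0 t) a.
- by move=> k t kp at_; apply: is_derive_expdshift; exact: dv.
- by have := ode t at_; rewrite iter_helm => ->; rewrite mulr0.
have v0 t : a < t -> v 0 t = expR (mu * t) * q.[t].
  move=> /qv <-; rewrite mulrA -expRD mulNr subrr expR0 mul1r //.
have q0 : q = 0.
  apply/eqP/negPn/negP => q0.
  have [T [c c0 qc]] : exists T, exists2 c, 0 < c & forall t, T <= t -> c <= `|q.[t]|.
    have : lead_coef q != 0 by rewrite lead_coef_eq0.
    rewrite neq_lt => /orP[lq|lq].
      have [|T HT] := @poly_pinfty_gt_lc _ (- q); first by rewrite lead_coefN oppr_gt0.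
      exists T, (lead_coef (- q)); first by rewrite lead_coefN oppr_gt0.
      by move=> t /HT; rewrite hornerN -normrN => /le_trans; apply; exact: ler_norm.
    have [//|T HT] := @poly_pinfty_gt_lc _ q.
    exists T, (lead_coef q) => // t /HT /le_trans; apply; exact: ler_norm.
  apply: (@nonintegrable_ray (bform (mu ^+ 2) p u u) (c ^+ 2 / 2 ^+ p)
    (Num.max T (Num.max 0 (a + 1)))) iu.
  - by rewrite divr_gt0 ?exprn_gt0.
  - by move=> t; apply: bform_ge0; exact: sqr_ge0.
  move=> t; rewrite !ge_max => /and3P[Tt t0 at_].
  rewrite ler_pdivrMr ?exprn_gt0 // mulrC.
  apply: le_trans (sqr_dshift_le mu p u t); rewrite -/v v0; last lra.
  rewrite -(real_normK (num_real (_ * _))) lerXn2r ?nnegrE ?(ltW c0) //.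
  rewrite normrM (gtr0_norm (expR_gt0 _)) (le_trans (qc _ Tt)) // ler_peMl //.
  by rewrite -expR0 ler_expR mulr_ge0.
exists a => // t at_ k /andP[pk kp]; rewrite -(subnKC pk) in kp *.
(* Higher k follow by differentiation: e^(mu t) (D + mu)^k u is zero on the whole ray and its
   derivative is e^(mu t) (D + mu)^(k+1) u. *)
elim: (k - p)%N t at_ kp => [|j IH] t at_ kp.
  by rewrite addn0 -/v v0 // q0 horner0 mulr0.
have D : is_derive t 1 (fun s => expR (mu * s) * iter (p + j) (dshift mu) u 0 s)
    (expR (mu * t) * iter (p + j).+1 (dshift mu) u 0 t).
  by apply: is_derive_expdshift => i ij; apply: du => //; lia.
have Z s : a < s -> expR (mu * s) * iter (p + j) (dshift mu) u 0 s = 0.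
  by move=> as_; rewrite IH ?mulr0 //; lia.
have /eqP := is_derive_zero_near at_ Z D.
by rewrite mulf_eq0 expR_eq0 addnS /= => /eqP.
Qed.

Lemma rapid_dshift (mu : R) k u :
  (forall j, (j <= k)%N -> rapid (iter j (dshift mu) u 0)) -> rapid (u k).
Proof.
elim: k u => [|k IH] u ru; first exact: (ru 0).
apply: (@rapid_near _ (fun t => dshift mu u k t + (- mu) * u k t)).
  by near=> t; rewrite /dshift; ring.
apply: rapidD.
  by apply: IH => j jk; rewrite -iterSr; exact: ru.
by apply/rapidZ/IH => j jk; apply/ru/leqW.
Unshelve. all: by end_near. Qed.

Lemma far_field p (mu : R) u g a : 0 <= mu ->
  (forall k t, (k < 2 * p)%N -> a < t -> is_derive t 1 (u k) (u k.+1 t)) ->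
  (forall t, a < t -> iter p (helm (mu ^+ 2)) u 0 t = 0) ->
  mu_.-integrable setT (EFin \o bform (mu ^+ 2) p u u) ->
  (forall k t, (k < p)%N -> is_derive t 1 (g k) (g k.+1 t)) ->
  (forall t, {for t, continuous (g p)}) ->
  mu_.-integrable setT (EFin \o bform (mu ^+ 2) p g g) ->
  bprim (mu ^+ 2) p u g t @[t --> +oo] --> 0.
Proof.
move=> mu0 du ode iu dg cg ig; apply: rapid_cvg0.
have [T aT uT] := far_zero mu0 du ode iu.
have HT : \forall t \near (+oo : set_system R), T < t.
  by apply: nbhs_pinfty_gt; exact: num_real.
(* Descending order of differentiation: the derivative of order p - 1 grows at most linearly because
   that of order p is square integrable, and each integration below it preserves polynomial
   growth. *)
have tg j : (j < p)%N -> tempered (g (p - j.+1)%N).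
  elim: j => [|j IH] jp.
    apply: (@tempered_sqr_integrable _ (g p) (bform (mu ^+ 2) p g g)) => // t.
      by have := dg (p - 1)%N t; rewrite (_ : (p - 1).+1 = p); [apply; lia|lia].
    by apply: bform_ge_last; exact: sqr_ge0.
  apply: (@tempered_antiderive _ _ (g (p - j.+1)%N) 0); last by apply: IH; lia.
  by move=> t _; rewrite -(subnSK jp); apply: dg; lia.
have {}tg k : (k < p)%N -> tempered (g k).
  move=> kp; have -> : k = (p - (p - k.+1).+1)%N by lia.
  by apply: tg; lia.
have [mu_eq0|mu_neq0] := eqVneq mu 0.
  apply: (@rapid_near _ (cst 0)); last exact: rapid0.
  apply: filterS HT => t Tt; rewrite mu_eq0 expr0n /= bprim0 // => k kp.
  have E l i : iter l (dshift 0) u i t = u (i + l)%N t.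
    elim: l i => [|l IH] i /=; first by rewrite addn0.
    by rewrite /dshift mul0r addr0 IH addSnnS.
  by have := uT t Tt k kp; rewrite mu_eq0 E add0n.
have mu_gt0 : 0 < mu by rewrite lt_def mu_neq0.
apply: rapid_bprim => // k kp; apply: (@rapid_dshift mu) => j jk.
have [jp|pj] := ltnP j p; last first.
  apply: (@rapid_near _ (cst 0)); last exact: rapid0.
  by apply: filterS HT => t Tt; rewrite uT //; lia.
(* The functions e^(mu t) (D + mu)^(j+k) u are successive derivatives in k and vanish at k = p - j,
   so (D + mu)^j u is e^(-mu t) times a polynomial. *)
have [|t Tt|q _ qE] := @chain_poly R (p - j)
    (fun k t => expR (mu * t) * iter (j + k) (dshift mu) u 0 t) T.
- move=> i t ip Tt; rewrite addnS; apply: is_derive_expdshift => l li.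
  by apply: du; [lia|exact: le_lt_trans Tt].
- by rewrite subnKC ?(ltnW jp) // uT ?mulr0 //; lia.
apply: rapid_near (rapid_expR_poly q mu_gt0).
apply: filterS HT => t /qE <-; rewrite addn0 mulrA -expRD addNr expR0 mul1r //.
Qed.

End far.

(** * Orthogonality for a single frequency *)

Section orthogonality.
Context {R : realType}.
Notation leb := (@lebesgue_measure R).
Implicit Types (u g : nat -> R -> R) (t : R).

Lemma integrable_reflect (w : R -> R) : (forall t, {for t, continuous w}) ->
  (forall t, 0 <= w t) -> leb.-integrable setT (EFin \o w) ->
  leb.-integrable setT (EFin \o (w \o -%R)).
Proof.
move=> cw w0 iw.
have cN : continuous (w \o -%R).
  by move=> t; apply: continuous_comp; [exact: opp_continuous|exact: cw].
have mw (A : set (measurableTypeR R)) (f : R -> R) : continuous f -> measurable A ->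
    measurable_fun A (EFin \o (f : measurableTypeR R -> measurableTypeR R)).
  move=> cf mA; apply/measurable_EFinP; apply: (@measurable_funS _ _ _ _ setT) => //.
  exact: continuous_measurable_fun.
have Wfin (A : set R) : measurable A -> (\int[leb]_(x in A) (w x)%:E < +oo)%E.
  move=> mA; case/integrableP: iw => m; apply: le_lt_trans.
  apply: (@le_trans _ _ (\int[leb]_x (w x)%:E)%E).
    apply: ge0_subset_integral => //.
    by move=> x _; rewrite lee_fin.
  by under [leRHS]eq_integral do rewrite /= ger0_norm //.
apply/integrableP; split; first exact: (mw _ _ cN).
under eq_integral do rewrite /= ger0_norm //.
have -> : [set: R] = `]-oo, (- 0)%R] `|` `]0, +oo[.
  by rewrite oppr0 -itv_bndbnd_setU // set_itvE.
rewrite ge0_integral_setU //=; first last.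
- rewrite oppr0; apply/disj_setPS => x [] /=; rewrite !in_itv /= andbT => x0.
  by rewrite ltNge x0.
- by move=> x _; rewrite lee_fin.
- by apply: (mw _ _ cN); apply: measurableU.
apply: lte_add_pinfty.
  rewrite (@ge0_integration_by_substitutionNy R (w \o -%R) 0).
  - by under eq_integral do rewrite /= opprK; exact: Wfin.
  - exact: continuous_subspaceT.
  - by move=> x _ /=.
apply: (@le_lt_trans _ _ (\int[leb]_(x in `]-oo, (- 0)%R]) (w x)%:E)%E); last exact: Wfin.
rewrite ge0_integration_by_substitutionNy //; last exact: continuous_subspaceT.
apply: ge0_subset_integral => //; first by apply: (mw _ _ cN).
  by move=> x _; rewrite lee_fin.
by move=> x /=; rewrite !in_itv /= !andbT; exact: ltW.
Qed.

Lemma is_derive_helm (lam : R) m u i t :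
  (forall j, (j <= 2 * m + i)%N -> is_derive t 1 (u j) (u j.+1 t)) ->
  is_derive t 1 (iter m (helm lam) u i) (iter m (helm lam) u i.+1 t).
Proof.
elim: m i => [|m IH] i du /=; first by apply: du; lia.
have {}IH k : (k = i \/ k = i.+2) ->
    is_derive t 1 (iter m (helm lam) u k) (iter m (helm lam) u k.+1 t).
  by move=> ki; apply: IH => j jm; apply: du; lia.
have ? := IH i (or_introl erefl); have ? := IH i.+2 (or_intror erefl).
have -> : helm lam (iter m (helm lam) u) i =
  iter m (helm lam) u i.+2 - lam *: iter m (helm lam) u i by [].
exact: is_derive_eq.
Qed.

Lemma continuous_helm (lam : R) m u i t :
  (forall j, (j <= 2 * m + i)%N -> {for t, continuous (u j)}) ->
  {for t, continuous (iter m (helm lam) u i)}.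
Proof.
elim: m i => [|m IH] i cu /=; first by apply: cu; lia.
apply: (@continuousB _ _ _ (iter m (helm lam) u i.+2)
  (fun s => lam * iter m (helm lam) u i s)).
  by apply: IH => j jm; apply: cu; lia.
apply: continuousM; first exact: cst_continuous.
by apply: IH => j jm; apply: cu; lia.
Qed.

Definition reflect_seq u : nat -> R -> R := fun k s => (-1) ^+ k * u k (- s).

Lemma reflect_helm (lam : R) m u :
  iter m (helm lam) (reflect_seq u) = reflect_seq (iter m (helm lam) u).
Proof.
elim: m => //= m ->; apply/funext => k; apply/funext => s.
by rewrite /helm /reflect_seq !exprS; ring.
Qed.

Lemma reflect_bform (lam : R) m u g t :
  bform lam m (reflect_seq u) (reflect_seq g) t = bform lam m u g (- t).
Proof. exact: bform_reflect. Qed.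

Lemma bform_opp (lam : R) m u g t :
  bform lam m (fun k s => - u k s) g t = - bform lam m u g t.
Proof. by elim: m u g => [|m IH] u g /=; rewrite ?mulNr // !IH; ring. Qed.

Lemma reflect_bprim (lam : R) m u g t :
  bprim lam m (reflect_seq u) (reflect_seq g) t = - bprim lam m u g (- t).
Proof.
elim: m u => [|m IH] u /=; first by rewrite oppr0.
have := reflect_helm lam 1 u; rewrite /= => ->; rewrite IH.
have -> : sh (reflect_seq u) = (fun k s => - reflect_seq (sh u) k s).
  by apply/funext => k; apply/funext => s; rewrite /sh /reflect_seq exprS; ring.
by rewrite bform_opp reflect_bform; ring.
Qed.

Lemma is_derive_reflect u k t : is_derive (- t) 1 (u k) (u k.+1 (- t)) ->
  is_derive t 1 (reflect_seq u k) (reflect_seq u k.+1 t).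
Proof.
move=> ?; have ? : is_derive t 1 (-%R : R -> R) (-1) by exact: is_deriveNid.
have -> : reflect_seq u k = (-1) ^+ k *: (u k \o -%R) by [].
apply: is_derive_eq; rewrite /reflect_seq exprS /GRing.scale /=; ring.
Qed.

Lemma ode_orthogonality m (mu : R) (Z : seq R) u g : (0 < m)%N -> 0 <= mu ->
  (forall k t, (k <= 2 * m)%N -> {for t, continuous (u k)}) ->
  (forall k t, (k < 2 * m.+1)%N -> t \notin Z -> is_derive t 1 (u k) (u k.+1 t)) ->
  (forall t, t \notin Z -> iter m.+1 (helm (mu ^+ 2)) u 0 t = 0) ->
  (forall k t, (k < m.+1)%N -> is_derive t 1 (g k) (g k.+1 t)) ->
  (forall t, {for t, continuous (g m.+1)}) ->
  (forall t, t \in Z -> g 0 t = 0) ->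
  leb.-integrable setT (EFin \o bform (mu ^+ 2) m.+1 u u) ->
  leb.-integrable setT (EFin \o bform (mu ^+ 2) m.+1 g g) ->
  leb.-integrable setT (EFin \o bform (mu ^+ 2) m.+1 u g) /\
  (\int[leb]_x (bform (mu ^+ 2) m.+1 u g x)%:E = 0)%E.
Proof.
move=> m0 mu0 cu du ode dg cg gZ iu ig.
set lam := mu ^+ 2 in ode iu ig *.
have lam0 : 0 <= lam by exact: sqr_ge0.
have cgk k t : (k <= m.+1)%N -> {for t, continuous (g k)}.
  rewrite leq_eqVlt => /predU1P[->|km]; first exact: cg.
  by apply: is_derive_continuous; exact: dg.
have cbf w h : (forall k t, (k <= m.+1)%N -> {for t, continuous (w k)}) ->
    (forall k t, (k <= m.+1)%N -> {for t, continuous (h k)}) ->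
    forall t, {for t, continuous (bform lam m.+1 w h)}.
  by move=> cw ch t; apply: continuous_bform => k km; [exact: cw|exact: ch].
(* Here m > 0 gives m + 1 <= 2m: the derivatives of u occurring in the form are continuous across
   the knots. *)
have cu1 k t : (k <= m.+1)%N -> {for t, continuous (u k)} by move=> km; apply: cu; lia.
have cq := cbf _ _ cu1 cgk.
have cP t : {for t, continuous (bprim lam m.+1 u g)}.
  have [tZ|tZ] := boolP (t \in Z); last first.
    apply: is_derive_continuous; by apply: is_derive_bprim => k km; exact: du.
  apply: continuous_bprim => [k km|k km||]; [exact: cu|apply: cgk; lia|exact: gZ|].
  (* Off [Z] the equation identifies the derivative of (D^2 - lam)^m u' with lam (D^2 - lam)^m u.
     The latter is continuous at t, hence bounded near t, and so (D^2 - lam)^m u' is bounded near t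
     as well. *)
  have [K HK] : exists K, \forall s \near t, `|lam * iter m (helm lam) u 0 s| <= K.
    exists (`|lam * iter m (helm lam) u 0 t| + 1).
    have : {for t, continuous (fun s => lam * iter m (helm lam) u 0 s)}.
      apply: continuousM; first exact: cst_continuous.
      by apply: continuous_helm => j jm; apply: cu; lia.
    move=> /cvgrPdist_lt /(_ 1 ltr01); apply: filterS => s h.
    rewrite -lerBlDl (le_trans (lerB_dist _ _)) // distrC ltW //.
  apply: (@bounded_near_removable _ _ (fun s => lam * iter m (helm lam) u 0 s) Z t K) => // s sZ.
  have := ode s sZ; rewrite /= {1}/helm => /eqP; rewrite subr_eq0 => /eqP <-.
  by apply: is_derive_helm => j jm; apply: du => //; lia.
(* Both sides are continuous on the whole line, so the exceptional points are removable and the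
   fundamental theorem of calculus applies across the knots. *)
have dP t : is_derive t 1 (bprim lam m.+1 u g) (bform lam m.+1 u g t).
  apply: (@is_derive_removable _ _ _ Z) => // s sZ.
  have := @is_derive_bprim R lam m.+1 u g s _ _.
  by rewrite ode // mulr0 mul0r subr0; apply => k km; exact: du.
have iq : leb.-integrable setT (EFin \o bform lam m.+1 u g).
  apply: (@le_integrable _ _ _ leb _ _ _
    ((EFin \o bform lam m.+1 u u) \+ (EFin \o bform lam m.+1 g g))%E) => //.
  - by apply/measurable_EFinP; apply: continuous_measurable_fun => t; exact: cq.
  - move=> t _; rewrite lee_fin (le_trans (normr_bform m.+1 u g t lam0)) //.
    exact: ler_norm.
  - exact: integrableD.
split => //.
have [b Zb] : exists b, forall t, t \in Z -> `|t| <= b.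
  elim: Z {du ode gZ cP dP} => [|z Z [b IH]]; first by exists 0.
  exists (Num.max `|z| b) => t; rewrite inE => /orP[/eqP->|/IH].
    by rewrite le_max lexx.
  by rewrite le_max orbC => ->.
have notZ t : b < t -> t \notin Z.
  move=> bt; apply/negP => /Zb; apply/negP; rewrite -ltNge.
  by rewrite (lt_le_trans bt) // ler_norm.
have notZ' t : b < t -> - t \notin Z.
  move=> bt; apply/negP => /Zb; apply/negP; rewrite -ltNge normrN.
  by rewrite (lt_le_trans bt) // ler_norm.
have P1 : bprim lam m.+1 u g t @[t --> +oo] --> 0.
  apply: (@far_field _ _ _ _ _ b) => //.
  - by move=> k t km /notZ bt; exact: du.
  - by move=> t /notZ; exact: ode.
(* The reflected sequences satisfy the same hypotheses, since D^2 - lam commutes with reflection and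
   the forms are only reflected. *)
have P2 : bprim lam m.+1 u g (- t) @[t --> +oo] --> 0.
  have -> : (fun t => bprim lam m.+1 u g (- t)) =
      - bprim lam m.+1 (reflect_seq u) (reflect_seq g).
    by apply/funext => t; rewrite fctE reflect_bprim opprK.
  rewrite -oppr0; apply: cvgN; apply: (@far_field _ _ _ _ _ b) => //.
  - by move=> k t km /notZ' bt; apply: is_derive_reflect; exact: du.
  - by move=> t /notZ' bt; rewrite reflect_helm /reflect_seq ode ?mulr0.
  - have -> : bform lam m.+1 (reflect_seq u) (reflect_seq u) =
        bform lam m.+1 u u \o -%R by apply/funext => t; exact: reflect_bform.
    by apply: integrable_reflect => // t; [exact: cbf|exact: bform_ge0].
  - by move=> k t km; apply: is_derive_reflect; exact: dg.
  - move=> t; rewrite /reflect_seq; apply: continuousM; first exact: cst_continuous.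
    by apply: continuous_comp; [exact: opp_continuous|exact: cg].
  - have -> : bform lam m.+1 (reflect_seq g) (reflect_seq g) =
        bform lam m.+1 g g \o -%R by apply/funext => t; exact: reflect_bform.
    by apply: integrable_reflect => // t; [exact: cbf|exact: bform_ge0].
pose q := bform lam m.+1 u g; pose P := bprim lam m.+1 u g.
have seqy : (fun n : nat => n.+1%:R : R) @ \oo --> +oo.
  by have := @cvgr_idn R; rewrite -cvg_shiftS.
have I1 (n : nat) : (\int[leb]_(x in `[(- n.+1%:R)%R, n.+1%:R]) (q x)%:E =
    (P n.+1%:R - P (- n.+1%:R))%:E)%E.
  apply: continuous_FTC2.
  - by rewrite gtrN ?ltr0n.
  - by apply: continuous_in_subspaceT => t _; exact: cq.
  - by split=> [t _||]; [exact: ex_derive|exact/cvg_at_right_filter/cP|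
      exact/cvg_at_left_filter/cP].
  - by move=> t _; rewrite derive1E; exact: derive_val.
have L1 : (fun n : nat => (\int[leb]_(x in `[(- n.+1%:R)%R, n.+1%:R]) (q x)%:E)%E)
    @ \oo --> 0%E.
  under eq_fun do rewrite I1; apply: cvg_EFin; first by near=> n.
  rewrite -[0]subr0; apply: cvgB.
    exact: (cvg_comp _ _ seqy P1).
  exact: (cvg_comp _ _ seqy P2).
have L2 : (fun n : nat => (\int[leb]_(x in `[(- n.+1%:R)%R, n.+1%:R]) (q x)%:E)%E)
    @ \oo --> (\int[leb]_x (q x)%:E)%E.
  under eq_fun do rewrite integral_mkcond.
  have mq : measurable_fun setT (EFin \o q) by exact: measurable_int iq.
  have [|||||_ _] := @dominated_convergence _ _ R leb setT measurableT
    (fun n => (EFin \o q) \_ `[(- n.+1%:R)%R, n.+1%:R]) (EFin \o q) (abse \o (EFin \o q)).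
  - by move=> n; apply/(measurable_restrictT _ _).1; [|exact: measurable_funS mq].
  - exact: mq.
  - apply: aeW => t _; apply: cvg_near_cst.
    have : \forall n \near \oo, `|t| <= n.+1%:R.
      exact: (seqy _ (nbhs_pinfty_ge (num_real `|t|))).
    apply: filterS => n; rewrite ler_norml => tn; rewrite /patch ifT //.
    by rewrite inE /= in_itv.
  - exact: integrable_abse.
  - apply: aeW => t n _ /=; rewrite /patch; case: ifP => _ //=.
    by rewrite normr0 lee_fin.
  - exact.
exact: (cvg_unique _ L2 L1).
Unshelve. all: by end_near. Qed.

End orthogonality.

(** * Lebesgue measure and integrals on the torus *)

Section row_topology.
Context {R : realType}.

Lemma continuous_rV (T : topologicalType) n (f : T -> 'rV[R]_n) (x : T) :
  (forall i, {for x, continuous (fun t => f t ord0 i)}) -> {for x, continuous f}.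
Proof.
move=> cf A [P hP sPA].
have : \forall t \near x, forall i, P ord0 i (f t ord0 i).
  by apply: filter_forall => i; apply: cf; exact: hP.
by apply: filterS => t Pt; apply: sPA => i j; rewrite (ord1 i).
Qed.

Lemma point0 n (t : R) (y : 'rV[R]_n) : point t y ord0 ord0 = t.
Proof. exact: (cons_rV0 (t, y)). Qed.

Lemma pointS n (t : R) (y : 'rV[R]_n) i : point t y ord0 (lift ord0 i) = y ord0 i.
Proof. exact: (cons_rVS (t, y)). Qed.

Lemma rV_point n (x : 'rV[R]_n.+1) :
  x = point (x ord0 ord0) (\row_j x ord0 (lift ord0 j)).
Proof.
apply/rowP => i; case: (unliftP ord0 i) => [j|] ->; rewrite ?point0 //.
by rewrite pointS mxE.
Qed.

Lemma continuous_pointr n t : continuous (fun y : 'rV[R]_n => point t y).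
Proof.
move=> y; apply: continuous_rV => i; case: (unliftP ord0 i) => [j|] ->.
  rewrite (_ : (fun _ => _) = (fun M : 'rV[R]_n => M ord0 j)).
    exact: coord_continuous.
  by apply/funext => z; rewrite pointS.
rewrite (_ : (fun _ => _) = cst t); first exact: cst_continuous.
by apply/funext => z; rewrite point0.
Qed.

Lemma continuous_pointl n (y : 'rV[R]_n) : continuous (fun t : R => point t y).
Proof.
move=> t; apply: continuous_rV => i; case: (unliftP ord0 i) => [j|] ->.
  rewrite (_ : (fun _ => _) = cst (y ord0 j)); first exact: cst_continuous.
  by apply/funext => z; rewrite pointS.
rewrite (_ : (fun _ => _) = id); first exact: cvg_id.
by apply/funext => z; rewrite point0.
Qed.

Let rbox n (q : 'rV[rat]_n) (k : nat) : set 'rV[R]_n :=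
  [set x | forall i, `|ratr (q ord0 i) - x ord0 i| < k.+1%:R^-1].

Let measurable_rbox n q k : measurable (@rbox n q k).
Proof.
have -> : rbox q k = \bigcap_(i in [set: 'I_n])
    ((fun x : 'rV[R]_n => x ord0 i : measurableTypeR R) @^-1`
      (ball (ratr (q ord0 i) : R) k.+1%:R^-1)).
  by apply/seteqP; split => x /= H i; [move=> _; exact: H|exact: H].
apply: fin_bigcap_measurable => [|i _]; first exact: finite_finset.
rewrite -[X in measurable X]setTI; apply: measurable_coord => //.
exact: measurable_ball.
Qed.

(** An open set is the countable union of the boxes with rational centre and radius 1/(k + 1) that
    it contains, and each box is a finite intersection of preimages under coordinates. *)
Lemma open_measurable_rV n (A : set 'rV[R]_n) : open A -> measurable A.
Proof.
move=> oA; pose F (m : nat) := if unpickle m is Some (q, k) then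
  if `[< rbox q k `<=` A >] then @rbox n q k else set0 else set0.
suff -> : A = \bigcup_m F m.
  apply: bigcupT_measurable => m; rewrite /F; case: unpickle => [[q k]|] //.
  by case: ifP => // _; exact: measurable_rbox.
apply/seteqP; split => [x Ax|x [m _]]; last first.
  rewrite /F; case: unpickle => [[q k]|] //.
  by case: ifPn => // /asboolP sA; exact: sA.
have /nbhs_ballP[e /= e0 eA] : nbhs x A by exact: open_nbhs_nbhs.
(* The factor 2: the centre q lies within 1/(k + 1) of x, and the points of the box lie within 1/(k
   + 1) of q. *)
have [k ke] : exists k : nat, 2 * k.+1%:R^-1 < e.
  have e2 : 0 < e / 2 by rewrite divr_gt0.
  have [k] := ltr_add_invr e2; rewrite add0r ltr_pdivlMr // mulrC => hk.
  by exists k.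
have q_ i : exists q : rat, `|ratr q - x ord0 i| < k.+1%:R^-1.
  have [] := @rat_in_itvoo _ (x ord0 i - k.+1%:R^-1) (x ord0 i + k.+1%:R^-1).
    by rewrite ltrD2l gtrN // invr_gt0.
  move=> q; rewrite in_itv /= => /andP[h1 h2]; exists q.
  by rewrite ltr_norml ltrBrDl h1 ltrBlDl h2.
pose q : 'rV[rat]_n := \row_i xchoose (q_ i).
have qx i : `|ratr (q ord0 i) - x ord0 i| < k.+1%:R^-1.
  by rewrite mxE; exact: (xchooseP (q_ i)).
exists (pickle (q, k)) => //; rewrite /F pickleK ifT //; apply/asboolP => y qy.
apply: eA; split=> // i j; rewrite (ord1 i) /ball /=.
have -> : x ord0 j - y ord0 j = (ratr (q ord0 j) - y ord0 j) - (ratr (q ord0 j) - x ord0 j).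
  by ring.
apply: le_lt_trans (ler_normB _ _) _; apply: lt_trans (ltrD (qy j) (qx j)) _.
by rewrite -mulr2n -[ltLHS]mulr_natl.
Qed.

Lemma continuous_measurable_rV n (f : 'rV[R]_n -> R) : continuous f ->
  measurable_fun setT (f : 'rV[R]_n -> measurableTypeR R).
Proof.
move=> /continuousP cf; apply: (measurability _ (RGenOpens.measurableE R)).
move=> _ [_ [a [b ->] <-]]; rewrite setTI; apply: open_measurable_rV.
exact/cf/interval_open.
Qed.

End row_topology.

(** * Fubini for cylinders *)

Section fubini.
Context {R : realType} (n : nat).
Notation leb := (@lebesgue_measure R).
Notation lebn := (@lebesgue_rV R n).

Definition cyl (A : set (measurableTypeR R)) (B : set 'rV[R]_n) : set 'rV[R]_n.+1 :=
  [set x | A (x ord0 ord0) /\ B (\row_j x ord0 (lift ord0 j))].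

Lemma cyl_uncons A B : cyl A B = @uncons_rV R n @^-1` (A `*` B).
Proof. by []. Qed.

Lemma cons_cyl A B : @cons_rV R n @^-1` cyl A B = A `*` B.
Proof.
rewrite cyl_uncons -comp_preimage (_ : _ \o _ = id) //.
by apply/funext => p; exact: cons_rVK.
Qed.

Lemma measurable_cyl A B : measurable A -> measurable B -> measurable (cyl A B).
Proof.
move=> mA mB; rewrite cyl_uncons -[X in measurable X]setTI.
by apply: measurable_uncons_rV => //; exact: measurableX.
Qed.

Lemma lebesgue_rV_cyl A B : measurable A -> measurable B ->
  lebesgue_rV n.+1 (cyl A B) = (leb A * lebn B)%E.
Proof.
move=> mA mB; rewrite /= /lebesgue_rV_step /pushforward cons_cyl.
by rewrite product_measure1E.
Qed.

(** The measure in dimension n + 1 is the image of a product measure under [cons_rV], and [cyl A B]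
    pulls back to the product of A and B. Extending by zero reduces the claim to Fubini on the whole
    product. *)
Lemma fubini_rV A B (f : 'rV[R]_n.+1 -> \bar R) : measurable A -> measurable B ->
  (lebesgue_rV n.+1).-integrable (cyl A B) f ->
  leb.-integrable A (fun s => \int[lebn]_(y in B) f (point s y))%E /\
  (\int[lebesgue_rV n.+1]_(x in cyl A B) f x =
   \int[leb]_(s in A) \int[lebn]_(y in B) f (point s y))%E.
Proof.
move=> mA mB fi.
have mf := measurable_int _ fi.
have mfc : measurable_fun (A `*` B) (f \o @cons_rV R n).
  apply: (measurable_comp _ _ mf); first exact: measurable_cyl.
    by move=> _ [p ABp <-]; rewrite -cons_cyl in ABp.
  exact: measurable_funS (@measurable_cons_rV R n).
have ic : (leb \x lebn)%E.-integrable (A `*` B) (f \o @cons_rV R n).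
  apply/integrableP; split => //.
  have /integrableP[_] := fi; rewrite (ge0_integral_pushforward (@measurable_cons_rV R n)) //.
  - by rewrite cons_cyl.
  - exact: measurable_cyl.
  - exact: measurableT_comp.
have iT : (leb \x lebn)%E.-integrable setT ((f \o @cons_rV R n) \_ (A `*` B)).
  by apply/(integrable_mkcond _ _).1 => //; exact: measurableX.
have FE s : fubini_F lebn ((f \o @cons_rV R n) \_ (A `*` B)) s =
    ((fun s => \int[lebn]_(y in B) f (point s y))%E \_ A) s.
  rewrite /fubini_F /patch; case: ifPn => sA.
    rewrite [RHS]integral_mkcond; apply: eq_integral => y _.
    by rewrite /patch in_setX sA.
  by apply: integral0_eq => y _; rewrite in_setX (negbTE sA).
split.
  apply/(integrable_mkcond _ _).2 => //.
  by rewrite -(funext FE); exact: (integrable_fubini_F iT).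
rewrite [RHS]integral_mkcond; under [RHS]eq_integral do rewrite -FE.
rewrite (integral12_prod_meas1 iT).
have mC := measurable_cyl mA mB.
have gT : measurable_fun setT (f \_ (cyl A B)) by exact/(measurable_restrictT _ _).1.
have E : ((f \o @cons_rV R n) \_ (A `*` B)) = (f \_ (cyl A B)) \o @cons_rV R n.
  by apply/funext => p; rewrite /patch /= -cons_cyl (_ : (p \in _) = (cons_rV p \in cyl A B)) //;
    apply/idP/idP; rewrite !inE.
rewrite integral_mkcond E; rewrite E in iT.
have := integral_pushforward (@measurable_cons_rV R n) gT (D := setT) _ measurableT.
by rewrite preimage_setT; apply.
Qed.

End fubini.

Section torus_integral.
Context {R : realType}.
Notation leb := (@lebesgue_measure R).

Definition tint n (f : 'rV[R]_n -> R) : R := \int[lebesgue_rV n]_(y in @torus R n) f y.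

Lemma torusS n : @torus R n.+1 = cyl `[- pi, pi] (@torus R n).
Proof.
apply/seteqP; split => x /= H.
  by split; [rewrite /= in_itv /=; exact: H|move=> i; rewrite mxE; exact: H].
case: H => x0 xS i; case: (unliftP ord0 i) => [j|] ->; last by move: x0; rewrite /= in_itv.
by have := xS j; rewrite mxE.
Qed.

Lemma slab_cyl n : @slab R n = cyl setT (@torus R n).
Proof.
apply/seteqP; split => x /= H.
  by split=> // i; rewrite mxE; apply: H; rewrite eq_sym neq_lift.
case: H => _ xS i; case: (unliftP ord0 i) => [j|] ->; last by rewrite eqxx.
by have := xS j; rewrite mxE.
Qed.

Lemma measurable_torus n : measurable (@torus R n).
Proof.
have -> : @torus R n = \bigcap_(i in [set: 'I_n])
    ((fun x : 'rV[R]_n => x ord0 i : measurableTypeR R) @^-1` `[- pi, pi]%classic).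
  apply/seteqP; split => x /= H i; first by move=> _ /=; rewrite in_itv; exact: H.
  by have := H i I; rewrite /= in_itv.
apply: fin_bigcap_measurable => [|i _]; first exact: finite_finset.
by rewrite -[X in measurable X]setTI; exact: measurable_coord.
Qed.

Lemma lebesgue_torus_fin n : (lebesgue_rV n (@torus R n) < +oo)%E.
Proof.
elim: n => [|n IH]; first by rewrite /= diracE ltry.
rewrite torusS lebesgue_rV_cyl //; last exact: measurable_torus.
rewrite lte_mul_pinfty ?measure_ge0 //=.
by rewrite lebesgue_measure_itv /=; case: ifP => // _; rewrite -EFinB.
Qed.

Lemma compact_box n (a b : 'I_n -> R) :
  compact [set x : 'rV[R]_n | forall i, a i <= x ord0 i <= b i].
Proof.
have := @rV_compact R n (fun i => `[a i, b i]%classic) (fun i => @segment_compact R (a i) (b i)).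
by congr compact; apply/seteqP; split => x /= H i; have := H i; rewrite /= in_itv.
Qed.

Lemma compact_box_bounded n (a b : 'I_n -> R) (f : 'rV[R]_n -> R) :
  (forall x : 'rV[R]_n, (forall i, a i <= x ord0 i <= b i) -> {for x, continuous f}) ->
  exists M, forall x : 'rV[R]_n, (forall i, a i <= x ord0 i <= b i) -> `|f x| <= M.
Proof.
move=> cf; set B := [set x : 'rV[R]_n | forall i, a i <= x ord0 i <= b i].
have cB : {within B, continuous f}.
  by apply: continuous_in_subspaceT => x; rewrite inE; exact: cf.
have [M [_ MB]] := compact_bounded (continuous_compact cB (@compact_box n a b)).
exists (M + 1) => x Bx; apply: (MB (M + 1)); first by rewrite ltrDl.
by exists x.
Qed.

Lemma integrable_torus n (f : 'rV[R]_n -> R) : continuous f ->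
  (lebesgue_rV n).-integrable (@torus R n) (EFin \o f).
Proof.
move=> cf; apply: measurable_bounded_integrable.
- exact: measurable_torus.
- exact: lebesgue_torus_fin.
- exact: measurable_funS (continuous_measurable_rV cf).
have [M HM] := @compact_box_bounded n (fun=> - pi) (fun=> pi) f (fun x _ => cf x).
exists M; split => [|K MK x Tx]; first exact: num_real.
exact: le_trans (HM x Tx) (ltW MK).
Qed.

Lemma tint0 (f : 'rV[R]_0 -> R) : tint f = f 0.
Proof.
have E (x : 'rV[R]_0) : x = 0 by apply/rowP => -[].
rewrite /tint /Rintegral /= integral_dirac.
  have T0 : @torus R 0 0 by case.
  by rewrite diracE (mem_set T0) mul1e.
- exact: measurable_torus.
apply/measurable_EFinP => _ Y mY.
have [H|H] := pselect (Y (f 0)); [rewrite (_ : _ `&` _ = @torus R 0)|rewrite (_ : _ `&` _ = set0)] => //.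
- exact: measurable_torus.
- by apply/seteqP; split => [x []//|x Tx]; split=> //=; rewrite (E x).
- by apply/seteqP; split => [x [_] /=|//]; rewrite (E x).
Qed.

Lemma tint_slice n (f : 'rV[R]_n.+1 -> R) s : continuous f ->
  continuous (fun y => f (point s y)).
Proof.
by move=> cf y; apply: continuous_comp; [exact: continuous_pointr|exact: cf].
Qed.

Lemma tintS n (f : 'rV[R]_n.+1 -> R) : continuous f ->
  tint f = \int[leb]_(s in `[- pi, pi]) tint (fun y => f (point s y)).
Proof.
move=> cf; rewrite /tint /Rintegral {1}torusS; congr fine.
have := integrable_torus cf; rewrite torusS => fi.
rewrite (fubini_rV _ _ fi).2 //; last exact: measurable_torus.
apply: eq_integral => s _; rewrite fineK //.
by apply: integrable_fin_num; [exact: measurable_torus|exact/integrable_torus/tint_slice].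
Qed.

Lemma tintD n (f g : 'rV[R]_n -> R) : continuous f -> continuous g ->
  tint (fun y => f y + g y) = tint f + tint g.
Proof.
by move=> cf cg; apply: RintegralD; [exact: measurable_torus|exact: integrable_torus..].
Qed.

Lemma tintZ n (f : 'rV[R]_n -> R) c : continuous f ->
  tint (fun y => c * f y) = c * tint f.
Proof.
by move=> cf; apply: RintegralZl; [exact: measurable_torus|exact: integrable_torus].
Qed.

Lemma tintB n (f g : 'rV[R]_n -> R) : continuous f -> continuous g ->
  tint (fun y => f y - g y) = tint f - tint g.
Proof.
by move=> cf cg; apply: RintegralB; [exact: measurable_torus|exact: integrable_torus..].
Qed.

Lemma eq_tint n (f g : 'rV[R]_n -> R) : (forall y, @torus R n y -> f y = g y) ->
  tint f = tint g.
Proof. by move=> fg; apply: eq_Rintegral => y; rewrite inE; exact: fg. Qed.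

Lemma le_tint n (f g : 'rV[R]_n -> R) : continuous f -> continuous g ->
  (forall y, @torus R n y -> f y <= g y) -> tint f <= tint g.
Proof.
move=> cf cg fg; apply: le_Rintegral => //; [exact: measurable_torus|exact: integrable_torus..].
Qed.

Lemma tint_ge0 n (f : 'rV[R]_n -> R) : (forall y, @torus R n y -> 0 <= f y) -> 0 <= tint f.
Proof. exact: Rintegral_ge0. Qed.

Lemma tint_sum n I (r : seq I) (P : pred I) (F : I -> 'rV[R]_n -> R) :
  (forall i, continuous (F i)) ->
  tint (fun y => \sum_(i <- r | P i) F i y) = \sum_(i <- r | P i) tint (F i).
Proof.
move=> cF; have cS (s : seq I) : continuous (fun y => \sum_(i <- s | P i) F i y).
  elim: s => [|i s IH]; first by under eq_fun do rewrite big_nil; exact: cst_continuous.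
  under eq_fun do rewrite big_cons; case: (P i) => // y.
  by apply: continuousD; [exact: cF|exact: IH].
elim: r => [|i r IH].
  rewrite big_nil; under eq_fun do rewrite big_nil.
  by rewrite /tint /Rintegral integral0.
rewrite big_cons; under eq_fun do rewrite big_cons.
by case: (P i) => //; rewrite tintD // IH.
Qed.

Lemma normr_tint n (f : 'rV[R]_n -> R) : continuous f ->
  `|tint f| <= tint (fun y => `|f y|).
Proof.
by move=> cf; apply: le_normr_Rintegral; [exact: measurable_torus|exact: integrable_torus].
Qed.

End torus_integral.

(** * Differentiation under the integral sign *)

Section slices.
Context {R : realType} (n : nat).
Implicit Types (h : 'rV[R]_n.+1 -> R) (t : R) (y : 'rV[R]_n).

Lemma pointDl (k t : R) y :
  point (k *: 1 + t) y = k *: delta_mx ord0 ord0 + point t y.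
Proof.
apply/rowP => i; rewrite [RHS]mxE [X in _ = X + _]mxE; case: (unliftP ord0 i) => [j|] ->.
  by rewrite !pointS mxE /= mulr0 add0r.
by rewrite !point0 mxE.
Qed.

Lemma pointDr (k t : R) y (j : 'I_n) :
  point t (k *: delta_mx ord0 j + y) = k *: delta_mx ord0 (lift ord0 j) + point t y.
Proof.
apply/rowP => i; rewrite [RHS]mxE [X in _ = X + _]mxE; case: (unliftP ord0 i) => [l|] ->.
  by rewrite !pointS !mxE /= (inj_eq lift_inj).
by rewrite !point0 mxE /= mulr0 add0r.
Qed.

Lemma is_derive_slice h t y :
  derivable h (point t y) (delta_mx ord0 ord0) ->
  is_derive t 1 (fun s => h (point s y)) (partial ord0 h (point t y)).
Proof.
rewrite /derivable /partial /derive => hd.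
have E : (fun k : R => k^-1 *: (((fun s => h (point s y)) \o shift t) (k *: 1) - h (point t y)))
   = (fun k : R => k^-1 *: ((h \o shift (point t y)) (k *: delta_mx ord0 ord0) - h (point t y))).
  by apply/funext => k; rewrite /= pointDl.
by apply: DeriveDef; rewrite /derivable /derive E.
Qed.

Let slice_quotient h t y j :
  (fun k : R => k^-1 *: (((fun y => h (point t y)) \o shift y) (k *: delta_mx ord0 j)
    - h (point t y))) =
  (fun k : R => k^-1 *: ((h \o shift (point t y)) (k *: delta_mx ord0 (lift ord0 j))
    - h (point t y))).
Proof. by apply/funext => k; rewrite /= pointDr. Qed.

Lemma partial_slice h t y j :
  partial (lift ord0 j) h (point t y) = partial j (fun y => h (point t y)) y.
Proof. by rewrite /partial /derive -slice_quotient. Qed.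

Lemma derivable_slice h t y j :
  derivable h (point t y) (delta_mx ord0 (lift ord0 j)) ->
  derivable (fun y => h (point t y)) y (delta_mx ord0 j).
Proof. by rewrite /derivable -slice_quotient. Qed.

Lemma continuous_slice h t : (forall y, {for point t y, continuous h}) ->
  continuous (fun y => h (point t y)).
Proof.
by move=> ch y; apply: continuous_comp; [exact: continuous_pointr|exact: ch].
Qed.

(** Compactness of [t - r, t + r] times the torus gives the bound, which is the dominating constant
    when limits and derivatives in t are taken under the integral. *)
Lemma tint_bound (I : set R) h t : open I -> I t ->
  (forall x : 'rV[R]_n.+1, I (x ord0 ord0) -> {for x, continuous h}) ->
  exists r, [/\ 0 < r, (forall s, t - r < s < t + r -> I s) &
  exists2 M, 0 <= M & forall s y, t - r < s < t + r -> torus y -> `|h (point s y)| <= M].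
Proof.
move=> oI It ch.
have /nbhs_ballP[e /= e0 eI] : nbhs t I by exact: open_nbhs_nbhs.
have e2 : 0 < e / 2 by rewrite divr_gt0.
have sI s : t - e / 2 <= s <= t + e / 2 -> I s.
  move=> /andP[h1 h2]; apply: eI; rewrite /ball /= ltr_norml; apply/andP; split; lra.
exists (e / 2); split => //.
  by move=> s /andP[h1 h2]; apply: sI; rewrite !ltW.
pose a (i : 'I_n.+1) : R := if unlift ord0 i is Some j then - pi else t - e / 2.
pose b (i : 'I_n.+1) : R := if unlift ord0 i is Some j then pi else t + e / 2.
have [|M HM] := @compact_box_bounded R n.+1 a b h.
  by move=> x H; apply/ch/sI; have := H ord0; rewrite /a /b unlift_none.
exists `|M| => // s y /andP[s1 s2] Ty; apply: le_trans (ler_norm M); apply: HM => i.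
rewrite /a /b; case: (unliftP ord0 i) => [j|] ->; first by rewrite pointS.
by rewrite point0 !ltW.
Qed.

(** Regularity is asked only over [I], because the top derivatives of a polyspline are available
    only inside the strips. *)
Lemma is_derive_tint (I : set R) h t : open I -> I t ->
  (forall x : 'rV[R]_n.+1, I (x ord0 ord0) -> {for x, continuous h}) ->
  (forall x : 'rV[R]_n.+1, I (x ord0 ord0) -> derivable h x (delta_mx ord0 ord0)) ->
  (forall x : 'rV[R]_n.+1, I (x ord0 ord0) -> {for x, continuous (partial ord0 h)}) ->
  is_derive t 1 (fun s => tint (fun y => h (point s y)))
    (tint (fun y => partial ord0 h (point t y))).
Proof.
move=> oI It ch dh cdh.
have [r [r0 rI [M M0 HM]]] := tint_bound oI It cdh.
have Itr : (`]t - r, t + r[%classic) t by rewrite /= in_itv /=; apply/andP; split; lra.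
have D s y : (`]t - r, t + r[%classic) s ->
    is_derive s 1 (fun s => h (point s y)) (partial ord0 h (point s y)).
  by rewrite /= in_itv => /rI Is; apply: is_derive_slice; apply: dh; rewrite point0.
have P1 s : (`]t - r, t + r[%classic) s ->
    (lebesgue_rV n).-integrable (@torus R n) (EFin \o (fun y => h (point s y))).
  rewrite /= in_itv => /rI Is; apply: integrable_torus; apply: continuous_slice => y.
  by apply: ch; rewrite point0.
have P2 s y : (`]t - r, t + r[%classic) s -> @torus R n y ->
    derivable ((fun s y => h (point s y)) ^~ y) s 1.
  by move=> Is _; have ? := D s y Is; exact: ex_derive.
have P3 s y : (`]t - r, t + r[%classic) s -> @torus R n y ->
    `|partial1of2 (fun s y => h (point s y)) s y| <= M.
  move=> Is Ty; rewrite partial1of2E; have ? := D s y Is.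
  by rewrite derive_val; apply: HM => //; move: Is; rewrite /= in_itv.
have P4 : (lebesgue_rV n).-integrable (@torus R n) (EFin \o (cst M)).
  by apply: integrable_torus; exact: cst_continuous.
have mT := @measurable_torus R n.
have H1 := derivable_under_integral mT Itr P1 P2 (fun=> M0) P4 P3.
have H2 := differentiation_under_integral mT Itr P1 P2 (fun=> M0) P4 P3.
apply: DeriveDef; first exact: H1.
rewrite -derive1E H2; apply: eq_tint => y Ty.
by rewrite partial1of2E; have ? := D t y Itr; exact: derive_val.
Qed.

Lemma continuous_tint (I : set R) h t : open I -> I t ->
  (forall x : 'rV[R]_n.+1, I (x ord0 ord0) -> {for x, continuous h}) ->
  {for t, continuous (fun s => tint (fun y => h (point s y)))}.
Proof.
move=> oI It ch.
have [r [r0 rI [M M0 HM]]] := tint_bound oI It ch.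
have Itr : (`]t - r, t + r[%classic) t by rewrite /= in_itv /=; apply/andP; split; lra.
have P1 s : (`]t - r, t + r[%classic) s ->
    (lebesgue_rV n).-integrable (@torus R n) (EFin \o (fun y => h (point s y))).
  rewrite /= in_itv => /rI Is; apply: integrable_torus; apply: continuous_slice => y.
  by apply: ch; rewrite point0.
have P4 : (lebesgue_rV n).-integrable (@torus R n) (EFin \o (cst M)).
  by apply: integrable_torus; exact: cst_continuous.
have mT := @measurable_torus R n.
apply: (continuity_under_integral mT P1 _ P4).
- apply: aeW => y Ty s; rewrite inE /= in_itv => /rI Is.
  apply: continuous_comp; first exact: continuous_pointl.
  by apply: ch; rewrite point0.
- by move=> s Is; apply: aeW => y Ty; apply: HM => //; move: Is; rewrite /= in_itv.
- by rewrite inE.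
Qed.

End slices.

(** * Integration by parts on the torus *)

Section by_parts.
Context {R : realType}.
Notation leb := (@lebesgue_measure R).

Definition rperiodic d (i : 'I_d) (f : 'rV[R]_d -> R) : Prop :=
  forall x, f (x + (2 * pi) *: delta_mx ord0 i) = f x.

Definition C1per n (j : 'I_n) (f : 'rV[R]_n -> R) : Prop :=
  [/\ continuous f, forall y, derivable f y (delta_mx ord0 j),
      continuous (partial j f) & rperiodic j f].

(** Induction on the dimension. For the first coordinate, the inner integral is a function of s
    whose values at -pi and pi agree by periodicity; for any other coordinate the inner integral
    already vanishes. *)
Lemma tint_partial0 n (j : 'I_n) (f : 'rV[R]_n -> R) : C1per j f ->
  tint (partial j f) = 0.
Proof.
elim: n j f => [[]//|n IH] j f [cf df cpf pf].
rewrite tintS //; case: (unliftP ord0 j) => [i|] ji; last first.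
  have D (s : R) : is_derive s 1 (fun s => tint (fun y => f (point s y)))
      (tint (fun y => partial ord0 f (point s y))).
    apply: (@is_derive_tint _ _ setT) => // [|x _|x _|x _]; first exact: openT.
    - exact: cf.
    - by rewrite -ji; exact: df.
    - by rewrite -ji; exact: cpf.
  have cD (s : R) : {for s, continuous (fun s => tint (fun y => partial ord0 f (point s y)))}.
    apply: (@continuous_tint _ _ setT) => // [|x _]; first exact: openT.
    by rewrite -ji; exact: cpf.
  have cF s := is_derive_continuous (D s).
  rewrite /Rintegral ji (@continuous_FTC2 _ _ (fun s => tint (fun y => f (point s y)))).
  - rewrite -EFinB /= -[RHS](subrr (tint (fun y => f (point (- pi) y)))).
    congr (_ - _); apply: eq_tint => y _.
    rewrite -[RHS]pf ji addrC -pointDl; congr (f (point _ _)).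
    by rewrite /GRing.scale /=; ring.
  - by have := pi_gt0 R; lra.
  - by apply: continuous_in_subspaceT => s _; exact: cD.
  - by split=> [s _||]; [exact: ex_derive|exact/cvg_at_right_filter/cF|
      exact/cvg_at_left_filter/cF].
  - by move=> s _; rewrite derive1E; exact: derive_val.
have E s : tint (fun y => partial j f (point s y)) = 0.
  rewrite -[RHS](IH i (fun y => f (point s y))).
    by apply: eq_tint => y _; rewrite ji partial_slice.
  split; first exact: tint_slice.
  - by move=> y; apply: derivable_slice; rewrite -ji; exact: df.
  - have -> : partial i (fun y => f (point s y)) = (fun y => partial j f (point s y)).
      by apply/funext => y; rewrite ji partial_slice.
    exact: tint_slice.
  - by move=> y; rewrite addrC pointDr addrC -ji pf.
by under eq_Rintegral do rewrite E; rewrite /Rintegral integral0.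
Qed.

Lemma is_derive_dir d (f : 'rV[R]_d -> R) (x v : 'rV[R]_d) l :
  is_derive (0 : R) 1 (fun k : R => f (k *: v + x)) l -> is_derive x v f l.
Proof.
have E : (fun h : R => h^-1 *: (((fun k : R => f (k *: v + x)) \o shift (0 : R)) (h *: 1)
    - f ((0 : R) *: v + x))) = (fun h : R => h^-1 *: ((f \o shift x) (h *: v) - f x)).
  by apply/funext => h; rewrite /= addr0 scale0r add0r /GRing.scale /= mulr1.
by case; rewrite /derivable /derive E => h1 h2; apply: DeriveDef; rewrite /derivable /derive.
Qed.

Lemma continuous_mul (T : topologicalType) (f g : T -> R) :
  continuous f -> continuous g -> continuous (fun y => f y * g y).
Proof. by move=> cf cg y; apply: continuousM; [exact: cf|exact: cg]. Qed.

Lemma continuous_add (T : topologicalType) (f g : T -> R) :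
  continuous f -> continuous g -> continuous (fun y => f y + g y).
Proof. by move=> cf cg y; apply: continuousD; [exact: cf|exact: cg]. Qed.

Lemma continuous_sumr (T : topologicalType) I (r : seq I) (P : pred I)
    (F : I -> T -> R) (x : T) : (forall i, {for x, continuous (F i)}) ->
  {for x, continuous (fun y => \sum_(i <- r | P i) F i y)}.
Proof.
move=> cF; elim: r => [|i r IH].
  rewrite (_ : (fun _ => _) = cst 0); first exact: cst_continuous.
  by apply/funext => y; rewrite big_nil.
case Pi : (P i).
  rewrite (_ : (fun _ => _) = (fun y => F i y + \sum_(j <- r | P j) F j y)).
    by apply: continuousD; [exact: cF|exact: IH].
  by apply/funext => y; rewrite big_cons Pi.
rewrite (_ : (fun _ => _) = (fun y => \sum_(j <- r | P j) F j y)) //.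
by apply/funext => y; rewrite big_cons Pi.
Qed.

Section frequency.
Context {n : nat} (xi : 'rV[int]_n).
Notation fd := (@freq_dot R n xi).

Lemma freq_dotD y z : fd (y + z) = fd y + fd z.
Proof.
by rewrite /freq_dot -big_split /=; apply: eq_bigr => i _; rewrite !mxE mulrDr.
Qed.

Lemma freq_dotZ k y : fd (k *: y) = k * fd y.
Proof.
by rewrite /freq_dot mulr_sumr; apply: eq_bigr => i _; rewrite !mxE mulrCA.
Qed.

Lemma freq_dot_delta j : fd (delta_mx ord0 j) = (xi ord0 j)%:~R.
Proof.
rewrite /freq_dot (bigD1 j) //= big1 ?addr0; last first.
  by move=> i ij; rewrite mxE /= (negbTE ij) mulr0.
by rewrite mxE !eqxx mulr1.
Qed.

Lemma freq_dotN y : fd (- y) = - fd y.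
Proof. by rewrite -scaleN1r freq_dotZ mulN1r. Qed.

Lemma continuous_freq_dot : continuous fd.
Proof.
move=> y; apply: continuous_sumr => i.
by apply: continuousM; [exact: cst_continuous|exact: coord_continuous].
Qed.

Lemma continuous_cosfd : continuous (fun y => cos (fd y)).
Proof.
move=> y; apply: continuous_comp; [exact: continuous_freq_dot|exact: continuous_cos].
Qed.

Lemma continuous_sinfd : continuous (fun y => sin (fd y)).
Proof.
move=> y; apply: continuous_comp; [exact: continuous_freq_dot|exact: continuous_sin].
Qed.

Lemma trig_int_period (m : int) (x : R) :
  cos (x + m%:~R * (2 * pi)) = cos x /\ sin (x + m%:~R * (2 * pi)) = sin x.
Proof.
have P (k : nat) (z : R) : cos (z + k%:R * (2 * pi)) = cos z /\ sin (z + k%:R * (2 * pi)) = sin z.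
  have -> : k%:R * (2 * pi) = (pi *+ 2) *+ k :> R by rewrite mulr_natl -(mulr_natl pi 2).
  by split; [rewrite (periodicn (@cosD2pi R))|rewrite (periodicn (@sinD2pi R))].
case: m => k; first exact: P.
rewrite NegzE mulrNz mulNr -[in X in _ = X /\ _](subrK (k.+1%:R * (2 * pi)) x).
by rewrite -[in X in _ /\ _ = X](subrK (k.+1%:R * (2 * pi)) x) !(P _ _).1 !(P _ _).2.
Qed.

Lemma is_derive_freq (g dg : R -> R) j y :
  (forall s : R, is_derive s 1 g (dg s)) ->
  is_derive y (delta_mx ord0 j) (fun y => g (fd y)) ((xi ord0 j)%:~R * dg (fd y)).
Proof.
move=> dgP; apply: is_derive_dir.
have -> : (fun k : R => g (fd (k *: delta_mx ord0 j + y))) =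
    g \o (fun k : R => k * (xi ord0 j)%:~R + fd y).
  by apply/funext => k; rewrite /= freq_dotD freq_dotZ freq_dot_delta.
have ? := dgP (0 * (xi ord0 j)%:~R + fd y).
have ? : is_derive (0 : R) 1 (fun k : R => k * (xi ord0 j)%:~R + fd y) (xi ord0 j)%:~R.
  have -> : (fun k : R => k * (xi ord0 j)%:~R + fd y) = (xi ord0 j)%:~R *: id + cst (fd y).
    by apply/funext => k; rewrite !fctE /GRing.scale /= mulrC.
  by apply: is_derive_eq; rewrite addr0 /GRing.scale /= mulr1.
by apply: is_derive_eq; rewrite mul0r add0r mulrC.
Qed.

Definition fcos (f : 'rV[R]_n -> R) := tint (fun y => cos (fd y) * f y).
Definition fsin (f : 'rV[R]_n -> R) := tint (fun y => sin (fd y) * f y).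

(** Used with g = cos and g = sin. Integrality of the frequency makes g(fd y) periodic, so the
    derivative of its product with f has zero integral. *)
Let by_parts (g dg : R -> R) j f : continuous g -> continuous dg ->
  (forall s : R, is_derive s 1 g (dg s)) ->
  (forall s (m : int), g (s + m%:~R * (2 * pi)) = g s) -> C1per j f ->
  tint (fun y => g (fd y) * partial j f y) =
  - ((xi ord0 j)%:~R * tint (fun y => dg (fd y) * f y)).
Proof.
move=> cg cdg dgP pg [cf df cpf pf].
have cgf : continuous (fun y => g (fd y)).
  by move=> y; apply: continuous_comp; [exact: continuous_freq_dot|exact: cg].
have cdgf : continuous (fun y => dg (fd y)).
  by move=> y; apply: continuous_comp; [exact: continuous_freq_dot|exact: cdg].
have c1 : continuous (fun y => g (fd y) * partial j f y).
  exact: continuous_mul.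
have c2 : continuous (fun y => dg (fd y) * f y).
  exact: continuous_mul.
have c3 : continuous (fun y => (xi ord0 j)%:~R * (dg (fd y) * f y)).
  by apply: continuous_mul => //; exact: cst_continuous.
have D y : is_derive y (delta_mx ord0 j) (fun y => g (fd y) * f y)
    (g (fd y) * partial j f y + (xi ord0 j)%:~R * (dg (fd y) * f y)).
  have ? := is_derive_freq j y dgP.
  have ? : is_derive y (delta_mx ord0 j) f (partial j f y) by apply: DeriveDef.
  have -> : (fun y => g (fd y) * f y) = (fun y => g (fd y)) * f by [].
  by apply: is_derive_eq; rewrite /GRing.scale /=; ring.
have PE : partial j (fun y => g (fd y) * f y) =
    (fun y => g (fd y) * partial j f y + (xi ord0 j)%:~R * (dg (fd y) * f y)).
  by apply/funext => y; have ? := D y; exact: derive_val.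
apply/eqP; rewrite -addr_eq0 -tintZ // -tintD // -PE; apply/eqP/tint_partial0; split.
- exact: continuous_mul.
- by move=> y; have ? := D y; exact: ex_derive.
- by rewrite PE; exact: continuous_add.
- by move=> y; rewrite pf freq_dotD freq_dotZ freq_dot_delta [X in _ + X]mulrC pg.
Qed.

Lemma fcos_partial j f : C1per j f -> fcos (partial j f) = (xi ord0 j)%:~R * fsin f.
Proof.
move=> Cf; have cs : continuous (@sin R) := @continuous_sin R.
rewrite /fcos (by_parts (dg := fun s => - sin s) _ _ _ _ Cf).
- rewrite -mulrN -[X in _ * X]mulN1r -tintZ; first by congr (_ * _); apply: eq_tint => y _; ring.
  by case: Cf => cf _ _ _; apply: continuous_mul => // y; apply: continuousN; exact: continuous_sinfd.
- exact: continuous_cos.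
- by move=> s; apply: continuousN; exact: cs.
- by move=> s m; exact: (trig_int_period m s).1.
Qed.

Lemma fsin_partial j f : C1per j f -> fsin (partial j f) = - ((xi ord0 j)%:~R * fcos f).
Proof.
move=> Cf; rewrite /fsin (by_parts (dg := cos) _ _ _ _ Cf) //.
- exact: continuous_sin.
- exact: continuous_cos.
- by move=> s m; exact: (trig_int_period m s).2.
Qed.

End frequency.
End by_parts.

(** * Fourier coefficients in the periodic variables *)

Section Ck_facts.
Context {R : realType} (d : nat).
Implicit Types (U V : set 'rV[R]_d) (f g : 'rV[R]_d -> R) (i : 'I_d).

Lemma Ck_on_cont U k f x : Ck_on U k f -> U x -> {for x, continuous f}.
Proof. by case: k => [|k] [cf _]; exact: cf. Qed.

Lemma Ck_on_derivable U k f i x : Ck_on U k.+1 f -> U x ->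
  derivable f x (delta_mx ord0 i).
Proof. by move=> [_ /(_ i)[df _]]; exact: df. Qed.

Lemma Ck_on_partial U k f i : Ck_on U k.+1 f -> Ck_on U k (partial i f).
Proof. by move=> [_ /(_ i)[]]. Qed.

Lemma Ck_on_pred U k f : Ck_on U k.+1 f -> Ck_on U k f.
Proof.
elim: k f => [|k IH] f [cf df]; first by split.
by split=> // i; have [df1 df2] := df i; split => //; exact: IH.
Qed.

Lemma Ck_on_le U k l f : (k <= l)%N -> Ck_on U l f -> Ck_on U k f.
Proof.
by move=> /subnK <-; elim: (l - k)%N => [|m IH] // /Ck_on_pred; exact: IH.
Qed.

Lemma Ck_on_iter U k l i f : Ck_on U (l + k) f -> Ck_on U k (iter l (partial i) f).
Proof.
elim: l k => [|l IH] k // Ck; apply: Ck_on_partial; apply: IH.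
by rewrite addnS.
Qed.

Lemma eq_on_partial U f g i x : open U -> (forall z, U z -> f z = g z) -> U x ->
  partial i f x = partial i g x.
Proof.
move=> oU fg Ux; apply: near_eq_derive.
have : nbhs x U by exact: open_nbhs_nbhs.
exact: filterS.
Qed.

Lemma eq_on_Ck U k f g : open U -> (forall z, U z -> f z = g z) ->
  Ck_on U k f -> Ck_on U k g.
Proof.
move=> oU; have nU x : U x -> nbhs x U by move=> Ux; exact: open_nbhs_nbhs.
have cfg h l x : (forall z, U z -> h z = l z) -> U x ->
    {for x, continuous h} -> {for x, continuous l}.
  move=> hl Ux ch; apply: (@cvg_trans _ (h @ x)); last by rewrite -hl.
  have H : \forall z \near x, h z = l z by apply: filterS (nU x Ux).
  exact: near_eq_cvg H.
elim: k f g => [|k IH] f g fg [cf df].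
  by split => // x Ux; exact: cfg fg Ux (cf x Ux).
split=> [x Ux|i]; first exact: cfg fg Ux (cf x Ux).
have [df1 df2] := df i; split => [x Ux|].
  apply: near_eq_derivable (df1 x Ux); apply: filterS (nU x Ux) => z Uz.
  exact: fg.
by apply: IH df2 => z Uz; exact: (eq_on_partial i oU fg Uz).
Qed.

Lemma partialD f g i x : derivable f x (delta_mx ord0 i) ->
  derivable g x (delta_mx ord0 i) ->
  partial i (fun z => f z + g z) x = partial i f x + partial i g x.
Proof. by move=> df dg; rewrite /partial -deriveD. Qed.

Lemma partialB f g i x : derivable f x (delta_mx ord0 i) ->
  derivable g x (delta_mx ord0 i) ->
  partial i (fun z => f z - g z) x = partial i f x - partial i g x.
Proof. by move=> df dg; rewrite /partial -deriveB. Qed.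

Lemma Ck_onD U k f g : open U -> Ck_on U k f -> Ck_on U k g ->
  Ck_on U k (fun z => f z + g z).
Proof.
move=> oU; elim: k f g => [|k IH] f g [cf df] [cg dg].
  by split=> // x Ux; apply: continuousD; [exact: cf|exact: cg].
split=> [x Ux|i]; first by apply: continuousD; [exact: cf|exact: cg].
have [df1 df2] := df i; have [dg1 dg2] := dg i; split.
  by move=> x Ux; apply: derivableD; [exact: df1|exact: dg1].
apply: eq_on_Ck (IH _ _ df2 dg2) => // z Uz.
by rewrite partialD //; [exact: df1|exact: dg1].
Qed.

Lemma Ck_onB U k f g : open U -> Ck_on U k f -> Ck_on U k g ->
  Ck_on U k (fun z => f z - g z).
Proof.
move=> oU; elim: k f g => [|k IH] f g [cf df] [cg dg].
  by split=> // x Ux; apply: continuousB; [exact: cf|exact: cg].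
split=> [x Ux|i]; first by apply: continuousB; [exact: cf|exact: cg].
have [df1 df2] := df i; have [dg1 dg2] := dg i; split.
  by move=> x Ux; apply: derivableB; [exact: df1|exact: dg1].
apply: eq_on_Ck (IH _ _ df2 dg2) => // z Uz.
by rewrite partialB //; [exact: df1|exact: dg1].
Qed.

Lemma Ck_on0 U k : Ck_on U k (fun=> 0).
Proof.
elim: k => [|k IH]; first by split => // x _; exact: cst_continuous.
split=> [x _|i]; first exact: cst_continuous.
split=> [x _|]; first exact: derivable_cst.
rewrite (_ : partial i _ = (fun=> 0)) //; apply/funext => x.
by rewrite /partial derive_cst.
Qed.

Lemma Ck_on_sum U k I (r : seq I) (F : I -> 'rV[R]_d -> R) : open U ->
  (forall a, Ck_on U k (F a)) -> Ck_on U k (fun z => \sum_(a <- r) F a z).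
Proof.
move=> oU CF; elim: r => [|a r IH].
  by under eq_fun do rewrite big_nil; exact: Ck_on0.
by under eq_fun do rewrite big_cons; exact: Ck_onD.
Qed.

Definition rlaplacian f : 'rV[R]_d -> R := fun x => \sum_(i < d) partial i (partial i f) x.

Lemma Ck_on_rlaplacian U k f : open U -> Ck_on U k.+2 f -> Ck_on U k (rlaplacian f).
Proof. by move=> oU Cf; apply: Ck_on_sum => // i; do 2!apply: Ck_on_partial. Qed.

Lemma rperiodic_partial i j f : rperiodic j f -> rperiodic j (partial i f).
Proof.
move=> pf x; rewrite /partial /derive.
have E : (fun h : R => h^-1 *: ((f \o shift (x + (2 * pi) *: delta_mx ord0 j))
      (h *: delta_mx ord0 i) - f (x + (2 * pi) *: delta_mx ord0 j))) =
    (fun h : R => h^-1 *: ((f \o shift x) (h *: delta_mx ord0 i) - f x)).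
  by apply/funext => h; rewrite /= addrA !pf.
by rewrite E.
Qed.

Lemma rperiodic_iter i j k f : rperiodic j f -> rperiodic j (iter k (partial i) f).
Proof. by move=> pf; elim: k => //= k; exact: rperiodic_partial. Qed.

Lemma rperiodic_rlaplacian j f : rperiodic j f -> rperiodic j (rlaplacian f).
Proof.
by move=> pf x; apply: eq_bigr => i _; do 2!apply: rperiodic_partial.
Qed.

End Ck_facts.
Arguments rlaplacian {R d}.

Section fourier_in_t.
Context {R : realType} (n : nat).
Implicit Types (h : 'rV[R]_n.+1 -> R) (I : set R).

Definition layer I : set 'rV[R]_n.+1 := [set x | I (x ord0 ord0)].

Lemma open_layer I : open I -> open (layer I).
Proof.
move=> oI; apply: (@open_comp _ _ (fun x : 'rV[R]_n.+1 => x ord0 ord0)) => // x _.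
exact: coord_continuous.
Qed.

Definition tail (x : 'rV[R]_n.+1) : 'rV[R]_n := \row_j x ord0 (lift ord0 j).

Lemma tail_point t y : tail (point t y) = y.
Proof. by apply/rowP => j; rewrite mxE pointS. Qed.

Lemma continuous_tail : continuous tail.
Proof.
move=> x; apply: continuous_rV => i.
rewrite (_ : (fun _ => _) = (fun x : 'rV[R]_n.+1 => x ord0 (lift ord0 i))).
  exact: coord_continuous.
by apply/funext => z; rewrite mxE.
Qed.

Section weight.
Variable w : 'rV[R]_n -> R.
Hypothesis cw : continuous w.

Definition wtint h t := tint (fun y => w y * h (point t y)).

(** The weight becomes a factor that is constant in t, so that the unweighted results apply to the
    product. *)
Let wh h x := w (tail x) * h x.

Let wtintE h t : wtint h t = tint (fun y => wh h (point t y)).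
Proof. by apply: eq_tint => y _; rewrite /wh tail_point. Qed.

Let wh_cont h x : {for x, continuous h} -> {for x, continuous (wh h)}.
Proof.
move=> ch; apply: continuousM => //.
by apply: continuous_comp; [exact: continuous_tail|exact: cw].
Qed.

Let wh_derive h x : derivable h x (delta_mx ord0 ord0) ->
  is_derive x (delta_mx ord0 ord0) (wh h) (wh (partial ord0 h) x).
Proof.
move=> dh.
have ? : is_derive x (delta_mx ord0 ord0) h (partial ord0 h x) by apply: DeriveDef.
have ? : is_derive x (delta_mx ord0 ord0) (fun x => w (tail x)) 0.
  apply: is_derive_dir.
  rewrite (_ : (fun _ => _) = cst (w (tail x))); first exact: is_derive_cst.
  apply/funext => k; congr w; apply/rowP => j; rewrite !mxE /=.
  by rewrite mulr0 add0r.
have -> : wh h = (fun x => w (tail x)) * h by [].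
by apply: is_derive_eq; rewrite /wh /GRing.scale /= mulr0 addr0.
Qed.

Lemma continuous_wtint I h t : open I -> I t -> Ck_on (layer I) 0 h ->
  {for t, continuous (wtint h)}.
Proof.
move=> oI It [ch _]; rewrite (_ : wtint h = fun s => tint (fun y => wh h (point s y))).
  by apply: (continuous_tint oI It) => x Ix; apply: wh_cont; exact: ch.
by apply/funext => s; exact: wtintE.
Qed.

Lemma is_derive_wtint I h t : open I -> I t -> Ck_on (layer I) 1 h ->
  is_derive t 1 (wtint h) (wtint (partial ord0 h) t).
Proof.
move=> oI It C1.
have dE (x : 'rV[R]_n.+1) : I (x ord0 ord0) -> partial ord0 (wh h) x = wh (partial ord0 h) x.
  move=> Ix; have ? := wh_derive (Ck_on_derivable (i := ord0) C1 (Ix : layer I x)).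
  exact: derive_val.
have -> : wtint h = fun s => tint (fun y => wh h (point s y)).
  by apply/funext => s; exact: wtintE.
have -> : wtint (partial ord0 h) t = tint (fun y => partial ord0 (wh h) (point t y)).
  by rewrite wtintE; apply: eq_tint => y _; rewrite dE // point0.
apply: (is_derive_tint oI It) => x Ix.
- by apply: wh_cont; exact: (Ck_on_cont C1).
- by have ? := wh_derive (Ck_on_derivable (i := ord0) C1 (Ix : layer I x)); exact: ex_derive.
have C0 : Ck_on (layer I) 0 (wh (partial ord0 h)).
  by split=> // z Iz; apply: wh_cont; exact: (Ck_on_cont (Ck_on_partial ord0 C1)).
have H := eq_on_Ck (open_layer oI) (fun z Iz => esym (dE z Iz)) C0.
exact: (Ck_on_cont H).
Qed.

Lemma is_derive_wtint_iter I h t k : open I -> I t -> Ck_on (layer I) k.+1 h ->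
  is_derive t 1 (wtint (iter k (partial ord0) h)) (wtint (iter k.+1 (partial ord0) h) t).
Proof.
move=> oI It Ck; apply: (is_derive_wtint oI It); apply: Ck_on_iter.
by rewrite addn1.
Qed.

End weight.

Lemma C1per_slice I h t j : I t -> Ck_on (layer I) 1 h ->
  rperiodic (lift ord0 j) h -> C1per j (fun y => h (point t y)).
Proof.
move=> It C1 ph.
have Ip y : layer I (point t y) by rewrite /layer /= point0.
split.
- by apply: continuous_slice => y; exact: (Ck_on_cont C1).
- by move=> y; apply: derivable_slice; exact: (Ck_on_derivable C1).
- have -> : partial j (fun y => h (point t y)) = (fun y => partial (lift ord0 j) h (point t y)).
    by apply/funext => y; rewrite partial_slice.
  apply: continuous_slice => y; exact: (Ck_on_cont (Ck_on_partial _ C1)).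
- by move=> y; rewrite addrC pointDr addrC ph.
Qed.

End fourier_in_t.

(** * The Laplacian on a single frequency *)

Section modes.
Context {R : realType} (n : nat) (xi : 'rV[int]_n).
Implicit Types (h g : 'rV[R]_n.+1 -> R) (I : set R).
Notation fd := (@freq_dot R n xi).

(* [fc] and [fs] are the real and (up to sign) imaginary parts of the Fourier
   coefficient of frequency [xi] in [y]; [cc] and [ss] are the sequences of
   their [t]-derivatives. *)
Definition fc h : R -> R := wtint (fun y => cos (fd y)) h.
Definition fs h : R -> R := wtint (fun y => sin (fd y)) h.
Definition cc h (k : nat) : R -> R := fc (iter k (partial ord0) h).
Definition ss h (k : nat) : R -> R := fs (iter k (partial ord0) h).
Definition freq2 : R := \sum_(j < n) (xi ord0 j)%:~R ^+ 2.

Definition yper h := forall j : 'I_n, rperiodic (lift ord0 j) h.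

Lemma yper_partial i h : yper h -> yper (partial i h).
Proof. by move=> ph j; exact: rperiodic_partial. Qed.

Lemma yper_rlaplacian h : yper h -> yper (rlaplacian h).
Proof. by move=> ph j; exact: rperiodic_rlaplacian. Qed.

Lemma fc_partial I h t j : I t -> Ck_on (layer I) 1 h -> yper h ->
  fc (partial (lift ord0 j) h) t = (xi ord0 j)%:~R * fs h t.
Proof.
move=> It C1 ph; have := @fcos_partial R n xi j _ (C1per_slice It C1 (ph j)).
by rewrite /fcos => <-; apply: eq_tint => y _; rewrite partial_slice.
Qed.

Lemma fs_partial I h t j : I t -> Ck_on (layer I) 1 h -> yper h ->
  fs (partial (lift ord0 j) h) t = - ((xi ord0 j)%:~R * fc h t).
Proof.
move=> It C1 ph; have := @fsin_partial R n xi j _ (C1per_slice It C1 (ph j)).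
by rewrite /fsin => <-; apply: eq_tint => y _; rewrite partial_slice.
Qed.

Lemma slice_cont I h t : I t -> Ck_on (layer I) 0 h -> continuous (fun y => h (point t y)).
Proof.
move=> It C0; apply: continuous_slice => y.
by apply: (Ck_on_cont C0); rewrite /layer /= point0.
Qed.

Lemma wtint_rlaplacian (w : 'rV[R]_n -> R) I h t : continuous w -> open I -> I t ->
  Ck_on (layer I) 2 h ->
  wtint w (rlaplacian h) t = wtint w (partial ord0 (partial ord0 h)) t +
    \sum_(j < n) wtint w (partial (lift ord0 j) (partial (lift ord0 j) h)) t.
Proof.
move=> cw oI It C2.
have cp i : continuous (fun y => w y * partial i (partial i h) (point t y)).
  by apply: continuous_mul => //; apply: (slice_cont It); do 2!apply: Ck_on_partial.
rewrite /wtint -tint_sum; last by move=> j; exact: cp.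
rewrite -tintD; [|exact: cp|]; last by move=> y; apply: continuous_sumr => j; exact: cp.
by apply: eq_tint => y _; rewrite /rlaplacian big_ord_recl mulrDr mulr_sumr.
Qed.

Lemma fc_rlaplacian I h t : open I -> I t -> Ck_on (layer I) 2 h -> yper h ->
  fc (rlaplacian h) t = cc h 2 t - freq2 * cc h 0 t.
Proof.
move=> oI It C2 ph; rewrite /fc (wtint_rlaplacian _ oI It C2); last exact: continuous_cosfd.
congr (_ + _); rewrite /freq2 mulr_suml -sumrN; apply: eq_bigr => j _.
rewrite -/(fc _) (fc_partial _ It); [|exact: Ck_on_partial|exact: yper_partial].
rewrite (fs_partial _ It) //; last exact: Ck_on_pred.
by rewrite mulrN mulrA -expr2.
Qed.

Lemma fs_rlaplacian I h t : open I -> I t -> Ck_on (layer I) 2 h -> yper h ->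
  fs (rlaplacian h) t = ss h 2 t - freq2 * ss h 0 t.
Proof.
move=> oI It C2 ph; rewrite /fs (wtint_rlaplacian _ oI It C2); last exact: continuous_sinfd.
congr (_ + _); rewrite /freq2 mulr_suml -sumrN; apply: eq_bigr => j _.
rewrite -/(fs _) (fs_partial _ It); [|exact: Ck_on_partial|exact: yper_partial].
rewrite (fc_partial _ It) //; last exact: Ck_on_pred.
by rewrite mulrA -expr2.
Qed.

Section helmholtz.
Variables (w : 'rV[R]_n -> R) (I : set R).
Hypotheses (cw : continuous w) (oI : open I).
Hypothesis lapw : forall h t, I t -> Ck_on (layer I) 2 h -> yper h ->
  wtint w (rlaplacian h) t = wtint w (iter 2 (partial ord0) h) t - freq2 * wtint w h t.

Let W h k := wtint w (iter k (partial ord0) h).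

(** The identity of order k holds on the open set [I] and is differentiated in t. This avoids
    commuting t-derivatives with the Laplacian, hence any appeal to the symmetry of mixed partial
    derivatives. *)
Lemma wtint_rlaplacian_iter1 h k t : I t -> Ck_on (layer I) k.+2 h -> yper h ->
  W (rlaplacian h) k t = W h k.+2 t - freq2 * W h k t.
Proof.
move=> It; elim: k t It => [|k IH] t It Ck ph; first exact: lapw.
pose A l s := W (rlaplacian h) l s - (W h l.+2 s - freq2 * W h l s).
have C0 : Ck_on (layer I) k.+1 (rlaplacian h).
  by apply: Ck_on_rlaplacian => //; exact: open_layer.
have D : is_derive t 1 (A k) (A k.+1 t).
  have ? : is_derive t 1 (W (rlaplacian h) k) (W (rlaplacian h) k.+1 t).
    exact: (is_derive_wtint_iter cw oI It).
  have ? : is_derive t 1 (W h k.+2) (W h k.+3 t) by exact: (is_derive_wtint_iter cw oI It).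
  have ? : is_derive t 1 (W h k) (W h k.+1 t).
    by apply: (is_derive_wtint_iter cw oI It); apply: Ck_on_le Ck; lia.
  have -> : A k = W (rlaplacian h) k - (W h k.+2 - freq2 *: W h k) by [].
  exact: is_derive_eq.
have A0 s : I s -> A k s = 0.
  by move=> Is; rewrite /A IH ?subrr //; exact: Ck_on_pred.
have : A k.+1 t = 0.
  have <- : 'D_1 (A k) t = A k.+1 t by exact: derive_val.
  rewrite (@near_eq_derive _ _ _ _ (cst 0)) ?derive_cst //.
  by apply: filterS (open_nbhs_nbhs (conj oI It)).
by move/eqP; rewrite subr_eq0 => /eqP.
Qed.

Lemma wtint_rlaplacian_iter h j k t : I t -> Ck_on (layer I) (k + 2 * j) h -> yper h ->
  W (iter j rlaplacian h) k t = iter j (helm freq2) (W h) k t.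
Proof.
move=> It; elim: j k h => [//|j IH] k h Ck ph; rewrite iterSr.
have Cj : Ck_on (layer I) (k + 2 * j) (rlaplacian h).
  by apply: Ck_on_rlaplacian; [exact: open_layer|apply: Ck_on_le Ck; lia].
rewrite (IH _ _ Cj (yper_rlaplacian ph)) iterSr.
(* The identity between [W (rlaplacian h)] and [helm freq2 (W h)] is available only at t in [I] and
   for the orders that the smoothness of h allows, so it is carried through the iterates of [helm]
   by a second induction. *)
elim: j k Ck {IH Cj} => [|j IH] k Ck /=.
  by rewrite wtint_rlaplacian_iter1 //; apply: Ck_on_le Ck; lia.
by rewrite /helm !IH //; apply: Ck_on_le Ck; lia.
Qed.

End helmholtz.

Lemma cc_iter_rlaplacian I h j k t : open I -> I t -> Ck_on (layer I) (k + 2 * j) h -> yper h ->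
  cc (iter j rlaplacian h) k t = iter j (helm freq2) (cc h) k t.
Proof.
move=> oI It Ck ph; apply: (wtint_rlaplacian_iter (@continuous_cosfd R n xi) oI _ It Ck ph).
by move=> g s Is C2 pg; exact: (fc_rlaplacian oI Is C2 pg).
Qed.

Lemma ss_iter_rlaplacian I h j k t : open I -> I t -> Ck_on (layer I) (k + 2 * j) h -> yper h ->
  ss (iter j rlaplacian h) k t = iter j (helm freq2) (ss h) k t.
Proof.
move=> oI It Ck ph; apply: (wtint_rlaplacian_iter (@continuous_sinfd R n xi) oI _ It Ck ph).
by move=> g s Is C2 pg; exact: (fs_rlaplacian oI Is C2 pg).
Qed.

Lemma Ck_on_word (U : set 'rV[R]_n.+1) (s : seq 'I_n) l h : Ck_on U (size s + l) h ->
  Ck_on U l (foldr (fun j => partial (lift ord0 j)) h s).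
Proof.
elim: s l => [|i s IH] l //= Ck; apply: Ck_on_partial; apply: IH.
by rewrite addnS.
Qed.

(* Differentiation in [y] rotates the pair (cosine, sine) of Fourier
   coefficients; only the scaling of the rotation enters quadratic forms. *)
Lemma word_rotation (s : seq 'I_n) : exists A B : R,
  A ^+ 2 + B ^+ 2 = \prod_(j <- s) (xi ord0 j)%:~R ^+ 2 /\
  forall h, Ck_on setT (size s) h -> yper h -> forall t,
    let H := foldr (fun j => partial (lift ord0 j)) h s in
    fc H t = A * fc h t + B * fs h t /\ fs H t = A * fs h t - B * fc h t.
Proof.
elim: s => [|j s [A [B [AB IH]]]].
  by exists 1, 0; split; [rewrite big_nil; ring|move=> h _ _ t /=; split; ring].
exists (- ((xi ord0 j)%:~R * B)), ((xi ord0 j)%:~R * A); split.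
  by rewrite big_cons -AB; ring.
move=> h Ck ph t H; rewrite /H /=; set H' := foldr _ _ _.
have CH : Ck_on (layer setT) 1 H'.
  by apply: (@Ck_on_word setT s 1); rewrite addn1.
have pH : yper H' by rewrite /H'; elim: s {H H' AB IH Ck CH} => //= i s; exact: yper_partial.
have [c s_] := IH h (Ck_on_pred Ck) ph t.
rewrite (fc_partial (I := setT)) // (fs_partial (I := setT)) //.
by rewrite -/H' in c s_; rewrite c s_; split; ring.
Qed.

End modes.

(** * Fourier expansion of the energy density *)

Section multinomial.
Context {R : realType}.

Lemma binomial_fact (q i : nat) : (i <= q)%N ->
  ('C(q, i)%:R / q`!%:R = (i`!%:R * (q - i)`!%:R)^-1 :> R).
Proof.
move=> iq; have := bin_fact iq => /(congr1 (fun k => k%:R : R)).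
have f0 k : (k`!%:R : R) != 0 by rewrite pnatr_eq0 -lt0n fact_gt0.
rewrite !natrM => <-; have c0 : ('C(q, i)%:R : R) != 0 by rewrite pnatr_eq0 -lt0n bin_gt0.
have := f0 i; have := f0 (q - i)%N => h1 h2; field.
by rewrite c0 h1 h2.
Qed.

(** Each factor is the exponential series of x X cut at degree p, and the cut does not affect
    coefficients up to p; the product of exponentials is the exponential of the sum. *)
Lemma coef_prod_exp p (s : seq R) q : (q <= p)%N ->
  (\prod_(x <- s) \poly_(k < p.+1) (x ^+ k / k`!%:R))`_q =
  (\sum_(x <- s) x) ^+ q / q`!%:R.
Proof.
elim: s q => [|x s IH] q qp.
  rewrite !big_nil coef1 expr0n; case: eqP => [->|_]; first by rewrite fact0 divr1.
  by rewrite mul0r.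
rewrite !big_cons coefM addrC exprDn mulr_suml; apply: eq_bigr => i _.
have iq : (i <= q)%N by rewrite -ltnS.
rewrite coef_poly ltnS (leq_trans iq qp) IH; last exact: leq_trans (leq_subr _ _) qp.
by rewrite -[_ *+ 'C(q, i)]mulr_natr -[RHS]mulrA binomial_fact // invfM; ring.
Qed.

(** Generating functions: both sides are p! times the coefficient of X^p in the product of the
    series of e^(x_j X) with the sum of b_k X^k / k!. The distinguished index carries an arbitrary
    sequence b because products of t-derivatives are not powers. *)
Lemma multinomial_split n p (x : 'I_n -> R) (b : nat -> R) :
  \sum_(f : {ffun 'I_n.+1 -> 'I_p.+1} | (\sum_(i < n.+1) f i == p)%N)
     p`!%:R / (\prod_(i < n.+1) (f i)`!)%:R *
     (\prod_(j < n) x j ^+ f (lift ord0 j) * b (f ord0)) =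
  \sum_(k < p.+1) 'C(p, k)%:R * (\sum_(j < n) x j) ^+ (p - k) * b k.
Proof.
pose c (i : 'I_n.+1) (k : 'I_p.+1) : R :=
  (if unlift ord0 i is Some j then x j ^+ k else b k) / k`!%:R.
have /(congr1 (fun q : {poly R} => p`!%:R * q`_p)) :
    \prod_i \sum_k (c i k *: 'X^k) =
    \sum_(f : {ffun 'I_n.+1 -> 'I_p.+1}) \prod_i (c i (f i) *: 'X^(f i) : {poly R}).
  exact: (bigA_distr_bigA (fun i k => c i k *: 'X^k : {poly R})).
rewrite coef_sum mulr_sumr => E.
have -> : \sum_(f : {ffun 'I_n.+1 -> 'I_p.+1} | (\sum_(i < n.+1) f i == p)%N)
     p`!%:R / (\prod_(i < n.+1) (f i)`!)%:R *
     (\prod_(j < n) x j ^+ f (lift ord0 j) * b (f ord0)) =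
  \sum_(f : {ffun 'I_n.+1 -> 'I_p.+1}) p`!%:R *
     (\prod_(i < n.+1) (c i (f i) *: 'X^(f i) : {poly R}))`_p.
  (* Choices f of total degree other than p contribute monomials whose coefficient of degree p is
     zero. *)
  rewrite [RHS](bigID (fun f : {ffun 'I_n.+1 -> 'I_p.+1} => (\sum_(i < n.+1) f i == p)%N)) /=.
  rewrite [X in _ = _ + X]big1 ?addr0; last first.
    by move=> f /negbTE fp; rewrite scaler_prod -expr_sum coefZ coefXn eq_sym fp !mulr0.
  apply: eq_bigr => f fp; rewrite scaler_prod -expr_sum coefZ coefXn eq_sym fp mulr1.
  rewrite -mulrA; congr (_ * _); rewrite /c prodf_div -natr_prod mulrC; congr (_ / _).
  by rewrite big_ord_recl unlift_none mulrC; congr (_ * _); apply: eq_bigr => j _; rewrite liftK.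
rewrite -E big_ord_recl.
have -> : \sum_k c ord0 k *: 'X^k = \poly_(k < p.+1) (b k / k`!%:R).
  by rewrite poly_def; apply: eq_bigr => k _; rewrite /c unlift_none.
have -> : \prod_(i < n) \sum_k c (lift ord0 i) k *: 'X^k =
    \prod_(y <- [seq x i | i <- enum 'I_n]) \poly_(k < p.+1) (y ^+ k / k`!%:R).
  rewrite big_map big_enum /=; apply: eq_bigr => i _.
  by rewrite poly_def; apply: eq_bigr => k _; rewrite /c liftK.
rewrite coefM mulr_sumr; apply: eq_bigr => k _.
rewrite coef_poly ltn_ord coef_prod_exp ?leq_subr // big_map big_enum /=.
have kp : (k <= p)%N by rewrite -ltnS.
have p0 : (p`!%:R : R) != 0 by rewrite pnatr_eq0 -lt0n fact_gt0.
have -> : 'C(p, k)%:R = p`!%:R * ('C(p, k)%:R / p`!%:R) :> R by field.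
by rewrite binomial_fact // invfM; ring.
Qed.

Lemma bformE (lam : R) m (u g : nat -> R -> R) t :
  bform lam m u g t = \sum_(k < m.+1) 'C(m, k)%:R * lam ^+ (m - k) * (u k t * g k t).
Proof.
pose E k (b : nat -> R) := \sum_(i < k.+1) 'C(k, i)%:R * lam ^+ (k - i) * b i.
(* This is Pascal's rule, and it has the shape of the recursion defining [bform]. *)
suff ES k b : E k.+1 b = lam * E k b + E k (b \o S).
  rewrite -[RHS]/(E m (fun k => u k t * g k t)).
  elim: m u g => [|m IH] u g /=; first by rewrite /E big_ord1 bin0 subnn expr0 !mul1r.
  by rewrite ES !IH.
rewrite /E [LHS]big_ord_recl [X in lam * X]big_ord_recl /= !bin0 !subn0 !mul1r.
rewrite mulrDr mulrA -exprS -addrA; congr (_ + _); rewrite mulr_sumr.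
under eq_bigr do rewrite /bump /= add1n binS natrD subSS !mulrDl.
rewrite big_split /=; congr (_ + _).
rewrite big_ord_recr /= bin_small // !mul0r addr0; apply: eq_bigr => i _.
have ik := ltn_ord i; have -> : (k - i)%N = (k - i.+1).+1 by lia.
by rewrite /bump /= add1n exprS; ring.
Qed.

End multinomial.

(** * Mixed derivatives and the energy of a frequency *)

Section energy.
Context {R : realType}.

Definition rmderive d (alpha : 'I_d -> nat) (f : 'rV[R]_d -> R) : 'rV[R]_d -> R :=
  foldr (fun i g => iter (alpha i) (partial i) g) f (enum 'I_d).

(** The enumeration starts with [ord0], so the t-derivatives are outermost and the y-derivatives
    form a word acting directly on h. *)
Lemma rmderive_word n (alpha : 'I_n.+1 -> nat) (h : 'rV[R]_n.+1 -> R) :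
  rmderive alpha h = iter (alpha ord0) (partial ord0)
    (foldr (fun j => partial (lift ord0 j)) h
      (flatten [seq nseq (alpha (lift ord0 j)) j | j <- enum 'I_n])).
Proof.
rewrite /rmderive enum_ordSl /= foldr_map; congr (iter _ _ _).
elim: (enum 'I_n) => //= j s ->; rewrite foldr_cat.
by elim: (alpha _) => //= k ->.
Qed.

Section rotation.
Context (n : nat) (xi : 'rV[int]_n).

Lemma is_derive_fc (h : 'rV[R]_n.+1 -> R) k (t : R) : Ck_on setT k.+1 h ->
  is_derive t 1 (cc xi h k) (cc xi h k.+1 t).
Proof.
move=> Ck; have CL : Ck_on (layer setT) k.+1 h by [].
exact: (is_derive_wtint_iter (@continuous_cosfd R n xi) openT (I : setT t) CL).
Qed.

Lemma is_derive_fs (h : 'rV[R]_n.+1 -> R) k (t : R) : Ck_on setT k.+1 h ->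
  is_derive t 1 (ss xi h k) (ss xi h k.+1 t).
Proof.
move=> Ck; have CL : Ck_on (layer setT) k.+1 h by [].
exact: (is_derive_wtint_iter (@continuous_sinfd R n xi) openT (I : setT t) CL).
Qed.

Lemma rmderive_rotation (alpha : 'I_n.+1 -> nat) : exists A B : R,
  A ^+ 2 + B ^+ 2 = \prod_(j < n) ((xi ord0 j)%:~R ^+ 2) ^+ alpha (lift ord0 j) /\
  forall h, Ck_on setT (\sum_(i < n.+1) alpha i) h -> yper h -> forall t,
    fc xi (rmderive alpha h) t =
      A * cc xi h (alpha ord0) t + B * ss xi h (alpha ord0) t /\
    fs xi (rmderive alpha h) t =
      A * ss xi h (alpha ord0) t - B * cc xi h (alpha ord0) t.
Proof.
pose w := flatten [seq nseq (alpha (lift ord0 j)) j | j <- enum 'I_n].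
have [A [B [AB rot]]] := word_rotation (R := R) xi w.
exists A, B; split.
  rewrite AB /w big_flatten big_map big_enum /=; apply: eq_bigr => j _.
  by rewrite big_nseq iter_mulr_1.
have sw : size w = (\sum_(j < n) alpha (lift ord0 j))%N.
  rewrite /w size_flatten /shape -map_comp sumnE big_map big_enum /=.
  by apply: eq_bigr => j _; rewrite size_nseq.
move=> h; rewrite big_ord_recl -sw rmderive_word -/w => Ck ph.
set H := foldr _ h w.
(* The rotation has coefficients independent of t, so the identity for k = 0 can be differentiated
   in t up to order [alpha ord0]. *)
suff K k t : (k <= alpha ord0)%N ->
    cc xi H k t = A * cc xi h k t + B * ss xi h k t /\
    ss xi H k t = A * ss xi h k t - B * cc xi h k t.
  by move=> t; exact: K.
elim: k t => [|k IH] t kl.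
  by apply: rot => //; apply: Ck_on_le Ck; exact: leq_addl.
have CH : Ck_on setT k.+1 H by apply: Ck_on_word; apply: Ck_on_le Ck; rewrite addnC leq_add2r.
have Ch : Ck_on setT k.+1 h by apply: Ck_on_le Ck; rewrite (leq_trans kl) // leq_addr.
have kl' := ltnW kl.
have dc := is_derive_fc t Ch; have ds := is_derive_fs t Ch.
have ? := is_derive_fc t CH; have ? := is_derive_fs t CH.
split.
- have <- : 'D_1 (cc xi H k) t = cc xi H k.+1 t by exact: derive_val.
  have -> : cc xi H k = A *: cc xi h k + B *: ss xi h k.
    by apply/funext => s; rewrite (IH s kl').1.
  by have [_ ->] := is_deriveD (is_deriveZ A dc) (is_deriveZ B ds).
- have <- : 'D_1 (ss xi H k) t = ss xi H k.+1 t by exact: derive_val.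
  have -> : ss xi H k = A *: ss xi h k - B *: cc xi h k.
    by apply/funext => s; rewrite (IH s kl').2.
  by have [_ ->] := is_deriveB (is_deriveZ A ds) (is_deriveZ B dc).
Qed.

End rotation.

Definition mcoef n p (f : {ffun 'I_n -> 'I_p.+1}) : R :=
  p`!%:R / (\prod_(i < n) (f i)`!)%:R.

Lemma mcoef_ge0 n p (f : {ffun 'I_n -> 'I_p.+1}) : 0 <= mcoef f.
Proof. by rewrite divr_ge0. Qed.

Definition energy n p (h g : 'rV[R]_n -> R) (x : 'rV[R]_n) : R :=
  \sum_(f : {ffun 'I_n -> 'I_p.+1} | (\sum_(i < n) f i == p)%N)
    mcoef f * (rmderive (fun i => f i : nat) h x * rmderive (fun i => f i : nat) g x).

(** For each multi-index a rotation scaled by A^2 + B^2 acts on both pairs of coefficients and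
    leaves their inner product, up to that factor, in terms of t-derivatives alone; the factors are
    products of powers of xi_j^2, which [multinomial_split] sums. *)
Lemma energy_modes n p (xi : 'rV[int]_n) (h g : 'rV[R]_n.+1 -> R) t :
  Ck_on setT p h -> Ck_on setT p g -> yper h -> yper g ->
  \sum_(f : {ffun 'I_n.+1 -> 'I_p.+1} | (\sum_(i < n.+1) f i == p)%N)
    mcoef f * (fc xi (rmderive (fun i => f i : nat) h) t * fc xi (rmderive (fun i => f i : nat) g) t +
               fs xi (rmderive (fun i => f i : nat) h) t * fs xi (rmderive (fun i => f i : nat) g) t) =
  bform (freq2 xi) p (cc xi h) (cc xi g) t + bform (freq2 xi) p (ss xi h) (ss xi g) t.
Proof.
move=> Ch Cg ph pg; rewrite !bformE -big_split /=.
transitivity (\sum_(k < p.+1) 'C(p, k)%:R * (\sum_(j < n) (xi ord0 j)%:~R ^+ 2) ^+ (p - k) *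
    (cc xi h k t * cc xi g k t + ss xi h k t * ss xi g k t) : R); last first.
  by apply: eq_bigr => k _; rewrite /freq2; ring.
rewrite -(multinomial_split p (fun j => (xi ord0 j)%:~R ^+ 2 : R)
  (fun k => cc xi h k t * cc xi g k t + ss xi h k t * ss xi g k t)).
apply: eq_bigr => f /eqP fp; rewrite /mcoef; congr (_ * _).
have [A [B [AB rot]]] := rmderive_rotation xi (fun i => f i : nat).
rewrite -AB.
have [-> ->] := rot h (eq_ind_r (fun k => Ck_on setT k h) Ch fp) ph t.
have [-> ->] := rot g (eq_ind_r (fun k => Ck_on setT k g) Cg fp) pg t.
by ring.
Qed.

End energy.

(** * Approximate identity on the torus *)

Section interval_integral.
Context {R : realType}.
Notation leb := (@lebesgue_measure R).
Implicit Types f g : R -> R.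

Definition oint f : R := \int[leb]_(s in `[- pi, pi]) f s.

Lemma integrable_oint f : continuous f -> leb.-integrable `[- pi, pi] (EFin \o f).
Proof.
move=> cf; apply: continuous_compact_integrable; first exact: segment_compact.
exact: continuous_subspaceT.
Qed.

Lemma ointB f g : continuous f -> continuous g ->
  oint (fun s => f s - g s) = oint f - oint g.
Proof. by move=> cf cg; apply: RintegralB => //; exact: integrable_oint. Qed.

Lemma ointZ f c : continuous f -> oint (fun s => c * f s) = c * oint f.
Proof. by move=> cf; apply: RintegralZl => //; exact: integrable_oint. Qed.

Lemma eq_oint f g : f =1 g -> oint f = oint g.
Proof. by move=> fg; apply: eq_Rintegral => s _. Qed.

Lemma oint_derive f g : (forall s : R, is_derive s 1 f (g s)) -> continuous g ->
  oint g = f pi - f (- pi).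
Proof.
move=> fg cg; have cf s := is_derive_continuous (fg s).
rewrite /oint /Rintegral (@continuous_FTC2 _ _ f).
- by rewrite -EFinB.
- by have := pi_gt0 R; lra.
- exact: continuous_subspaceT.
- by split=> [s _||]; [exact: ex_derive|exact/cvg_at_right_filter/cf|
    exact/cvg_at_left_filter/cf].
- by move=> s _; rewrite derive1E; exact: derive_val.
Qed.

Lemma tint_prod n (f : 'I_n -> R -> R) : (forall i, continuous (f i)) ->
  tint (fun y : 'rV[R]_n => \prod_(i < n) f i (y ord0 i)) = \prod_(i < n) oint (f i).
Proof.
have cprod m (h : 'I_m -> R -> R) (r : seq 'I_m) : (forall i, continuous (h i)) ->
    continuous (fun y : 'rV[R]_m => \prod_(i <- r) h i (y ord0 i)).
  move=> ch; elim: r => [|i r IH].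
    by under eq_fun do rewrite big_nil; exact: cst_continuous.
  under eq_fun do rewrite big_cons; apply: continuous_mul => // y.
  by apply: continuous_comp; [exact: coord_continuous|exact: ch].
elim: n f => [|n IH] f cf; first by rewrite tint0 !big_ord0.
rewrite tintS; last exact: cprod.
rewrite big_ord_recl -(IH (fun i => f (lift ord0 i))) // mulrC -ointZ //.
apply: eq_Rintegral => s _; rewrite mulrC -tintZ; last exact: (cprod _ (fun i => f (lift ord0 i))).
apply: eq_tint => y _; rewrite big_ord_recl point0; congr (_ * _).
by apply: eq_bigr => i _; rewrite pointS.
Qed.

(** This is cos(s/2)^(2m), written so that it is visibly a trigonometric polynomial in s. *)
Definition kap (m : nat) (s : R) : R := ((1 + cos s) / 2) ^+ m.

Lemma kap_ge0 m s : 0 <= kap m s.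
Proof. by rewrite exprn_ge0 // divr_ge0 //; have := cos_geN1 s; lra. Qed.

Lemma continuous_kap m : continuous (kap m).
Proof.
elim: m => [|m IH].
  by rewrite (_ : kap 0 = cst 1) //; exact: cst_continuous.
rewrite (_ : kap m.+1 = (fun s => (1 + cos s) / 2 * kap m s)).
  apply: continuous_mul => //.
  apply: (@continuous_mul R R _ (cst 2^-1)); last by move=> ?; exact: cst_continuous.
  apply: (@continuous_add R R (cst 1)); last exact: continuous_cos.
  by move=> ?; exact: cst_continuous.
by apply/funext => s; rewrite /kap exprS.
Qed.

Let ckc m : continuous (fun s : R => kap m s * (1 - cos s)).
Proof.
apply: continuous_mul; first exact: continuous_kap.
by move=> s; apply: continuousB; [exact: cst_continuous|exact: continuous_cos].
Qed.

(** The function sin s * kap m s vanishes at -pi and pi, and by sin^2 = (1 - cos)(1 + cos) its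
    derivative is kap m s - (m + 1) kap m s (1 - cos s). *)
Lemma oint_kap_moment m : oint (fun s => kap m s * (1 - cos s)) = oint (kap m) / m.+1%:R.
Proof.
have ck := @continuous_kap m; have ckcm := @ckc m.
suff H : oint (fun s => kap m s - m.+1%:R * (kap m s * (1 - cos s))) = 0.
  move: H; rewrite ointB // ?ointZ //; last by apply: continuous_mul => //; exact: cst_continuous.
  by move/eqP; rewrite subr_eq0 => /eqP ->; rewrite mulrAC mulfV ?mul1r.
have cG : continuous (fun s => kap m s - m.+1%:R * (kap m s * (1 - cos s))).
  by move=> s; apply: continuousB; [exact: ck|apply: continuous_mul => //; exact: cst_continuous].
suff D (s : R) : is_derive s 1 (fun s => sin s * kap m s)
    (kap m s - m.+1%:R * (kap m s * (1 - cos s))).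
  by rewrite (oint_derive D cG) sinN sinpi oppr0 !mul0r subrr.
have ? : is_derive s 1 (fun s : R => (1 + cos s) / 2) (- sin s / 2).
  have ? := is_derive_cos s.
  have -> : (fun s : R => (1 + cos s) / 2) = 2^-1 *: (cst 1 + cos).
    by apply/funext => z; rewrite !fctE /GRing.scale /= mulrC.
  by apply: is_derive_eq; rewrite /GRing.scale /=; ring.
have ? := is_derive_sin s.
have -> : (fun s => sin s * kap m s) = sin * (fun s : R => (1 + cos s) / 2) ^+ m.
  by apply/funext => z; rewrite !fctE.
apply: is_derive_eq; rewrite /GRing.scale /= /kap.
have -> : ((fun s : R => (1 + cos s) / 2) ^+ m) s = ((1 + cos s) / 2) ^+ m.
  by rewrite exprfctE.
case: m {ck ckcm cG} => [|k] /=; first by rewrite !expr0; ring.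
apply/eqP; rewrite -subr_eq0; apply/eqP.
transitivity (- (k.+1%:R / 2 * ((1 + cos s) / 2) ^+ k * (sin s ^+ 2 - (1 - cos s ^+ 2)))).
  by rewrite !exprS -[k.+2%:R]natr1; field.
by rewrite -sin2cos2 subrr mulr0 oppr0.
Qed.

(** Since (1 + cos)/2 = 1 - (1 - cos)/2, the moment formula shows that passing from m to m + 1
    multiplies the integral by 1 - 1/(2(m + 1)). *)
Lemma oint_kap_gt0 m : 0 < oint (kap m).
Proof.
elim: m => [|m IH].
  have D (s : R) : is_derive s 1 id (kap 0 s) by rewrite /kap expr0; exact: is_derive_id.
  by rewrite (oint_derive D (@continuous_kap 0)) opprK; have := pi_gt0 R; lra.
have -> : oint (kap m.+1) = oint (kap m) - 2^-1 * (oint (kap m) / m.+1%:R).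
  have ck := @continuous_kap m; have ckcm := @ckc m.
  rewrite -oint_kap_moment -ointZ // -ointB //.
    by apply: eq_oint => s; rewrite /kap exprS; field.
  by apply: continuous_mul => // ?; exact: cst_continuous.
have : oint (kap m) / m.+1%:R <= oint (kap m).
  rewrite ler_pdivrMr ?ltr0n //; apply: ler_peMr; first exact: ltW.
  by rewrite ler1n.
move: IH; set x := oint _; set z := x / _; move: x z => x z x0 zx; lra.
Qed.

End interval_integral.

(** * Trigonometric polynomials as convolution kernels *)

Section trigpoly.
Context {R : realType} (n : nat).
Implicit Types (s : seq (R * 'rV[int]_n)) (y z : 'rV[R]_n) (f g : 'rV[R]_n -> R).

(** Cosines suffice because the kernel is a product of even functions of single coordinates.
    Frequencies may repeat in the list, which makes sums concatenations. *)
Definition tpoly s y : R := \sum_(a <- s) a.1 * cos (freq_dot a.2 y).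

Definition is_tpoly f := exists s, f =1 tpoly s.

Lemma freq_dotDl (a b : 'rV[int]_n) y :
  freq_dot (a + b) y = freq_dot a y + freq_dot b y.
Proof.
by rewrite /freq_dot -big_split /=; apply: eq_bigr => i _; rewrite mxE intrD mulrDl.
Qed.

Lemma freq_dotNl (a : 'rV[int]_n) y : freq_dot (- a) y = - freq_dot a y.
Proof.
by rewrite /freq_dot -sumrN; apply: eq_bigr => i _; rewrite mxE mulrNz mulNr.
Qed.

Lemma freq_dot0l y : freq_dot 0 y = 0.
Proof. by rewrite /freq_dot big1 // => i _; rewrite mxE mulr0z mul0r. Qed.

Lemma freq_dot_deltal j y : freq_dot (delta_mx ord0 j) y = y ord0 j.
Proof.
rewrite /freq_dot (bigD1 j) //= big1 ?addr0; last first.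
  by move=> i ij; rewrite mxE /= (negbTE ij) mulr0z mul0r.
by rewrite mxE !eqxx mul1r.
Qed.

Lemma is_tpoly_cst c : is_tpoly (fun=> c).
Proof.
by exists [:: (c, 0)] => y; rewrite /tpoly big_seq1 /= freq_dot0l cos0 mulr1.
Qed.

Lemma is_tpoly_cos j : is_tpoly (fun y => cos (y ord0 j)).
Proof.
by exists [:: (1, delta_mx ord0 j)] => y; rewrite /tpoly big_seq1 /= mul1r freq_dot_deltal.
Qed.

Lemma is_tpolyD f g : is_tpoly f -> is_tpoly g -> is_tpoly (fun y => f y + g y).
Proof.
by move=> [s fs] [r gr]; exists (s ++ r) => y; rewrite /tpoly big_cat fs gr.
Qed.

Lemma is_tpolyM f g : is_tpoly f -> is_tpoly g -> is_tpoly (fun y => f y * g y).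
Proof.
move=> [s fs] [r gr].
exists ([seq (a.1 * b.1 / 2, a.2 + b.2) | a <- s, b <- r] ++
        [seq (a.1 * b.1 / 2, a.2 - b.2) | a <- s, b <- r]) => y.
rewrite /tpoly big_cat /= !big_allpairs_dep fs gr /tpoly mulr_suml -big_split /=.
apply: eq_bigr => a _; rewrite mulr_sumr -big_split /=; apply: eq_bigr => b _.
by rewrite !freq_dotDl freq_dotNl cosD cosB; field.
Qed.

Lemma is_tpoly_prod (I : Type) (r : seq I) (F : I -> 'rV[R]_n -> R) :
  (forall i, is_tpoly (F i)) -> is_tpoly (fun y => \prod_(i <- r) F i y).
Proof.
move=> tF; elim: r => [|i r IH].
  by under eq_fun do rewrite big_nil; exact: is_tpoly_cst.
by under eq_fun do rewrite big_cons; exact: is_tpolyM.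
Qed.

Lemma continuous_tpoly s : continuous (tpoly s).
Proof.
move=> y; apply: continuous_sumr => a; apply: continuousM; first exact: cst_continuous.
exact: continuous_cosfd.
Qed.

(* The kernel [tpoly s (y - z)] is diagonal in the Fourier basis. *)
Definition pairing s f g : R :=
  \sum_(a <- s) a.1 * (fcos a.2 f * fcos a.2 g + fsin a.2 f * fsin a.2 g).

Lemma pairingC s f g : pairing s f g = pairing s g f.
Proof. by apply: eq_bigr => a _; congr (_ * _); ring. Qed.

Lemma tint_tpoly_shift s y g : continuous g ->
  tint (fun z => tpoly s (y - z) * g z) =
  \sum_(a <- s) a.1 * (cos (freq_dot a.2 y) * fcos a.2 g + sin (freq_dot a.2 y) * fsin a.2 g).
Proof.
move=> cg.
have cc a : continuous (fun z => cos (freq_dot a z) * g z).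
  by apply: continuous_mul => //; exact: continuous_cosfd.
have cs a : continuous (fun z => sin (freq_dot a z) * g z).
  by apply: continuous_mul => //; exact: continuous_sinfd.
have cZ c f : continuous f -> continuous (fun z : 'rV[R]_n => c * f z).
  by move=> cf; apply: continuous_mul => // ?; exact: cst_continuous.
have -> : (fun z => tpoly s (y - z) * g z) = (fun z => \sum_(a <- s)
    a.1 * (cos (freq_dot a.2 y) * (cos (freq_dot a.2 z) * g z) +
           sin (freq_dot a.2 y) * (sin (freq_dot a.2 z) * g z))).
  apply/funext => z; rewrite /tpoly mulr_suml; apply: eq_bigr => a _.
  by rewrite freq_dotD freq_dotN cosB; ring.
rewrite tint_sum => [|a]; last by apply/cZ/continuous_add; exact/cZ.
apply: eq_bigr => a _.
by rewrite tintZ ?tintD ?tintZ //; [exact/cZ|exact/cZ|apply: continuous_add; exact/cZ].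
Qed.

Lemma continuous_tpoly_conv s g : continuous g ->
  continuous (fun y => tint (fun z => tpoly s (y - z) * g z)).
Proof.
move=> cg; under eq_fun do rewrite tint_tpoly_shift //.
move=> y; apply: continuous_sumr => a; apply: continuousM; first exact: cst_continuous.
apply: continuousD; apply: continuousM; try exact: cst_continuous.
  exact: continuous_cosfd.
exact: continuous_sinfd.
Qed.

Lemma pairingE s f g : continuous f -> continuous g ->
  pairing s f g = tint (fun y => f y * tint (fun z => tpoly s (y - z) * g z)).
Proof.
move=> cf cg.
have cc a : continuous (fun z => cos (freq_dot a z) * f z).
  by apply: continuous_mul => //; exact: continuous_cosfd.
have cs a : continuous (fun z => sin (freq_dot a z) * f z).
  by apply: continuous_mul => //; exact: continuous_sinfd.
have cZ (c : R) (h : 'rV[R]_n -> R) : continuous h -> continuous (fun z : 'rV[R]_n => c * h z).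
  by move=> ch; apply: continuous_mul => // ?; exact: cst_continuous.
have -> : (fun y => f y * tint (fun z => tpoly s (y - z) * g z)) = (fun y => \sum_(a <- s)
    a.1 * (fcos a.2 g * (cos (freq_dot a.2 y) * f y) +
           fsin a.2 g * (sin (freq_dot a.2 y) * f y))).
  apply/funext => y; rewrite tint_tpoly_shift // mulr_sumr; apply: eq_bigr => a _; ring.
rewrite tint_sum => [|a]; last by apply/cZ/continuous_add; exact/cZ.
apply: eq_bigr => a _.
rewrite tintZ ?tintD ?tintZ //; [|exact/cZ|exact/cZ|apply: continuous_add; exact/cZ].
by rewrite -/(fcos _ _) -/(fsin _ _); ring.
Qed.

(** The derivative of the constant in a direction with xi_j nonzero is 0, while on the coefficients
    it acts as multiplication by xi_j up to sign and exchange. *)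
Lemma fourier_cst1 (xi : 'rV[int]_n) : xi != 0 ->
  fcos xi (fun=> 1 : R) = 0 /\ fsin xi (fun=> 1 : R) = 0.
Proof.
move=> xi0; have [j xij] : exists j, xi ord0 j != 0.
  apply/existsP; apply: contraNT xi0; rewrite negb_exists => /forallP H.
  by apply/eqP/rowP => i; rewrite mxE; apply/eqP; move: (H i); rewrite negbK.
have p0 : partial j (fun=> 1 : R) = (fun=> 0).
  by apply/funext => y; rewrite /partial derive_cst.
have C1 : @C1per R n j (fun=> 1).
  split => [y|y||y //]; [exact: cst_continuous|exact: derivable_cst|].
  by rewrite p0 => y; exact: cst_continuous.
have xr : ((xi ord0 j)%:~R : R) != 0 by rewrite intr_eq0.
have z0 (w : 'rV[R]_n -> R) : tint (fun y => w y * 0) = 0.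
  by under eq_fun do rewrite mulr0; rewrite /tint /Rintegral integral0.
have := fcos_partial xi C1; have := fsin_partial xi C1.
rewrite p0 {1}/fsin {2}/fcos !z0 => /eqP; rewrite eq_sym oppr_eq0 mulf_eq0 (negbTE xr).
by move=> /eqP ? /eqP; rewrite eq_sym mulf_eq0 (negbTE xr) => /eqP.
Qed.

(** Only frequency zero survives the integration, and its cosine is the constant 1; no change of
    variables on the torus is involved. *)
Lemma tint_is_tpoly_shift f y : is_tpoly f -> tint (fun z => f (y - z)) = tint f.
Proof.
move=> [s /funext ->].
have c1 : continuous (fun _ : 'rV[R]_n => 1 : R) by move=> ?; exact: cst_continuous.
suff E y' : tint (fun z => tpoly s (y' - z)) = \sum_(a <- s) a.1 * fcos a.2 (fun=> 1 : R).
  rewrite E -(E 0); apply: eq_tint => z _; apply: eq_bigr => a _.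
  by rewrite sub0r freq_dotN cosN.
under eq_fun do rewrite -[tpoly _ _]mulr1.
rewrite tint_tpoly_shift //; apply: eq_bigr => a _; congr (_ * _).
have [->|a0] := eqVneq a.2 0; last by have [-> ->] := fourier_cst1 a0; ring.
rewrite freq_dot0l cos0 sin0; ring.
Qed.

End trigpoly.

Section kernel.
Context {R : realType} (n : nat).

Definition kern m (y : 'rV[R]_n) : R := \prod_(j < n) (kap m (y ord0 j) / oint (kap m)).

Let is_tpoly_kap m j : is_tpoly (fun y : 'rV[R]_n => kap m (y ord0 j)).
Proof.
have H : is_tpoly (fun y : 'rV[R]_n => (1 + cos (y ord0 j)) / 2).
  apply: is_tpolyM; last exact: is_tpoly_cst.
  by apply: is_tpolyD; [exact: is_tpoly_cst|exact: is_tpoly_cos].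
elim: m => [|m IH]; first exact: is_tpoly_cst.
rewrite /kap; under eq_fun do rewrite exprS; exact: is_tpolyM.
Qed.

Lemma is_tpoly_kern m : is_tpoly (kern m).
Proof.
apply: is_tpoly_prod => j; apply: is_tpolyM; first exact: is_tpoly_kap.
exact: is_tpoly_cst.
Qed.

Lemma kern_ge0 m y : 0 <= kern m y.
Proof.
by apply: prodr_ge0 => j _; rewrite divr_ge0 ?kap_ge0 // ltW // oint_kap_gt0.
Qed.

Let ck m : continuous (fun s : R => kap m s / oint (kap m)).
Proof.
by apply: continuous_mul; [exact: continuous_kap|move=> ?; exact: cst_continuous].
Qed.

Let oint_norm m : oint (fun s : R => kap m s / oint (kap m)) = 1.
Proof.
under eq_fun do rewrite mulrC; rewrite ointZ; last exact: continuous_kap.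
by rewrite mulVf // gt_eqF // oint_kap_gt0.
Qed.

Lemma tint_kern m y : tint (fun z => kern m (y - z)) = 1.
Proof.
rewrite (tint_is_tpoly_shift _ (is_tpoly_kern m)) /kern.
rewrite (tint_prod (f := fun=> fun s => kap m s / oint (kap m))) => [|i]; last exact: ck.
by rewrite big1 // => j _; exact: oint_norm.
Qed.

Lemma tint_kern_moment m y j :
  tint (fun z => kern m (y - z) * (1 - cos ((y - z) ord0 j))) = m.+1%:R^-1.
Proof.
have T : is_tpoly (fun z : 'rV[R]_n => kern m z * (1 - cos (z ord0 j))).
  apply: is_tpolyM; first exact: is_tpoly_kern.
  apply: is_tpolyD; first exact: is_tpoly_cst.
  under eq_fun do rewrite -mulN1r.
  by apply: is_tpolyM; [exact: is_tpoly_cst|exact: is_tpoly_cos].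
rewrite (tint_is_tpoly_shift y T).
pose F i (s : R) := if i == j then (oint (kap m))^-1 * (kap m s * (1 - cos s))
  else kap m s / oint (kap m).
have -> : (fun z : 'rV[R]_n => kern m z * (1 - cos (z ord0 j))) =
    (fun z => \prod_(i < n) F i (z ord0 i)).
  apply/funext => z; rewrite /kern (bigD1 j) //= [RHS](bigD1 j) //= {1}/F eqxx.
  rewrite mulrAC; congr (_ * _); first by rewrite mulrC mulrA mulrAC -mulrA; ring.
  by apply: eq_bigr => i /negbTE ij; rewrite /F ij.
have ckc : continuous (fun s : R => kap m s * (1 - cos s)).
  apply: continuous_mul; first exact: continuous_kap.
  by move=> s; apply: continuousB; [exact: cst_continuous|exact: continuous_cos].
rewrite tint_prod => [|i]; last first.
  rewrite /F; case: eqP => _; last exact: ck.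
  by apply: continuous_mul => // ?; exact: cst_continuous.
rewrite (bigD1 j) //= big1 => [|i /negbTE ij]; last by rewrite /F ij; exact: oint_norm.
rewrite /F eqxx ointZ // oint_kap_moment mulr1 mulrA mulVf ?mul1r //.
by rewrite gt_eqF // oint_kap_gt0.
Qed.

End kernel.

(** * Concentration of the kernel and convergence of the means *)

Section approximate_identity.
Context {R : realType} (n : nat).
Implicit Types (f g : 'rV[R]_n -> R) (y z : 'rV[R]_n).

Lemma continuous_sub (T : topologicalType) (f g : T -> R) :
  continuous f -> continuous g -> continuous (fun x => f x - g x).
Proof. by move=> cf cg x; exact: (cvgB (cf x) (cg x)). Qed.

Lemma continuous_subl y : continuous (fun z : 'rV[R]_n => y - z).
Proof.
move=> z; apply: continuous_rV => i.
rewrite (_ : (fun _ => _) = (fun z : 'rV[R]_n => y ord0 i - z ord0 i)).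
  apply: (@continuousB _ _ _ (cst (y ord0 i)) (fun z : 'rV[R]_n => z ord0 i)).
    exact: cst_continuous.
  exact: coord_continuous.
by apply/funext => w; rewrite !mxE.
Qed.

Lemma cos_eq1_bounded (x : R) : `|x| <= 2 * pi -> cos x = 1 ->
  x = 0 \/ x = 2 * pi \/ x = - (2 * pi).
Proof.
move=> xle c1.
suff H (a : R) : 0 <= a -> a <= 2 * pi -> cos a = 1 -> a = 0 \/ a = 2 * pi.
  have [x0|x0] := leP 0 x.
    by move: xle; rewrite ger0_norm // => xle; case: (H x x0 xle c1) => ->; tauto.
  move: xle; rewrite ltr0_norm // => xle.
  case: (H (- x) _ xle); rewrite ?cosN // ?oppr_ge0 ?ltW // => e.
    by left; rewrite -(opprK x) e oppr0.
  by right; right; rewrite -e opprK.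
rewrite le0r => /predU1P[->|a0 ale ca]; first by left.
right; apply/eqP; rewrite eq_le ale leNgt; apply/negP => alt.
have s0 : 0 < sin (a / 2) by apply: sin_gt0_pi; apply/andP; split; lra.
have : cos a = 1 - 2 * sin (a / 2) ^+ 2.
  have {1}-> : a = a / 2 + a / 2 by field.
  by rewrite cosD -!expr2 cos2sin2; ring.
by rewrite ca => /eqP; rewrite -subr_eq0 opprB addrC subrK mulf_eq0 expf_eq0 /= (gt_eqF s0) pnatr_eq0.
Qed.

Lemma lattice_invariance g (r : seq 'I_n) (e : 'I_n -> R) y :
  (forall j, rperiodic j g) ->
  (forall j, e j = 0 \/ e j = 2 * pi \/ e j = - (2 * pi)) ->
  g (y + \sum_(j <- r) e j *: delta_mx ord0 j) = g y.
Proof.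
move=> pg he; elim: r y => [|j r IH] y; first by rewrite big_nil addr0.
rewrite big_cons addrA IH.
have [->|[->|->]] := he j; first by rewrite scale0r addr0.
- exact: pg.
- by rewrite -[LHS](pg j) -addrA -scalerDl addNr scale0r addr0.
Qed.

(** A substitute for the squared distance that respects the identification of opposite faces of the
    torus: it is zero exactly when y and z agree modulo 2 pi in every coordinate. Its average
    against the kernel is explicit by [tint_kern_moment]. *)
Definition cosdist y z : R := \sum_(j < n) (1 - cos ((y - z) ord0 j)).

Lemma cosdist_ge0 y z : 0 <= cosdist y z.
Proof. by apply: sumr_ge0 => j _; rewrite subr_ge0 cos_le1. Qed.

Lemma cosdist_eq0 g y z : (forall j, rperiodic j g) -> torus y -> torus z ->
  cosdist y z = 0 -> g y = g z.
Proof.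
move=> pg Ty Tz /eqP; rewrite psumr_eq0 => [/allP H|j _]; last by rewrite subr_ge0 cos_le1.
have -> : y = z + \sum_(j <- enum 'I_n) (y - z) ord0 j *: delta_mx ord0 j.
  rewrite big_enum /= -[LHS](subrK z) addrC; congr (_ + _).
  rewrite [LHS]matrix_sum_delta big_ord1; apply: eq_bigr => j _.
  by congr (_ *: delta_mx _ _).
apply: lattice_invariance => // j; apply: cos_eq1_bounded.
  rewrite !mxE; have /andP[h1 h2] := Ty j; have /andP[h3 h4] := Tz j.
  by rewrite ler_norml; apply/andP; split; lra.
have := H j; rewrite mem_index_enum => /(_ isT) /=.
by rewrite subr_eq0 eq_sym => /eqP.
Qed.

(** The pairs with |g z - g y| >= e form a compact set on which [cosdist] is positive, hence bounded
    below; C is twice a bound for |g| divided by this minimum. *)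
Lemma cosdist_modulus g (e : R) : continuous g -> (forall j, rperiodic j g) -> 0 < e ->
  exists2 C, 0 <= C & forall y z, torus y -> torus z -> `|g z - g y| <= e + C * cosdist y z.
Proof.
move=> cg pg e0.
have cT : compact (@torus R n) := @compact_box R n (fun=> - pi) (fun=> pi).
pose A := (@torus R n `*` @torus R n) `&` [set p | e <= `|g p.2 - g p.1|].
have cG : continuous (fun p : 'rV[R]_n * 'rV[R]_n => `|g p.2 - g p.1|).
  move=> p; apply: cvg_norm.
  apply: (@continuousB _ _ _ (fun p : 'rV[R]_n * 'rV[R]_n => g p.2) (fun p => g p.1)).
    by apply: (continuous_comp (f := snd) (g := g)); [exact: cvg_snd|exact: cg].
  by apply: (continuous_comp (f := fst) (g := g)); [exact: cvg_fst|exact: cg].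
have cA : compact A.
  apply: compact_closedI; first exact: compact_setX.
  apply: (@preimage_closed _ _ (fun p : 'rV[R]_n * 'rV[R]_n => `|g p.2 - g p.1|)
    [set x | e <= x]) => [p _|]; first exact: cG.
  exact: closed_ge.
have cD : continuous (fun p : 'rV[R]_n * 'rV[R]_n => cosdist p.1 p.2).
  pose D j (q : 'rV[R]_n * 'rV[R]_n) : R := 1 - cos (q.1 ord0 j - q.2 ord0 j).
  have cDj j : continuous (D j).
    move=> p; apply: cvgB; first exact: cvg_cst.
    apply: (cvg_comp _ cos); last exact: continuous_cos.
    apply: cvgB.
      by apply: (continuous_comp (f := fst) (g := fun y : 'rV[R]_n => y ord0 j));
        [exact: cvg_fst|exact: coord_continuous].
    by apply: (continuous_comp (f := snd) (g := fun y : 'rV[R]_n => y ord0 j));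
      [exact: cvg_snd|exact: coord_continuous].
  have -> : (fun p : 'rV[R]_n * 'rV[R]_n => cosdist p.1 p.2) = (fun p => \sum_(j < n) D j p).
    by apply/funext => p; apply: eq_bigr => j _; rewrite !mxE.
  by move=> p; apply: continuous_sumr => j; exact: cDj.
have [A0|A0] := pselect (A !=set0); last first.
  exists 0 => // y z Ty Tz; rewrite mul0r addr0 leNgt; apply/negP => h.
  by apply: A0; exists (y, z); split => //=; exact: ltW.
have [p Ap pmin] := compact_EVT_min A0 cA (continuous_subspaceT cD).
have d0 : 0 < cosdist p.1 p.2.
  rewrite lt_neqAle cosdist_ge0 andbT; apply/eqP => d0.
  move: Ap; rewrite inE => -[[T1 T2] /=]; rewrite (cosdist_eq0 pg T1 T2 (esym d0)).
  by rewrite subrr normr0 leNgt e0.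
have [M HM] := @compact_box_bounded R n (fun=> - pi) (fun=> pi) g (fun x _ => cg x).
have M0 : 0 <= 2 * `|M| by rewrite mulr_ge0.
exists (2 * `|M| / cosdist p.1 p.2) => [|y z Ty Tz]; first by rewrite divr_ge0 // ltW.
have [h|h] := leP e `|g z - g y|; last first.
  by rewrite (le_trans (ltW h)) // lerDl mulr_ge0 ?cosdist_ge0 // divr_ge0 // ltW.
have Ayz : (y, z) \in A by rewrite inE; split.
have := pmin _ Ayz => /= dle.
apply: (@le_trans _ _ (2 * `|M|)).
  rewrite (le_trans (ler_normB _ _)) // mulr2n mulrDl mul1r.
  by rewrite lerD // (le_trans _ (ler_norm M)) //; exact: HM.
apply: (@le_trans _ _ (2 * `|M| / cosdist p.1 p.2 * cosdist y z)); last by rewrite lerDr ltW.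
by rewrite -mulrA ler_peMr // mulrC ler_pdivlMr // mul1r.
Qed.

Section kernel_pairing.
Variables (m : nat) (s : seq (R * 'rV[int]_n)).
Hypothesis kernE : kern m =1 tpoly s.

Let conv_cont g y : continuous g -> continuous (fun z => tpoly s (y - z) * g z).
Proof.
move=> cg; apply: continuous_mul => // z.
apply: (continuous_comp (f := fun z : 'rV[R]_n => y - z)); last exact: continuous_tpoly.
exact: continuous_subl.
Qed.

Let k_ge0 y : 0 <= tpoly s y. Proof. by rewrite -kernE kern_ge0. Qed.

Let tint_k y : tint (fun z => tpoly s (y - z)) = 1.
Proof. by rewrite -(@tint_kern R n m y); apply: eq_tint => z _; rewrite kernE. Qed.

Let csqr f : continuous f -> continuous (fun y => f y ^+ 2).
Proof. by move=> cf; under eq_fun do rewrite expr2; exact: continuous_mul. Qed.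

Let c1 : continuous (fun _ : 'rV[R]_n => 1 : R).
Proof. by move=> ?; exact: cst_continuous. Qed.

Let cabs f : continuous f -> continuous (fun y => `|f y|).
Proof. by move=> cf y; exact: (cvg_norm (cf y)). Qed.

Let tint_k_cst c y : tint (fun z => tpoly s (y - z) * c) = c.
Proof.
under eq_fun do rewrite mulrC; rewrite tintZ ?tint_k ?mulr1 //.
by have := conv_cont (y := y) c1; under eq_fun do rewrite mulr1.
Qed.

(** The kernel is nonnegative with unit mass in each variable, so the inequality |f(y) g(z)| <=
    f(y)^2 + g(z)^2 can be integrated against it. The bound does not depend on m. *)
Lemma pairing_bound f g : continuous f -> continuous g ->
  `|pairing s f g| <= tint (fun y => f y ^+ 2) + tint (fun y => g y ^+ 2).
Proof.
move=> cf cg; rewrite pairingE //.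
have ck h : continuous h -> continuous (fun y => tint (fun z => tpoly s (y - z) * h z)).
  exact: continuous_tpoly_conv.
have cc : continuous (fun y => f y * tint (fun z => tpoly s (y - z) * g z)).
  by apply: continuous_mul => //; exact: ck.
apply: (le_trans (normr_tint cc)).
(* The symmetry of [pairing] exchanges the order of the two integrations here: the constant 1 paired
   with g^2 is g^2 paired with 1, where the kernel integrates to 1. *)
have -> : tint (fun y => g y ^+ 2) =
    tint (fun y => 1 * tint (fun z => tpoly s (y - z) * g z ^+ 2)).
  rewrite -pairingE //; last exact: csqr.
  rewrite pairingC pairingE //; last exact: csqr.
  by apply: eq_tint => y _; rewrite tint_k_cst mulr1.
have c2 : continuous (fun y => 1 * tint (fun z => tpoly s (y - z) * g z ^+ 2)).
  by apply: continuous_mul => //; apply: ck; exact: csqr.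
rewrite -tintD //; last exact: csqr.
apply: le_tint; [exact: cabs|by apply: continuous_add => //; exact: csqr|move=> y _].
rewrite mul1r -[f y ^+ 2](tint_k_cst _ y) -tintD; [|apply: conv_cont..]; first last.
- exact: csqr.
- by move=> ?; exact: cst_continuous.
rewrite -tintZ; last exact: conv_cont.
have c3 : continuous (fun z => f y * (tpoly s (y - z) * g z)).
  by apply: continuous_mul; [move=> ?; exact: cst_continuous|exact: conv_cont].
apply: (le_trans (normr_tint c3)); apply: le_tint; first exact: cabs.
  by apply: continuous_add; apply: conv_cont => //; [move=> ?; exact: cst_continuous|exact: csqr].
move=> z _; rewrite mulrCA normrM (ger0_norm (k_ge0 _)) -mulrDr ler_wpM2l //.
have := sqr_ge0 (f y + g z); have := sqr_ge0 (f y - g z).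
have := sqr_ge0 (f y); have := sqr_ge0 (g z).
by rewrite ler_norml => ? ? ? ?; apply/andP; split; nra.
Qed.

(** Because of unit mass, the error at y is the kernel average of g(z) - g(y). It is at most e plus
    C times the average of [cosdist], and each of the n coordinates contributes 1/(m + 1) to the
    latter. *)
Lemma pairing_error f g e C : continuous f -> continuous g -> 0 <= C ->
  (forall y z, torus y -> torus z -> `|g z - g y| <= e + C * cosdist y z) ->
  `|pairing s f g - tint (fun y => f y * g y)| <=
  (e + C * (n%:R / m.+1%:R)) * tint (fun y => `|f y|).
Proof.
move=> cf cg C0 gC; rewrite pairingE //.
have ck : continuous (fun y => tint (fun z => tpoly s (y - z) * g z)).
  exact: continuous_tpoly_conv.
have c2 : continuous (fun y => f y * tint (fun z => tpoly s (y - z) * g z)).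
  exact: continuous_mul.
have c3 : continuous (fun y => f y * g y) by exact: continuous_mul.
rewrite -tintB // -tintZ; last exact: cabs.
have c4 : continuous (fun y => f y * tint (fun z => tpoly s (y - z) * g z) - f y * g y).
  exact: continuous_sub.
apply: (le_trans (normr_tint c4)); apply: le_tint; first exact: cabs.
  by apply: continuous_mul; [move=> ?; exact: cst_continuous|exact: cabs].
move=> y Ty; rewrite -mulrBr normrM mulrC ler_wpM2r //.
rewrite -[X in _ - X](tint_k_cst (g y) y) -tintB; [|exact: conv_cont|]; last first.
  by apply: conv_cont => ?; exact: cst_continuous.
have c5 : continuous (fun z => tpoly s (y - z) * g z - tpoly s (y - z) * g y).
  apply: continuous_sub; apply: conv_cont => // ?; exact: cst_continuous.
apply: (le_trans (normr_tint c5)).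
have ccos j : continuous (fun z : 'rV[R]_n => 1 - cos ((y - z) ord0 j)).
  apply: continuous_sub => z; first exact: cst_continuous.
  apply: (continuous_comp (f := fun z : 'rV[R]_n => (y - z) ord0 j) (g := cos));
    last exact: continuous_cos.
  apply: (continuous_comp (f := fun z : 'rV[R]_n => y - z) (g := fun x : 'rV[R]_n => x ord0 j)).
    exact: continuous_subl.
  exact: coord_continuous.
have cdist : continuous (fun z => cosdist y z).
  by move=> z; apply: continuous_sumr => j; exact: ccos.
have <- : tint (fun z => tpoly s (y - z) * e + C * (tpoly s (y - z) * cosdist y z)) =
    e + C * (n%:R / m.+1%:R).
  rewrite tintD; first last.
  - by apply: continuous_mul; [move=> ?; exact: cst_continuous|exact: conv_cont].
  - by apply: conv_cont => ?; exact: cst_continuous.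
  rewrite tint_k_cst tintZ; last exact: conv_cont.
  congr (_ + _ * _).
  transitivity (tint (fun z => \sum_(j < n) kern m (y - z) * (1 - cos ((y - z) ord0 j)))).
    by apply: eq_tint => z _; rewrite -kernE /cosdist mulr_sumr.
  rewrite tint_sum => [|j].
    by under eq_bigr do rewrite tint_kern_moment; rewrite sumr_const card_ord mulr_natl.
  by under eq_fun do rewrite kernE; apply: conv_cont; exact: ccos.
apply: le_tint; first exact: cabs.
  apply: continuous_add; first by apply: conv_cont => ?; exact: cst_continuous.
  by apply: continuous_mul; [move=> ?; exact: cst_continuous|exact: conv_cont].
move=> z Tz; rewrite -mulrBr normrM (ger0_norm (k_ge0 _)) mulrCA -mulrDr ler_wpM2l //.
exact: gC.
Qed.

End kernel_pairing.

(** [s_ m] lists the coefficients and frequencies of the kernel of order m. The uniform bound serves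
    for dominated convergence in t, the limit for pointwise convergence in t. *)
Lemma pairing_cvg : exists s_ : nat -> seq (R * 'rV[int]_n),
  (forall m f g, continuous f -> continuous g ->
    `|pairing (s_ m) f g| <= tint (fun y => f y ^+ 2) + tint (fun y => g y ^+ 2)) /\
  (forall f g, continuous f -> continuous g -> (forall j, rperiodic j g) ->
    pairing (s_ m) f g @[m --> \oo] --> tint (fun y => f y * g y)).
Proof.
have [s_ kE] := choice (@is_tpoly_kern R n); exists s_; split.
  by move=> m f g; exact: (pairing_bound (kE m)).
move=> f g cf cg pg; apply/cvgrPdist_le => e e0.
set T := tint (fun y => `|f y|).
have T0 : 0 <= T by apply: tint_ge0.
(* Half of the tolerance goes to the modulus of g and half to the moment of the kernel; T + 1
   replaces T to keep the denominator positive. *)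
have e1 : 0 < e / (2 * (T + 1)) by rewrite divr_gt0 // mulr_gt0 // ltr_wpDl.
have [C C0 HC] := cosdist_modulus cg pg e1.
have : \forall m \near \oo, C * n%:R / (e / (2 * (T + 1))) <= m%:R :> R.
  exact: (@cvgr_idn R _ (nbhs_pinfty_ge (num_real _))).
apply: filterS => m hm; rewrite distrC.
apply: (le_trans (pairing_error (kE m) cf cg C0 HC)); rewrite -/T.
have h2 : C * (n%:R / m.+1%:R) <= e / (2 * (T + 1)).
  rewrite mulrA ler_pdivrMr ?ltr0n // -[leRHS]mulrC -ler_pdivrMr //.
  by rewrite (le_trans hm) // ler_nat.
apply: (@le_trans _ _ ((e / (2 * (T + 1)) + e / (2 * (T + 1))) * T)).
  by rewrite ler_wpM2r // lerD2l.
have -> : (e / (2 * (T + 1)) + e / (2 * (T + 1))) = e / (T + 1).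
  by field; rewrite gt_eqF // ltr_wpDl.
by rewrite mulrAC ler_pdivrMr ?ltr_wpDl // ler_wpM2l ?ltW // ltrDl.
Qed.

End approximate_identity.

(** * Orthogonality *)

Section mixed_derivatives.
Context {R : realType} (d : nat).
Implicit Types (f g : 'rV[R]_d -> R) (alpha : 'I_d -> nat).

Lemma Ck_on_rmderive U alpha l f : Ck_on U (\sum_(i < d) alpha i + l) f ->
  Ck_on U l (rmderive alpha f).
Proof.
rewrite /rmderive -(big_enum _ _ _ (fun i => alpha i)) /=.
elim: (enum _) l => [|i s IH] l; first by rewrite big_nil.
rewrite big_cons /= => Cf; apply: Ck_on_iter; apply: IH.
by apply: Ck_on_le Cf; lia.
Qed.

Lemma continuous_rmderive alpha f : Ck_on setT (\sum_(i < d) alpha i) f ->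
  continuous (rmderive alpha f).
Proof.
move=> Cf x; have C0 : Ck_on setT 0 (rmderive alpha f).
  by apply: Ck_on_rmderive; rewrite addn0.
exact: (Ck_on_cont C0).
Qed.

Lemma rperiodic_rmderive alpha j f : rperiodic j f -> rperiodic j (rmderive alpha f).
Proof.
by move=> pf; rewrite /rmderive; elim: (enum _) => //= i s; exact: rperiodic_iter.
Qed.

End mixed_derivatives.

(** * Square integrability on the slab *)

Section slab_integrals.
Context {R : realType} (n : nat).
Notation leb := (@lebesgue_measure R).
Implicit Types (h g : 'rV[R]_n.+1 -> R).

Lemma slab_fubini h : continuous h ->
  (lebesgue_rV n.+1).-integrable (@slab R n) (EFin \o h) ->
  leb.-integrable setT (EFin \o (fun t => tint (fun y => h (point t y)))) /\
  (\int[lebesgue_rV n.+1]_(x in @slab R n) (h x)%:E =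
   \int[leb]_t (tint (fun y => h (point t y)))%:E)%E.
Proof.
move=> ch; rewrite slab_cyl => ih.
have E t : (\int[lebesgue_rV n]_(y in @torus R n) (EFin \o h) (point t y))%E =
    (tint (fun y => h (point t y)))%:E.
  rewrite /tint /Rintegral fineK //; apply: integrable_fin_num; first exact: measurable_torus.
  apply: (@integrable_torus R n (fun y => h (point t y))); exact: tint_slice.
have [i1 i2] := fubini_rV measurableT (@measurable_torus R n) ih; split.
  by move: i1; under [X in _.-integrable _ X -> _]eq_fun do rewrite E.
by rewrite i2; apply: eq_integral => t _; exact: E.
Qed.

Lemma measurable_slab : measurable (@slab R n).
Proof. by rewrite slab_cyl; apply: measurable_cyl => //; exact: measurable_torus. Qed.

Definition sqint h := (lebesgue_rV n.+1).-integrable (@slab R n) (EFin \o (fun x => h x ^+ 2)).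

Lemma sqint_mul h g : continuous h -> continuous g -> sqint h -> sqint g ->
  (lebesgue_rV n.+1).-integrable (@slab R n) (EFin \o (fun x => h x * g x)).
Proof.
move=> ch cg ih ig; have mS := measurable_slab.
pose h2 x := h x ^+ 2; pose g2 x := g x ^+ 2.
apply: (@le_integrable _ _ _ _ _ mS _ ((EFin \o h2) \+ (EFin \o g2))%E).
- apply/measurable_EFinP; apply: (@measurable_funS _ _ _ _ setT) => //.
  by apply: continuous_measurable_rV; exact: continuous_mul.
- move=> x _; rewrite lee_fin (le_trans _ (ler_norm _)) //= /h2 /g2.
  have := sqr_ge0 (h x + g x); have := sqr_ge0 (h x - g x).
  have := sqr_ge0 (h x); have := sqr_ge0 (g x).
  by rewrite ler_norml => ? ? ? ?; apply/andP; split; nra.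
- exact: integrableD.
Qed.

(** Cauchy-Schwarz with a cruder constant. Let V be the integral of 1 and A that of f; integrating
    ((V + 1) f - A)^2 >= 0 bounds (V + 2) A^2 by (V + 1)^2 times the integral of f^2, without
    division. *)
Lemma sqr_tint_le (f : 'rV[R]_n -> R) : continuous f ->
  tint f ^+ 2 <= (tint (fun _ : 'rV[R]_n => 1) + 1) ^+ 2 * tint (fun y => f y ^+ 2).
Proof.
move=> cf; set V := tint (fun=> 1); set A := tint f; set F := tint (fun y => f y ^+ 2).
have c1 : continuous (fun _ : 'rV[R]_n => 1 : R) by move=> ?; exact: cst_continuous.
have c2 : continuous (fun y => f y ^+ 2).
  by under eq_fun do rewrite expr2; exact: continuous_mul.
have cZ (c : R) (h : 'rV[R]_n -> R) : continuous h -> continuous (fun z => c * h z).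
  by move=> ch; apply: continuous_mul => // ?; exact: cst_continuous.
have V0 : 0 <= V by apply: tint_ge0 => y _; exact: ler01.
have : 0 <= tint (fun y => ((V + 1) * f y - A) ^+ 2) by apply: tint_ge0 => y _; exact: sqr_ge0.
have -> : (fun y => ((V + 1) * f y - A) ^+ 2) = (fun y => (V + 1) ^+ 2 * f y ^+ 2 +
    (- (2 * (V + 1) * A) * f y + A ^+ 2 * 1)).
  by apply/funext => y; ring.
rewrite !tintD ?tintZ //; try exact: cZ; last by apply: continuous_add; exact: cZ.
rewrite -/V -/A -/F => H.
have : 0 <= A ^+ 2 * V by rewrite mulr_ge0 // sqr_ge0.
have : 0 <= A ^+ 2 by exact: sqr_ge0.
by move: H; rewrite expr2; nra.
Qed.

End slab_integrals.

Lemma cvg_sumr (R : realType) (I : Type) (r : seq I) (P : pred I)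
    (F : I -> nat -> R) (l : I -> R) :
  (forall i, P i -> F i k @[k --> \oo] --> l i) ->
  \sum_(i <- r | P i) F i k @[k --> \oo] --> \sum_(i <- r | P i) l i.
Proof.
move=> Fl; elim: r => [|i r IH].
  by under eq_fun do rewrite big_nil; rewrite big_nil; exact: cvg_cst.
under eq_fun do rewrite big_cons; rewrite big_cons; case: ifPn => // Pi.
by apply: cvgD; [exact: Fl|exact: IH].
Qed.

Section orthogonality.
Context {R : realType} (n : nat).
Notation leb := (@lebesgue_measure R).
Implicit Types (h g : 'rV[R]_n.+1 -> R) (xi : 'rV[int]_n).

(** The form in which [in_B] is inherited by real and imaginary parts; multi-indices range over the
    finite type used in [B_seminorm]. *)
Definition beppo p h := [/\ Ck_on setT p h, yper h &
  forall f : {ffun 'I_n.+1 -> 'I_p.+1}, (\sum_(i < n.+1) f i == p)%N ->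
    sqint (rmderive (fun i => f i : nat) h)].

Section one_function.
Context (p : nat) (h : 'rV[R]_n.+1 -> R).
Hypothesis Bh : beppo p h.

Lemma beppo_cont (f : {ffun 'I_n.+1 -> 'I_p.+1}) : (\sum_(i < n.+1) f i == p)%N ->
  continuous (rmderive (fun i => f i : nat) h).
Proof. by case: Bh => Ch _ _ /eqP fp; apply: continuous_rmderive; rewrite fp. Qed.

Definition slice_sq (f : {ffun 'I_n.+1 -> 'I_p.+1}) (t : R) : R :=
  tint (fun y => rmderive (fun i => f i : nat) h (point t y) ^+ 2).

Lemma integrable_slice_sq (f : {ffun 'I_n.+1 -> 'I_p.+1}) : (\sum_(i < n.+1) f i == p)%N ->
  leb.-integrable setT (EFin \o slice_sq f).
Proof.
move=> fp; have [_ _ /(_ f fp) i2] := Bh.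
have c2 : continuous (fun x => rmderive (fun i => f i : nat) h x ^+ 2).
  by under eq_fun do rewrite expr2; apply: continuous_mul; exact: beppo_cont.
by have [] := slab_fubini c2 i2.
Qed.

Lemma continuous_cc xi k : (k <= p)%N -> continuous (cc xi h k).
Proof.
case: Bh => Ch _ _ kp t; apply: (@continuous_wtint _ _ _ (@continuous_cosfd R n xi) setT).
- exact: openT.
- by [].
- by apply: Ck_on_iter; apply: Ck_on_le Ch; rewrite addn0.
Qed.

Lemma continuous_ss xi k : (k <= p)%N -> continuous (ss xi h k).
Proof.
case: Bh => Ch _ _ kp t; apply: (@continuous_wtint _ _ _ (@continuous_sinfd R n xi) setT).
- exact: openT.
- by [].
- by apply: Ck_on_iter; apply: Ck_on_le Ch; rewrite addn0.
Qed.

Lemma freq2_ge0 xi : 0 <= freq2 xi :> R.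
Proof. by apply: sumr_ge0 => j _; exact: sqr_ge0. Qed.

Let bound (w : 'rV[R]_n -> R) (f : {ffun 'I_n.+1 -> 'I_p.+1}) t : continuous w -> (forall y, `|w y| <= 1) ->
  (\sum_(i < n.+1) f i == p)%N ->
  wtint w (rmderive (fun i => f i : nat) h) t ^+ 2 <=
  (tint (fun _ : 'rV[R]_n => 1) + 1) ^+ 2 * slice_sq f t.
Proof.
move=> cw w1 fp; have cf := tint_slice (s := t) (beppo_cont fp).
have cwf : continuous (fun y => w y * rmderive (fun i => f i : nat) h (point t y)).
  exact: continuous_mul.
apply: (le_trans (sqr_tint_le cwf)); rewrite ler_wpM2l ?sqr_ge0 //.
have csq (u : 'rV[R]_n -> R) : continuous u -> continuous (fun y => u y ^+ 2).
  by move=> cu; under eq_fun do rewrite expr2; exact: continuous_mul.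
apply: le_tint; [exact: csq|exact: csq|move=> y _].
rewrite exprMn ler_piMl ?sqr_ge0 // -(real_normK (num_real _)) expr_le1 //.
Qed.

(** By [energy_modes] the sum of the two forms is a weighted sum of squares of Fourier coefficients
    of mixed derivatives. Each square is at most a constant times the slice integral of the squared
    derivative, which Fubini makes integrable in t. *)
Lemma integrable_modes xi :
  leb.-integrable setT (EFin \o bform (freq2 xi) p (cc xi h) (cc xi h)) /\
  leb.-integrable setT (EFin \o bform (freq2 xi) p (ss xi h) (ss xi h)).
Proof.
(* The last factor 2 accounts for the cosine and the sine coefficient together. *)
pose V : R := (tint (fun _ : 'rV[R]_n => 1) + 1) ^+ 2 * 2.
pose M t : R := \sum_(f : {ffun 'I_n.+1 -> 'I_p.+1} | (\sum_(i < n.+1) f i == p)%N)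
  mcoef f * V * slice_sq f t.
have iM : leb.-integrable setT (EFin \o M).
  have -> : EFin \o M = (fun t => \sum_(f : {ffun 'I_n.+1 -> 'I_p.+1} | (\sum_(i < n.+1) f i == p)%N)
      ((mcoef f * V)%:E * (slice_sq f t)%:E))%E.
    by apply/funext => t; rewrite /= /M -sumEFin.
  apply: integrable_sum => // f fp; apply: integrableZl => //.
  exact: integrable_slice_sq.
have [Ch ph _] := Bh.
have cb (u : nat -> R -> R) : (forall k, (k <= p)%N -> continuous (u k)) ->
    continuous (bform (freq2 xi) p u u).
  by move=> cu t; apply: continuous_bform => k kp; exact: cu.
have le t : bform (freq2 xi) p (cc xi h) (cc xi h) t + bform (freq2 xi) p (ss xi h) (ss xi h) t <= M t.
  rewrite -energy_modes // /M; apply: ler_sum => f fp; rewrite -mulrA ler_wpM2l ?mcoef_ge0 //.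
  rewrite -!expr2 /V mulrAC mulr_natr mulr2n; apply: lerD; apply: bound => //.
  - exact: continuous_cosfd.
  - by move=> y; exact: cos_max.
  - exact: continuous_sinfd.
  - by move=> y; exact: sin_max.
have c0 t := bform_ge0 p (cc xi h) t (freq2_ge0 xi).
have s0 t := bform_ge0 p (ss xi h) t (freq2_ge0 xi).
split; apply: (le_integrable _ _ _ iM) => //.
- apply/measurable_EFinP; apply: continuous_measurable_fun; apply: cb => k kp.
  exact: continuous_cc.
- move=> t _; rewrite lee_fin (ger0_norm (c0 t)) (le_trans _ (ler_norm _)) //.
  by apply: le_trans (le t); rewrite lerDl.
- apply/measurable_EFinP; apply: continuous_measurable_fun; apply: cb => k kp.
  exact: continuous_ss.
- move=> t _; rewrite lee_fin (ger0_norm (s0 t)) (le_trans _ (ler_norm _)) //.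
  by apply: le_trans (le t); rewrite lerDr.
Qed.

End one_function.

Section energy.
Context (p : nat) (h g : 'rV[R]_n.+1 -> R).
Hypothesis Bh : beppo p h.
Hypothesis Bg : beppo p g.
Notation idx := {ffun 'I_n.+1 -> 'I_p.+1}.
Notation deg f := (\sum_(i < n.+1) f i == p)%N.

Lemma continuous_energy : continuous (energy p h g).
Proof.
have cF (f : idx) : continuous (fun x => if deg f then
    mcoef f * (rmderive (fun i => f i : nat) h x * rmderive (fun i => f i : nat) g x) else 0).
  case: (boolP (deg f)) => fp; last by move=> ?; exact: cst_continuous.
  apply: continuous_mul; first by move=> ?; exact: cst_continuous.
  by apply: continuous_mul; [exact: (beppo_cont Bh fp)|exact: (beppo_cont Bg fp)].
have -> : energy p h g = (fun x => \sum_(f : idx) (if deg f then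
    mcoef f * (rmderive (fun i => f i : nat) h x * rmderive (fun i => f i : nat) g x) else 0)).
  by apply/funext => z; rewrite /energy big_mkcond.
by move=> x; apply: continuous_sumr => f; exact: cF.
Qed.

Lemma integrable_energy :
  (lebesgue_rV n.+1).-integrable (@slab R n) (EFin \o energy p h g).
Proof.
have -> : EFin \o energy p h g = (fun x => \sum_(f : idx | deg f)
    ((mcoef f)%:E * (rmderive (fun i => f i : nat) h x * rmderive (fun i => f i : nat) g x)%:E))%E.
  by apply/funext => x; rewrite /= /energy -sumEFin.
apply: integrable_sum => [|f fp]; first exact: measurable_slab.
apply: integrableZl; first exact: measurable_slab.
have [_ _ /(_ f fp) ih] := Bh; have [_ _ /(_ f fp) ig] := Bg.
by apply: sqint_mul ih ig; [exact: (beppo_cont Bh fp)|exact: (beppo_cont Bg fp)].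
Qed.

End energy.

Section two_functions.
Context (m : nat) (Z : seq R) (h g : 'rV[R]_n.+1 -> R).
Hypothesis m_gt0 : (0 < m)%N.
Hypothesis Ch : Ck_on setT (2 * m) h.
Hypothesis Ph : forall t, t \notin Z -> exists I : set R, [/\ open I, I t,
  Ck_on (layer I) (2 * m.+1) h & forall x, layer I x -> iter m.+1 rlaplacian h x = 0].
Hypothesis Bh : beppo m.+1 h.
Hypothesis Bg : beppo m.+1 g.
Hypothesis gZ : forall t y, t \in Z -> torus y -> g (point t y) = 0.

Lemma mode_orthogonality xi :
  (leb.-integrable setT (EFin \o bform (freq2 xi) m.+1 (cc xi h) (cc xi g)) /\
   (\int[leb]_t (bform (freq2 xi) m.+1 (cc xi h) (cc xi g) t)%:E = 0)%E) /\
  (leb.-integrable setT (EFin \o bform (freq2 xi) m.+1 (ss xi h) (ss xi g)) /\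
   (\int[leb]_t (bform (freq2 xi) m.+1 (ss xi h) (ss xi g) t)%:E = 0)%E).
Proof.
have [_ ph _] := Bh; have [Cg pg _] := Bg.
have [hc hs] := integrable_modes Bh xi; have [gc gs] := integrable_modes Bg xi.
pose mu : R := Num.sqrt (freq2 xi).
have mu2 : freq2 xi = mu ^+ 2 by rewrite sqr_sqrtr // freq2_ge0.
have mu0 : 0 <= mu by exact: sqrtr_ge0.
have z0 (w : 'rV[R]_n -> R) f t : (forall y, torus y -> f (point t y) = 0) -> wtint w f t = 0.
  move=> f0; rewrite /wtint (@eq_tint _ _ _ (fun=> 0)); last by move=> y Ty; rewrite f0 // mulr0.
  by rewrite /tint /Rintegral integral0.
rewrite mu2 in hc hs gc gs *.
have cW (w : 'rV[R]_n -> R) k t : continuous w -> (k <= 2 * m)%N ->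
    {for t, continuous (wtint w (iter k (partial ord0) h))}.
  move=> cw km; apply: (@continuous_wtint _ _ _ cw setT) => //; first exact: openT.
  by apply: Ck_on_iter; apply: Ck_on_le Ch; rewrite addn0.
split; apply: (ode_orthogonality (Z := Z)) => //.
- by move=> k t km; apply: cW => //; exact: continuous_cosfd.
- move=> k t km /Ph[I [oI It CI _]].
  apply: (is_derive_wtint_iter (@continuous_cosfd R n xi) oI It).
  exact: Ck_on_le CI.
- move=> t /Ph[I [oI It CI hI]]; rewrite -mu2 -(cc_iter_rlaplacian xi oI It) //.
  by apply: z0 => y _; apply: hI; rewrite /layer /= point0.
- by move=> k t km; apply: is_derive_fc; exact: Ck_on_le Cg.
- by move=> t; exact: (continuous_cc Bg).
- by move=> t tZ; apply: z0 => y Ty; exact: gZ.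
- by move=> k t km; apply: cW => //; exact: continuous_sinfd.
- move=> k t km /Ph[I [oI It CI _]].
  apply: (is_derive_wtint_iter (@continuous_sinfd R n xi) oI It).
  exact: Ck_on_le CI.
- move=> t /Ph[I [oI It CI hI]]; rewrite -mu2 -(ss_iter_rlaplacian xi oI It) //.
  by apply: z0 => y _; apply: hI; rewrite /layer /= point0.
- by move=> k t km; apply: is_derive_fs; exact: Ck_on_le Cg.
- by move=> t; exact: (continuous_ss Bg).
- by move=> t tZ; apply: z0 => y Ty; exact: gZ.
Qed.

Notation idx := {ffun 'I_n.+1 -> 'I_m.+2}.
Notation deg f := (\sum_(i < n.+1) f i == m.+1)%N.

Lemma energy_orthogonality :
  (\int[lebesgue_rV n.+1]_(x in @slab R n) (energy m.+1 h g x)%:E = 0)%E.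
Proof.
have [_ ph _] := Bh; have [Cg pg _] := Bg.
have Chm : Ck_on setT m.+1 h by apply: Ck_on_le Ch; lia.
pose Dh (f : idx) := rmderive (fun i => f i : nat) h.
pose Dg (f : idx) := rmderive (fun i => f i : nat) g.
have cDh (f : idx) : deg f -> continuous (Dh f) by move=> fp; exact: (beppo_cont Bh fp).
have cDg (f : idx) : deg f -> continuous (Dg f) by move=> fp; exact: (beppo_cont Bg fp).
pose hs t f y := Dh f (point t y); pose gs t f y := Dg f (point t y).
have chs t (f : idx) : deg f -> continuous (hs t f).
  by move=> fp; apply: tint_slice; exact: cDh.
have cgs t (f : idx) : deg f -> continuous (gs t f).
  by move=> fp; apply: tint_slice; exact: cDg.
have [iJ ->] := slab_fubini (continuous_energy Bh Bg) (integrable_energy Bh Bg).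
pose J t := tint (fun y => energy m.+1 h g (point t y)).
have JE t : J t = \sum_(f : idx | deg f) mcoef f * tint (fun y => hs t f y * gs t f y).
  rewrite /J /energy.
  (* [tint_sum] asks for continuity at every index, so terms of the wrong degree are replaced by
     0. *)
  transitivity (\sum_(f : idx | deg f) tint (fun y =>
      if deg f then mcoef f * (hs t f y * gs t f y) else 0)).
    rewrite -tint_sum => [|f].
      by apply: eq_tint => y _; apply: eq_bigr => f ->.
    case: (boolP (deg f)) => fp; last by move=> ?; exact: cst_continuous.
    apply: continuous_mul; first by move=> ?; exact: cst_continuous.
    by apply: continuous_mul; [exact: chs|exact: cgs].
  apply: eq_bigr => f fp; rewrite fp tintZ //.
  by apply: continuous_mul; [exact: chs|exact: cgs].
have [s_ [s_bound s_cvg]] := @pairing_cvg R n.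
pose Jm k t := \sum_(f : idx | deg f) mcoef f * pairing (s_ k) (hs t f) (gs t f).
pose Q xi t : R := bform (freq2 xi) m.+1 (cc xi h) (cc xi g) t +
                   bform (freq2 xi) m.+1 (ss xi h) (ss xi g) t.
(* Exchanging two finite sums groups the approximate density by frequency. It becomes a finite
   combination of single-frequency forms, each of zero integral. *)
have JmE k t : Jm k t = \sum_(a <- s_ k) a.1 * Q a.2 t.
  rewrite /Jm /pairing; under eq_bigr do rewrite mulr_sumr.
  rewrite exchange_big /=; apply: eq_bigr => a _.
  rewrite /Q -energy_modes // mulr_sumr; apply: eq_bigr => f _.
  by rewrite mulrCA.
have iQ xi : leb.-integrable setT (EFin \o Q xi) /\ (\int[leb]_t (Q xi t)%:E = 0)%E.
  have [[i1 e1] [i2 e2]] := mode_orthogonality xi.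
  have -> : EFin \o Q xi = ((EFin \o bform (freq2 xi) m.+1 (cc xi h) (cc xi g)) \+
      (EFin \o bform (freq2 xi) m.+1 (ss xi h) (ss xi g)))%E by apply/funext.
  split; first exact: integrableD.
  under eq_integral do rewrite /Q EFinD.
  by rewrite integralD // e1 e2 adde0.
have iJm k : leb.-integrable setT (EFin \o Jm k) /\ (\int[leb]_t (Jm k t)%:E = 0)%E.
  have -> : EFin \o Jm k = (fun t => \sum_(a <- s_ k) (a.1%:E * (Q a.2 t)%:E))%E.
    by apply/funext => t; rewrite /= JmE -sumEFin.
  split.
    apply: integrable_sum => // a _; apply: integrableZl => //; exact: (iQ _).1.
  transitivity (\int[leb]_t (\sum_(a <- s_ k) (a.1%:E * (Q a.2 t)%:E)))%E.
    by apply: eq_integral => t _; rewrite JmE -sumEFin.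
  rewrite integral_sum //=; last by move=> a; apply: integrableZl => //; exact: (iQ _).1.
  by apply: big1 => a _; rewrite integralZl ?(iQ _).2 ?mule0 //; exact: (iQ _).1.
(* An integrable majorant of all the approximate densities, given by the bound of [pairing_cvg] on
   each slice. *)
pose M t := \sum_(f : idx | deg f) mcoef f * (slice_sq h f t + slice_sq g f t).
have iM : leb.-integrable setT (EFin \o M).
  have -> : EFin \o M = (fun t => \sum_(f : idx | deg f)
      ((mcoef f)%:E * ((slice_sq h f t)%:E + (slice_sq g f t)%:E)))%E.
    by apply/funext => t; rewrite /= /M -sumEFin.
  apply: integrable_sum => // f fp; apply: integrableZl => //; apply: integrableD => //.
    exact: (integrable_slice_sq Bh).
  exact: (integrable_slice_sq Bg).
have JmM k t : `|Jm k t| <= M t.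
  apply: (le_trans (ler_norm_sum _ _ _)); apply: ler_sum => f fp.
  rewrite normrM (ger0_norm (mcoef_ge0 f)) ler_wpM2l ?mcoef_ge0 //.
  by apply: s_bound; [exact: chs|exact: cgs].
have JmJ t : Jm k t @[k --> \oo] --> J t.
  rewrite JE; apply: (cvg_sumr (F := fun f k => mcoef f * pairing (s_ k) (hs t f) (gs t f))).
  move=> f fp; apply: cvgM; first exact: cvg_cst.
  apply: s_cvg; [exact: chs|exact: cgs|move=> j y].
  by rewrite /gs /Dg addrC pointDr addrC (rperiodic_rmderive _ (pg j)).
have mR (u : R -> R) : leb.-integrable setT (EFin \o u) -> measurable_fun setT (EFin \o u).
  exact: measurable_int.
have [|||||_ _ cvgJ] := @dominated_convergence _ _ R leb setT measurableT
  (fun k => EFin \o Jm k) (EFin \o J) (EFin \o M).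
- by move=> k; exact: mR (iJm k).1.
- exact: mR iJ.
- by apply: aeW => t _; apply: cvg_EFin; [near=> k|exact: JmJ].
- exact: iM.
- by apply: aeW => t k _; rewrite /= lee_fin.
apply: (cvg_unique _ cvgJ); first exact: ereal_hausdorff.
rewrite (_ : (fun _ => _) = cst 0%E); first exact: cvg_cst.
by apply/funext => k; exact: (iJm k).2.
Unshelve. all: by end_near. Qed.

End two_functions.

End orthogonality.

(** * Vanishing of the energy *)

Section positivity.
Context {R : realType}.
Notation leb := (@lebesgue_measure R).

Lemma integral_ge0_eq0 (f : R -> R) (a b : R) : a < b -> continuous f ->
  (forall s, a <= s <= b -> 0 <= f s) ->
  \int[leb]_(s in `[a, b]) f s = 0 -> forall s, a <= s <= b -> f s = 0.
Proof.
move=> ab cf f0 If c /andP[ac cb]; apply/eqP; rewrite eq_le f0 ?ac ?cb // andbT leNgt.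
apply/negP => fc.
have /cvgrPdist_lt /(_ (f c / 2) (divr_gt0 fc (ltr0Sn _ 1))) := cf c.
move=> /nbhs_ballP[d /= d0 dP].
(* The neighbourhood of c is clipped to [a, b], since c may be an endpoint; it still has positive
   length. *)
pose u := Num.max a (c - d / 2); pose v := Num.min b (c + d / 2).
have d2 : 0 < d / 2 by rewrite divr_gt0.
have uv : u < v by rewrite /u /v gt_max !lt_min ab /=; apply/and3P; split; lra.
have sub s : u <= s <= v -> a <= s <= b /\ f c / 2 <= f s.
  rewrite /u /v ge_max le_min => /andP[/andP[h1 h2] /andP[h3 h4]]; split; first by rewrite h1.
  have : ball c d s by rewrite /ball /= ltr_norml; apply/andP; split; lra.
  by move=> /dP /=; rewrite ltr_norml => /andP[h5 h6]; lra.
have ci (x y : R) : leb.-integrable `[x, y] (EFin \o f).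
  apply: continuous_compact_integrable; first exact: segment_compact.
  exact: continuous_subspaceT.
have I1 : \int[leb]_(s in `[u, v]) f s <= \int[leb]_(s in `[a, b]) f s.
  apply: fine_le; [exact: integrable_fin_num|exact: integrable_fin_num|].
  apply: ge0_subset_integral => //.
  - by apply/measurable_int; exact: ci.
  - by move=> s /=; rewrite !in_itv /= => /sub[].
have I2 : \int[leb]_(s in `[u, v]) (f c / 2) <= \int[leb]_(s in `[u, v]) f s.
  apply: le_Rintegral => //.
    apply: continuous_compact_integrable; first exact: segment_compact.
    by apply: continuous_subspaceT => ?; exact: cst_continuous.
  by move=> s /=; rewrite in_itv /= => /sub[].
have : 0 < \int[leb]_(s in `[u, v]) (f c / 2).
  rewrite Rintegral_cst // mulr_gt0 ?divr_gt0 //=.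
  by rewrite lebesgue_measure_itv /= lte_fin uv -EFinB /= subr_gt0.
by rewrite ltNge (le_trans I2) // -If.
Qed.

Lemma tint_ge0_eq0 n (f : 'rV[R]_n -> R) : continuous f ->
  (forall y, torus y -> 0 <= f y) -> tint f = 0 -> forall y, torus y -> f y = 0.
Proof.
elim: n f => [|n IH] f cf f0.
  by rewrite tint0 => f00 y _; rewrite -f00; congr f; apply/rowP => -[].
rewrite tintS // => If x; rewrite torusS => -[/= x0 xT].
move: x0; rewrite in_itv /= => x0.
have cH : continuous (fun s => tint (fun y => f (point s y))).
  by move=> s; apply: (@continuous_tint _ _ setT) => // [|z _]; [exact: openT|exact: cf].
have fp s y : - pi <= s <= pi -> torus y -> 0 <= f (point s y).
  move=> sp Ty; apply: f0 => i; case: (unliftP ord0 i) => [j|] ->; rewrite ?pointS ?point0 //.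
have pp : - pi < pi :> R by have := pi_gt0 R; lra.
have H0 := integral_ge0_eq0 pp cH (fun s sp => tint_ge0 (fun y => fp s y sp)) If x0.
rewrite (rV_point x).
apply: (IH (fun y => f (point (x ord0 ord0) y))) => //; first exact: tint_slice.
by move=> y; exact: fp.
Qed.

Lemma slab_ge0_eq0 n (h : 'rV[R]_n.+1 -> R) : continuous h -> (forall x, 0 <= h x) ->
  (lebesgue_rV n.+1).-integrable (@slab R n) (EFin \o h) ->
  (\int[lebesgue_rV n.+1]_(x in @slab R n) (h x)%:E = 0)%E ->
  forall t y, torus y -> h (point t y) = 0.
Proof.
move=> ch h0 ih Ih t y Ty; have [iH IHE] := slab_fubini ch ih; rewrite Ih in IHE.
pose H s := tint (fun y => h (point s y)).
have cH : continuous H.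
  by move=> s; apply: (@continuous_tint _ _ setT) => // [|z _]; [exact: openT|exact: ch].
have H0 s : 0 <= H s by apply: tint_ge0.
have IH0 : \int[leb]_(s in `[t - 1, t + 1]) H s = 0.
  apply/eqP; rewrite eq_le; apply/andP; split; last by apply: Rintegral_ge0.
  rewrite -[leRHS]/(fine 0%E) IHE; apply: fine_le.
  - apply: integrable_fin_num => //; apply: integrableS iH => //.
  - by rewrite -IHE.
  - apply: ge0_subset_integral => //; last by move=> s _; rewrite lee_fin.
    exact: measurable_int iH.
have tt : t - 1 < t + 1 by lra.
have Ht := integral_ge0_eq0 tt cH (fun s _ => H0 s) IH0.
have {}Ht : H t = 0 by apply: Ht; apply/andP; split; lra.
by apply: (tint_ge0_eq0 (f := fun y => h (point t y))) => //; exact: tint_slice.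
Qed.

End positivity.

Section uniqueness.
Context {R : realType} (n : nat).
Implicit Types g : 'rV[R]_n.+1 -> R.

Lemma yper_slab_eq0 g : yper g -> (forall t y, torus y -> g (point t y) = 0) ->
  forall x, g x = 0.
Proof.
move=> pg g0 x.
have shift (k : int) z j : g (z + (k%:~R * (2 * pi)) *: delta_mx ord0 (lift ord0 j)) = g z.
  have P (m : nat) w : g (w + (m%:R * (2 * pi)) *: delta_mx ord0 (lift ord0 j)) = g w.
    elim: m w => [|m IH] w; first by rewrite mul0r scale0r addr0.
    by rewrite -natr1 mulrDl mul1r scalerDl addrA pg IH.
  case: k => m; first exact: P.
  by rewrite NegzE mulrNz mulNr scaleNr -[LHS](P m.+1) -addrA addNr addr0.
(* Adding 2 pi times this integer moves the coordinate into [-pi, pi). *)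
pose k (j : 'I_n) : int := - Num.floor ((x ord0 (lift ord0 j) + pi) / (2 * pi)).
have inv (r : seq 'I_n) z :
    g (z + \sum_(j <- r) ((k j)%:~R * (2 * pi)) *: delta_mx ord0 (lift ord0 j)) = g z.
  elim: r z => [|j r IH] z; first by rewrite big_nil addr0.
  by rewrite big_cons addrA IH shift.
rewrite -(inv (index_enum _) x); set z := x + _.
rewrite (rV_point z); apply: g0 => j; rewrite mxE.
have -> : z ord0 (lift ord0 j) = x ord0 (lift ord0 j) + (k j)%:~R * (2 * pi).
  rewrite mxE summxE (bigD1 j) //= big1 ?addr0 => [|i ij].
    by rewrite !mxE !eqxx mulr1.
  by rewrite !mxE /= (inj_eq lift_inj) eq_sym (negbTE ij) mulr0.
set a := x ord0 (lift ord0 j); rewrite /k -/a.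
have p2 : 0 < 2 * pi :> R by rewrite mulr_gt0 // pi_gt0.
have := @real_floor_itv R ((a + pi) / (2 * pi)) (num_real _).
rewrite ler_pdivlMr // ltr_pdivrMr // intrD => /andP[h1 h2].
by rewrite mulrNz mulNr; apply/andP; split; lra.
Qed.

(* For fixed [y] such a function is a polynomial in [t] of degree less than
   [p], with at least [p] roots. *)
Lemma dt_poly_eq0 p g (r : seq R) : Ck_on setT p g -> uniq r -> (p <= size r)%N ->
  (forall t y, torus y -> iter p (partial ord0) g (point t y) = 0) ->
  (forall t y, t \in r -> torus y -> g (point t y) = 0) ->
  forall t y, torus y -> g (point t y) = 0.
Proof.
move=> Cg ur pr dg0 gr t y Ty.
(* [chain_poly] works on a ray, so its starting point is placed to the left of t and of all the
   zeros in r. *)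
pose a := \big[Num.min/t]_(s <- r) s - 1.
have ar s : s \in r -> a < s.
  move=> sr; rewrite /a ltrBlDr (le_lt_trans (_ : _ <= s)) ?ltrDl //.
  elim: (r) sr => [//|z q IH]; rewrite inE big_cons ge_min => /predU1P[->|/IH->].
    by rewrite lexx.
  by rewrite orbT.
have at_ : a < t.
  rewrite /a ltrBlDr (le_lt_trans (_ : _ <= t)) ?ltrDl //.
  by elim: (r) => [|s q IH]; rewrite ?big_nil ?big_cons // ge_min IH orbT.
have [k s kp _|s _|q sq qE] := @chain_poly R p (fun k s => iter k (partial ord0) g (point s y)) a.
- apply: is_derive_slice.
  have C1 : Ck_on setT 1 (iter k (partial ord0) g).
    by apply: Ck_on_iter; apply: Ck_on_le Cg; rewrite addn1.
  exact: (Ck_on_derivable C1).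
- exact: dg0.
have q0 : q = 0.
  apply: (@roots_geq_poly_eq0 _ q r) => //; last exact: leq_trans pr.
  by apply/allP => s sr; apply/rootP; rewrite -qE ?ar //=; exact: gr.
by have := qE t at_; rewrite q0 horner0.
Qed.

End uniqueness.

(** * Complex-valued functions *)

Section real_parts.
Context {R : realType} (d : nat).
Implicit Types (F : 'rV[R]_d -> R[i]) (f g : 'rV[R]_d -> R).

Definition re F : 'rV[R]_d -> R := fun x => complex.Re (F x).
Definition im F : 'rV[R]_d -> R := fun x => complex.Im (F x).

Lemma re_mderive alpha F : re (mderive alpha F) = rmderive alpha (re F).
Proof.
rewrite /mderive /rmderive; elim: (enum 'I_d) => //= i s IH.
by elim: (alpha i) => //= k <-.
Qed.

Lemma im_mderive alpha F : im (mderive alpha F) = rmderive alpha (im F).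
Proof.
rewrite /mderive /rmderive; elim: (enum 'I_d) => //= i s IH.
by elim: (alpha i) => //= k <-.
Qed.

Lemma re_sum I (r : seq I) (c : I -> R[i]) :
  complex.Re (\sum_(i <- r) c i) = \sum_(i <- r) complex.Re (c i).
Proof. by elim: r => [|i r IH]; rewrite ?big_nil // !big_cons -IH; case: (c i); case: (\sum_(_ <- _) _). Qed.

Lemma im_sum I (r : seq I) (c : I -> R[i]) :
  complex.Im (\sum_(i <- r) c i) = \sum_(i <- r) complex.Im (c i).
Proof. by elim: r => [|i r IH]; rewrite ?big_nil // !big_cons -IH; case: (c i); case: (\sum_(_ <- _) _). Qed.

Lemma re_laplacian k F : re (iter k (@laplacian R d) F) = iter k rlaplacian (re F).
Proof.
elim: k => //= k <-; apply/funext => x; rewrite /re /laplacian re_sum.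
exact: eq_bigr.
Qed.

Lemma im_laplacian k F : im (iter k (@laplacian R d) F) = iter k rlaplacian (im F).
Proof.
elim: k => //= k <-; apply/funext => x; rewrite /im /laplacian im_sum.
exact: eq_bigr.
Qed.

Lemma normc_sqr (z : R[i]) :
  ComplexField.Normc.normc z ^+ 2 = complex.Re z ^+ 2 + complex.Im z ^+ 2.
Proof. by case: z => a b; rewrite /= sqr_sqrtr // addr_ge0 // sqr_ge0. Qed.

Lemma rmderiveB alpha f g : Ck_on setT (\sum_(i < d) alpha i) f ->
  Ck_on setT (\sum_(i < d) alpha i) g ->
  rmderive alpha (fun x => f x - g x) = (fun x => rmderive alpha f x - rmderive alpha g x).
Proof.
rewrite /rmderive -(big_enum _ _ _ (fun i => alpha i)) /= => Cf Cg.
(* The induction also keeps l further orders of smoothness, needed to split each derivative of a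
   difference that is still to be applied. *)
suff H l : Ck_on setT (\sum_(i <- enum 'I_d) alpha i + l) f ->
    Ck_on setT (\sum_(i <- enum 'I_d) alpha i + l) g ->
  let D := foldr (fun i h => iter (alpha i) (partial i) h)^~ (enum 'I_d) in
  [/\ D (fun x => f x - g x) = (fun x => D f x - D g x), Ck_on setT l (D f) & Ck_on setT l (D g)].
  by have [] := H 0; rewrite ?addn0.
elim: (enum 'I_d) l {Cf Cg} => [|i s IH] l; first by rewrite !big_nil.
rewrite !big_cons => Cf Cg /=.
have [| |E C1 C2] := IH (alpha i + l)%N; [by apply: Ck_on_le Cf; lia|by apply: Ck_on_le Cg; lia|].
rewrite {}E; split; [|exact: Ck_on_iter|exact: Ck_on_iter].
elim: (alpha i) l {IH Cf Cg} C1 C2 => //= k IH l C1 C2.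
rewrite (IH l.+1) ?addnS //.
by apply/funext => x; rewrite partialB //; apply: (@Ck_on_derivable _ _ setT l) => //;
  apply: Ck_on_iter; rewrite addnS.
Qed.

End real_parts.

(** * The strips between consecutive knots *)

Section strips.
Context {R : realType} (n N : nat) (t : 'I_N.+1 -> R).

Lemma strip_open j : open [set s : R | (knot t j < s%:E < knot t j.+1)%E].
Proof.
have E x : open [set s : R | (x < s%:E)%E] /\ open [set s : R | (s%:E < x)%E].
  case: x => [r||]; split.
  - rewrite (_ : [set _ | _] = [set s | r < s]); first exact: open_gt.
    by apply/seteqP; split => s /=; rewrite lte_fin.
  - rewrite (_ : [set _ | _] = [set s | s < r]); first exact: open_lt.
    by apply/seteqP; split => s /=; rewrite lte_fin.
  - rewrite (_ : [set _ | _] = set0); first exact: open0.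
    by apply/seteqP; split.
  - rewrite (_ : [set _ | _] = setT); first exact: openT.
    by apply/seteqP; split => s //= _; rewrite ltry.
  - rewrite (_ : [set _ | _] = setT); first exact: openT.
    by apply/seteqP; split => s //= _; rewrite ltNyr.
  - rewrite (_ : [set _ | _] = set0); first exact: open0.
    by apply/seteqP; split.
rewrite (_ : [set _ | _] = [set s : R | (knot t j < s%:E)%E] `&` [set s : R | (s%:E < knot t j.+1)%E]).
  by apply: openI; [exact: (E _).1|exact: (E _).2].
by apply/seteqP; split => s /= => [/andP|] [] // ? ?; apply/andP.
Qed.

(** Take the least j whose right endpoint exceeds s: minimality bounds the left endpoint by s,
    strictly because s is not a knot. *)
Lemma strip_cover s : (forall i, s != t i) ->
  exists2 j, (j <= N.+1)%N & (knot t j < s%:E < knot t j.+1)%E.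
Proof.
move=> st; have P : (s%:E < knot t N.+2)%E.
  by rewrite /= insubF ?ltnn // ltry.
have ex : exists j, (s%:E < knot t j.+1)%E by exists N.+1.
have [j sj minj] := ex_minnP ex; exists j; first exact: minj.
rewrite sj andbT; case: j sj minj => [|j] sj minj; first by rewrite ltNyr.
rewrite lt_neqAle; apply/andP; split.
  by rewrite /=; case: insubP => [i _ _|_] //; rewrite eqe eq_sym st.
by rewrite leNgt; apply/negP => /minj; rewrite ltnn.
Qed.

End strips.

(** * The energy as a quadratic functional *)

Section beppo_functions.
Context {R : realType} (n : nat).
Notation leb := (@lebesgue_measure R).
Notation mu := (lebesgue_rV n.+1).
Implicit Types (h g : 'rV[R]_n.+1 -> R) (F : 'rV[R]_n.+1 -> R[i]).

Lemma beppoB p h g : beppo p h -> beppo p g -> beppo p (fun x => g x - h x).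
Proof.
move=> Bh Bg; have [Ch ph ih] := Bh; have [Cg pg ig] := Bg; split.
- by apply: Ck_onB => //; exact: openT.
- by move=> j x; rewrite (ph j) (pg j).
move=> f fp; have fpE := eqP fp.
rewrite rmderiveB ?fpE //.
have ch := beppo_cont Bh fp; have cg := beppo_cont Bg fp.
rewrite /sqint; under eq_fun do rewrite expr2.
have cB : continuous (fun x => rmderive (fun i => f i : nat) g x - rmderive (fun i => f i : nat) h x).
  by move=> x; apply: continuousB; [exact: cg|exact: ch].
set a := rmderive _ g in cg cB *; set b := rmderive _ h in ch cB *.
pose a2 x := a x ^+ 2; pose b2 x := b x ^+ 2; pose ab x := a x * b x.
have -> : EFin \o (fun x => (a x - b x) * (a x - b x)) =
    (fun x => (a2 x)%:E + (b2 x)%:E - 2%:E * (ab x)%:E)%E.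
  by apply/funext => x; rewrite /= /a2 /b2 /ab; congr EFin; ring.
apply: integrableB; [exact: measurable_slab| |].
  by apply: integrableD; [exact: measurable_slab|exact: ig|exact: ih].
apply: integrableZl; first exact: measurable_slab.
by apply: sqint_mul => //; [exact: ig|exact: ih].
Qed.

Lemma energyB p h g x : Ck_on setT p h -> Ck_on setT p g ->
  energy p g g x = energy p h h x + 2 * energy p h (fun z => g z - h z) x
                   + energy p (fun z => g z - h z) (fun z => g z - h z) x.
Proof.
move=> Ch Cg; rewrite /energy mulr_sumr -!big_split; apply: eq_bigr => f /eqP fp /=.
by rewrite rmderiveB ?fp //; ring.
Qed.

Definition denergy p h : \bar R := (\int[mu]_(x in @slab R n) (energy p h h x)%:E)%E.

Lemma energy_ge0 p h x : 0 <= energy p h h x.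
Proof. by apply: sumr_ge0 => f _; rewrite mulr_ge0 ?mcoef_ge0 // -expr2 sqr_ge0. Qed.

Lemma denergy_ge0 p h : (0 <= denergy p h)%E.
Proof. by apply: integral_ge0 => x _; rewrite lee_fin energy_ge0. Qed.

Lemma denergy_fin p h : beppo p h -> denergy p h \is a fin_num.
Proof.
by move=> Bh; apply: integrable_fin_num; [exact: measurable_slab|exact: integrable_energy].
Qed.

Lemma denergy_eq0 p g (r : seq R) : beppo p g -> uniq r -> (p <= size r)%N ->
  (forall t y, t \in r -> torus y -> g (point t y) = 0) ->
  denergy p g = 0%E -> forall x, g x = 0.
Proof.
move=> Bg ur pr gr I0; have [Cg pg _] := Bg.
apply: yper_slab_eq0 => //.
apply: (dt_poly_eq0 Cg ur pr _ gr) => t y Ty.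
have := slab_ge0_eq0 (continuous_energy Bg Bg) (energy_ge0 p g) (integrable_energy Bg Bg) I0 t Ty.
move=> E0.
(* This is the multi-index (p, 0, ..., 0). Its term in the energy is a positive multiple of the
   square of the p-th t-derivative, so it vanishes with the sum. *)
pose a : {ffun 'I_n.+1 -> 'I_p.+1} := [ffun i => if i == ord0 then ord_max else ord0].
have ap : (\sum_(i < n.+1) a i == p)%N.
  rewrite (bigD1 ord0) //= ffunE eqxx big1 ?addn0 // => i i0.
  by rewrite ffunE (negbTE i0).
have D : rmderive (fun i => a i : nat) g = iter p (partial ord0) g.
  rewrite rmderive_word ffunE eqxx; congr (iter _ _ _).
  rewrite (_ : flatten _ = [::]) //.
  by elim: (enum 'I_n) => //= j s ->; rewrite ffunE.
have /eqP := E0; rewrite /energy psumr_eq0 => [/allP/(_ a)|f _].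
  rewrite mem_index_enum ap /= => /(_ isT); rewrite mulf_eq0 -expr2 sqrf_eq0 D.
  case/orP => /eqP // /eqP; rewrite gt_eqF // divr_gt0 // ltr0n ?fact_gt0 //.
  by rewrite prodn_gt0 // => i; exact: fact_gt0.
by rewrite mulr_ge0 ?mcoef_ge0 // -expr2 sqr_ge0.
Qed.

Lemma denergyE p F : beppo p (re F) -> beppo p (im F) ->
  B_seminorm p F = ((denergy p (re F) + denergy p (im F)) `^ 2^-1)%E.
Proof.
move=> BR BI; rewrite /B_seminorm; congr (_ `^ _)%E.
rewrite /denergy -(integralD (@measurable_slab R n) (integrable_energy BR BR) (integrable_energy BI BI)).
apply: eq_integral => x _; rewrite /= -EFinD; congr EFin.
rewrite /energy -big_split /=; apply: eq_bigr => f _.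
rewrite normc_sqr -[complex.Re _]/(re _ x) -[complex.Im _]/(im _ x).
by rewrite re_mderive im_mderive /mcoef -mulrDr !expr2.
Qed.

Lemma beppo_reim p F : in_B p F -> beppo p (re F) /\ beppo p (im F).
Proof.
move=> [[CR CI] pF L2].
have bd (f : {ffun 'I_n.+1 -> 'I_p.+1}) (w : 'rV[R]_n.+1 -> R) :
    (\sum_(i < n.+1) f i == p)%N -> continuous w ->
    (forall x, w x ^+ 2 <= ComplexField.Normc.normc (mderive (fun i => f i : nat) F x) ^+ 2) ->
    sqint w.
  move=> /eqP fp cw le; have [mR mI fin] := L2 _ fp.
  have mw : measurable_fun (@slab R n) (fun x => w x ^+ 2 : measurableTypeR R).
    apply: (@measurable_funS _ _ _ _ setT) => //.
    apply: continuous_measurable_rV.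
    by under eq_fun do rewrite expr2; exact: continuous_mul.
  apply/integrableP; split; first exact/measurable_EFinP.
  apply: le_lt_trans fin; apply: ge0_le_integral => //.
  - exact: measurable_slab.
  - exact/measurable_EFinP/measurableT_comp.
  - apply/measurable_EFinP.
    under eq_fun do rewrite normc_sqr.
    by apply: measurable_funD; exact: measurable_funX.
  - by move=> x _; rewrite /= lee_fin ger0_norm ?sqr_ge0.
split; split => //.
- by move=> j x; rewrite /re (pF (lift ord0 j)).
- move=> f fp; apply: (bd f) => // [|x].
    by apply: continuous_rmderive; rewrite (eqP fp).
  by rewrite normc_sqr -re_mderive lerDl sqr_ge0.
- by move=> j x; rewrite /im (pF (lift ord0 j)).
- move=> f fp; apply: (bd f) => // [|x].
    by apply: continuous_rmderive; rewrite (eqP fp).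
  by rewrite normc_sqr -im_mderive lerDr sqr_ge0.
Qed.

Lemma denergy_pythagoras m (Z : seq R) h f : (0 < m)%N -> Ck_on setT (2 * m) h ->
  (forall t, t \notin Z -> exists I : set R, [/\ open I, I t,
    Ck_on (layer I) (2 * m.+1) h & forall x, layer I x -> iter m.+1 rlaplacian h x = 0]) ->
  beppo m.+1 h -> beppo m.+1 f ->
  (forall t y, t \in Z -> torus y -> f (point t y) = h (point t y)) ->
  denergy m.+1 f = (denergy m.+1 h + denergy m.+1 (fun x => (f x - h x)%R))%E.
Proof.
move=> m0 Ch Ph Bh Bf fh; set g := (fun x => f x - h x).
have Bg : beppo m.+1 g := beppoB Bh Bf.
have gZ t y : t \in Z -> torus y -> g (point t y) = 0.
  by move=> tZ Ty; rewrite /g fh // subrr.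
have iX := integrable_energy Bh Bg.
rewrite /denergy -(integralD (@measurable_slab R n) (integrable_energy Bh Bh) (integrable_energy Bg Bg)).
transitivity (\int[mu]_(x in @slab R n) ((energy m.+1 h h x)%:E + (energy m.+1 g g x)%:E
   + 2%:E * (energy m.+1 h g x)%:E))%E.
  apply: eq_integral => x _; have [[Ch' _ _] [Cf _ _]] := (Bh, Bf).
  rewrite (energyB _ Ch' Cf) -EFinM -!EFinD; congr EFin; rewrite -/g; ring.
have mS := @measurable_slab R n.
have i1 : mu.-integrable (@slab R n)
    (fun x => (energy m.+1 h h x)%:E + (energy m.+1 g g x)%:E)%E.
  by apply: integrableD => //; exact: integrable_energy.
rewrite (integralD mS i1 (integrableZl mS 2 iX)) (integralZl mS iX).
by rewrite (energy_orthogonality m0 Ch Ph Bh Bg gZ) mule0 adde0.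
Qed.

End beppo_functions.

Theorem theorem3p3 (R : realType) (n p N : nat)
    (n_gt0 : (0 < n)%N) (p_ge2 : (2 <= p)%N) (p_leN : (p <= N.+1)%N)
    (N_gt0 : (0 < N)%N)
    (t : 'I_N.+1 -> R)
    (t_incr : forall i j : 'I_N.+1, (i < j)%N -> (t i < t j)%R)
    (f : 'I_N.+1 -> 'rV[R]_n -> R[i])
    (f_W : forall j : 'I_N.+1, in_W (2 * p - 2) (f j))
    (S : 'rV[R]_n.+1 -> R[i])
    (S_poly : in_S p t S) (S_interp : interpolates t f S)
    (F : 'rV[R]_n.+1 -> R[i])
    (F_B : in_B p F) (F_neq_S : F <> S) (F_interp : interpolates t f F) :
  (B_seminorm p S < B_seminorm p F)%E.
Proof.
case: p p_ge2 p_leN f_W S_poly F_B => [|m] // m0 mN _ [[CR CI] PS pS LS] FB.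
have E2 : (2 * m.+1 - 2 = 2 * m)%N by lia.
rewrite {}E2 in CR CI.
(* With p = m + 1 and m >= 1, the order 2m = 2p - 2 of smoothness is at least p. *)
have SB : in_B m.+1 S.
  by split => //; split; [apply: Ck_on_le CR|apply: Ck_on_le CI]; lia.
have [SR SI] := beppo_reim SB; have [FR FI] := beppo_reim FB.
pose Z := [seq t i | i <- enum 'I_N.+1].
have ZP s : s \notin Z -> exists2 I : set R, open I /\ I s & polyharmonic_on (layer I) m.+1 S.
  move=> sZ; have [|j jN js] := @strip_cover R N t s.
    by move=> i; apply: contra sZ => /eqP ->; apply: map_f; rewrite mem_enum.
  exists [set s : R | (knot t j < s%:E < knot t j.+1)%E]; last exact: PS.
  by split; [exact: strip_open|].
have PR s : s \notin Z -> exists I : set R, [/\ open I, I s,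
    Ck_on (layer I) (2 * m.+1) (re S) & forall x, layer I x -> iter m.+1 rlaplacian (re S) x = 0].
  move=> /ZP[I [oI Is] [[C1 _] L0]]; exists I; split => // x Ix.
  by rewrite -re_laplacian /re L0.
have PI s : s \notin Z -> exists I : set R, [/\ open I, I s,
    Ck_on (layer I) (2 * m.+1) (im S) & forall x, layer I x -> iter m.+1 rlaplacian (im S) x = 0].
  move=> /ZP[I [oI Is] [[_ C1] L0]]; exists I; split => // x Ix.
  by rewrite -im_laplacian /im L0.
have FS s y : s \in Z -> torus y -> F (point s y) = S (point s y).
  by move=> /mapP[i _ ->] Ty; rewrite F_interp // S_interp.
have FSR s y (sZ : s \in Z) (Ty : torus y) : re F (point s y) = re S (point s y).
  by rewrite /re FS.
have FSI s y (sZ : s \in Z) (Ty : torus y) : im F (point s y) = im S (point s y).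
  by rewrite /im FS.
have tinj : injective t.
  move=> i j tij; apply/val_inj; case: (ltngtP i j) => // /t_incr; by rewrite tij ltxx.
have uZ : uniq Z by rewrite map_inj_uniq // enum_uniq.
have sZ : (m.+1 <= size Z)%N by rewrite size_map size_enum_ord.
have GR := beppoB SR FR; have GI := beppoB SI FI.
set gR := fun x => re F x - re S x in GR; set gI := fun x => im F x - im S x in GI.
have zR s y : s \in Z -> torus y -> gR (point s y) = 0.
  by move=> sZ' Ty; rewrite /gR FSR // subrr.
have zI s y : s \in Z -> torus y -> gI (point s y) = 0.
  by move=> sZ' Ty; rewrite /gI FSI // subrr.
have pos : (0 < denergy m.+1 gR + denergy m.+1 gI)%E.
  rewrite lt_neqAle adde_ge0 ?denergy_ge0 // andbT eq_sym.
  rewrite padde_eq0 ?denergy_ge0 //; apply/negP => /andP[/eqP R0 /eqP I0].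
  have gR0 := denergy_eq0 GR uZ sZ zR R0; have gI0 := denergy_eq0 GI uZ sZ zI I0.
  apply: F_neq_S; apply/funext => x; apply/eqP; rewrite eq_complex.
  by apply/andP; split; rewrite -subr_eq0; apply/eqP; [exact: gR0|exact: gI0].
rewrite (denergyE SR SI) (denergyE FR FI).
rewrite (denergy_pythagoras m0 CR PR SR FR FSR) (denergy_pythagoras m0 CI PI SI FI FSI).
rewrite -/gR -/gI [X in (_ < X `^ _)%E]addeACA.
have := denergy_ge0 m.+1 (re S); have := denergy_ge0 m.+1 (im S).
(* Finiteness is essential for strictness: adding a positive energy to an infinite one would change
   nothing. With all four energies real, the strict monotonicity of the square root on nonnegative
   reals concludes. *)
move: pos (denergy_fin SR) (denergy_fin SI) (denergy_fin GR) (denergy_fin GI).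
move: (denergy _ (re S)) (denergy _ (im S)) (denergy _ gR) (denergy _ gI).
move=> [a||] // [b||] // [c||] // [d||] // cd _ _ _ _ b0 a0.
move: cd b0 a0; rewrite -!EFinD !poweR_EFin !lte_fin !lee_fin => cd b0 a0.
have ab0 : 0 <= a + b by exact: addr_ge0.
apply: gt0_ltr_powR; rewrite ?invr_gt0 ?nnegrE ?ltrDl //.
by apply: addr_ge0 => //; exact: ltW.
Qed.
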